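(* Let $n\ge 2$, let $K$ be an algebraically closed field of characteristic zero containing a primitive $n$-th root of unity $\zeta$, and let $H=H_n$ be the Taft Hopf algebra of dimension $n^2$ over $k=\mathbb Q(\zeta)$. For a convolution invertible two-cocycle $\alpha$ on $H$ with values in $K$, let $W={}^\alpha H$ be the corresponding $H$-comodule algebra over $K$, let $t\in W$ be its canonical element, and let $b=t^n\in K$. Then $\alpha\mapsto b$ induces a one-to-one correspondence between the equivalence classes of two-cocycles on $H$ with values in $K$ and the elements of $K$. Moreover, the field of invariants of the comodule algebra corresponding to $b$ is $K_0=\mathbb Q(\zeta,b)$.
   Context: Taft algebra and cocycles. $H_n=k\langle g,x\rangle/(g^n-1,x^n,gxg^{-1}-\zeta x)$ with $\Delta(g)=g\otimes g$, $\Delta(x)=x\otimes1+g\otimes x$. The comodule algebra ${}^\alpha H$ is $H\otimes_kK$ as a right $H$-comodule, with multiplication $x\cdot_\alpha y=\alpha(x_1,y_1)x_2y_2$. Two cocycles are equivalent iff the corresponding $H$-comodule algebras are isomorphic. Write $\tilde h\in W$ for the element corresponding to $h\in H$ and let $f\in H^*$ act on $W$ by $T_f=(\mathrm{Id}\otimes f)\rho$, $\rho$ the coaction. Define $\gamma,\xi\in H^*$ by $\gamma(g^ix^j)=\zeta^i\delta_{j,0}$, $\xi(g^ix^j)=\delta_{j,1}$ ($0\le i,j\le n-1$). For $i,j\in\mathbb Z/n$ put $W_{i,j}=\{y\in W:\gamma(y)=\zeta^iy,\ \tilde g y\tilde g^{-1}=\zeta^jy\}$. There is a unique $t\in W_{-1,1}$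 with $\xi(t)=1$, called here the canonical element, and $t^n\in K\cdot 1$. Structures. $\mathrm{Vec}_K$ is the category of finite-dimensional $K$-vector spaces; $W^{p,q}=W^{\otimes p}\otimes (W^* )^{\otimes q}$. A finite-dimensional structure over $K$ is a finite-dimensional $K$-space $W$ with a family of tensors $x_i\in W^{p_i,q_i}$. The comodule algebra $W={}^\alpha H$ is regarded as the structure given by its multiplication (in $W^{1,2}$) and the operators $T_f\in W^{1,1}$, $f\in H^*$. Kernel completion. Let $\mathcal C$ be a small additive symmetric monoidal rigid category with a faithful additive symmetric monoidal functor $F:\mathcal C\to\mathcal A$ to an abelian symmetric monoidal rigid category. A sequence in $\mathcal C$ is good if $F$ maps it to an exact sequence; $\mathcal C$ is good if every $f:A\to B$ fits in a good sequence $X\to A\to B$ (this is automatic if $\mathcal A=\mathrm{Vec}_K$). For $\mathcal C$ good, let $X^{f,g}\subseteq \mathrm{Hom}_{\mathcal A}(\ker F(f),\ker F(g))$ ($f,g$ morphisms of $\mathcal C$) be the smallest collection of abelian subgroups such that: (1) if $X\xrightarrow{f_1}Y\xrightarrow{f_0}A\xrightarrow{f}B$ is good, $g:C\to D$, $h:Y\to C$, $gh=0$, $hf_1=0$, then the induced map $\ker F(f)\cong \mathrm{coker} F(f_1)\to\ker F(g)$ is in $X^{f,g}$; (2) it is closed under composition; (3) if $a\in X^{f,g}$ is invertible in $\mathcal A$ then $a^{-1}\in X^{g,f}$. The category $\mathrm{Ker}(\mathcal C)_F$ has one object $K(f)$ for each morphism $f$ of $\mathcal C$, $\mathrm{Hom}(K(f),K(g))=X^{f,g}$,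 and composition as in $\mathcal A$. It is additive rigid symmetric monoidal, with $K(f)\otimes K(g)=K(f\otimes 1\oplus 1\otimes g)$ and tensor product of morphisms and symmetry as in $\mathcal A$; it has faithful additive symmetric monoidal functors $\widetilde F:K(f)\mapsto\ker F(f)$ to $\mathcal A$ and $I:A\mapsto K(A\to0)$ from $\mathcal C$, with $\widetilde FI\cong F$. Fundamental category. Let $S^{p,q}\subseteq W^{p,q}$ be the smallest collection of $\mathbb Q$-subspaces such that: $x_i\in S^{p_i,q_i}$; $\mathrm{Id}_W\in S^{1,1}$; $x\in S^{p,q},y\in S^{r,s}$ implies $x\otimes y\in S^{p+r,q+s}$ (after rearranging factors); evaluating the first copy of $W^*$ on the first copy of $W$ sends $S^{p,q}$ to $S^{p-1,q-1}$; $S^{p,q}$ is stable under $S_p\times S_q$ permuting tensor factors; if $0\ne x\in S^{0,0}\subseteq K$ then $x^{-1}\in S^{0,0}$. Let $\mathcal C_0$ have objects $(p,q)\in\mathbb N^2$, $\mathrm{Hom}((p,q),(a,b))=S^{a+q,b+p}\subseteq W^{a+q,b+p}=\mathrm{Hom}_K(W^{p,q},W^{a,b})$ with composition of linear maps, $(p,q)\otimes(a,b)=(p+a,q+b)$, $(p,q)^*=(q,p)$, and $F_0((p,q))=W^{p,q}$. Let $\mathcal C_1$ be its additive envelope (formal finite direct sums), with $F_1$ induced by $F_0$, and $\mathcal C_{m+1}=\mathrm{Ker}(\mathcal C_m)_{F_m}$, $F_{m+1}=\widetilde{F_m}$ for $m\ge1$. Put $\mathcal C_W=\varinjlim \mathcal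 C_m$, with induced functor $F:\mathcal C_W\to\mathrm{Vec}_K$. Then $\mathcal C_W$ is an abelian rigid symmetric monoidal category and $F$ is exact, faithful, additive and symmetric monoidal. The field of invariants of $W$ is $K_0=\mathrm{End}_{\mathcal C_W}(\mathbf 1)$, a subfield of $K$ via $F$. *)

(* Defs.v *)
From HB Require Import structures.
From mathcomp Require Import all_boot all_order all_algebra all_fingroup all_field.

Set Implicit Arguments.
Unset Strict Implicit.
Unset Printing Implicit Defensive.

Import GRing.Theory.
Local Open Scope ring_scope.

(* R^o rather than R, so that these are R-modules. *)
Notation fspace R J := {ffun J%type -> R^o}.

Definition bas (R : nzRingType) (J : finType) (c : J) : fspace R J :=
  [ffun d => (d == c)%:R].

(* The smallest subfield of K containing A; it is Q(A) in characteristic zero. *)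
Inductive gen_field (K : fieldType) (A : K -> Prop) : K -> Prop :=
| gf_in x of A x : gen_field A x
| gf_1 : gen_field A 1
| gf_B x y of gen_field A x & gen_field A y : gen_field A (x - y)
| gf_div x y of gen_field A x & gen_field A y : gen_field A (x / y).

(* H_n over F, with parameter z, in its basis g^i x^j, 0 <= i, j < n, indexed *)
(* by (i, j). From gxg^-1 = zx one gets                                      *)
(*        (g^i x^j)(g^k x^l) = z^(-jk) g^(i+k) x^(j+l).                      *)
(* [taft_mulA], [taft_mul1l], [taft_mul1r] and [taft_presentation] below     *)
(* check that this is the algebra F<g,x>/(g^n-1, x^n, gxg^-1-zx) when z^n=1. *)
Section TaftAlgebra.
Variables (F : fieldType) (n : nat) (z : F).

Definition tidx := ('I_n * 'I_n)%type.
Definition taft := fspace F tidx.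
(* H (x) H, in the basis of pairs *)
Definition taft2 := fspace F (tidx * tidx).

(* g^i x^j for arbitrary i, j: the exponent of g is reduced mod n, and the   *)
(* value is 0 for j >= n.                                                    *)
Definition taft_mon (i j : nat) : taft :=
  [ffun a : tidx => (((a.1 : nat) == i %% n)%N && ((a.2 : nat) == j))%:R].

Definition taft1 : taft := taft_mon 0 0.
Definition taftg : taft := taft_mon 1 0.
Definition taftx : taft := taft_mon 0 1.

Definition taft_mul (u v : taft) : taft :=
  \sum_(a : tidx) \sum_(b : tidx)
    (u a * v b * z ^- (a.2 * b.1)) *: taft_mon (a.1 + b.1) (a.2 + b.2).

Lemma taft_mul_linear u : linear (taft_mul u).
Proof.
move=> c v w; rewrite /taft_mul scaler_sumr -big_split; apply: eq_bigr => a _.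
rewrite /= scaler_sumr -big_split; apply: eq_bigr => b _.
by rewrite /= !ffunE scalerA -scalerDl mulrDr mulrDl mulrCA !mulrA.
Qed.

HB.instance Definition _ u :=
  GRing.isLinear.Build F taft taft _ (taft_mul u) (taft_mul_linear u).

Definition taft_mulr v u := taft_mul u v.

Lemma taft_mulr_linear v : linear (taft_mulr v).
Proof.
move=> c u w; rewrite /taft_mul scaler_sumr -big_split.
apply: eq_bigr => a _; rewrite /= scaler_sumr -big_split; apply: eq_bigr => b _.
by rewrite /= !ffunE scalerA -scalerDl !mulrDl !mulrA.
Qed.

HB.instance Definition _ v :=
  GRing.isLinear.Build F taft taft _ (taft_mulr v) (taft_mulr_linear v).

Lemma taft_mul0l v : taft_mul 0 v = 0.
Proof. exact: (linear0 (taft_mulr v)). Qed.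

Lemma taft_mulZl c u v : taft_mul (c *: u) v = c *: taft_mul u v.
Proof.
by have := taft_mulr_linear v c u 0; rewrite /taft_mulr taft_mul0l !addr0.
Qed.

Lemma taft_mul_suml (I : finType) (f : I -> taft) v :
  taft_mul (\sum_(i : I) f i) v = \sum_(i : I) taft_mul (f i) v.
Proof. exact: (linear_sum (taft_mulr v)). Qed.

Lemma taft_mulZr c u v : taft_mul u (c *: v) = c *: taft_mul u v.
Proof. by rewrite linearZ. Qed.

Section Presentation.
Hypotheses (n_gt0 : (0 < n)%N) (z_n : z ^+ n = 1).

Let z_neq0 : z != 0.
Proof.
apply/eqP=> z0; move: z_n; rewrite z0 expr0n -(prednK n_gt0) /= => /eqP.
by rewrite eq_sym oner_eq0.
Qed.

Lemma taft_mon_mod i j : taft_mon (i %% n) j = taft_mon i j.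
Proof. by apply/ffunP=> a; rewrite !ffunE modn_mod. Qed.

Lemma taft_mon0 i j : (n <= j)%N -> taft_mon i j = 0.
Proof.
move=> nj; apply/ffunP=> a; rewrite !ffunE; case: eqP => //= _.
by case: eqP => // aj; move: (ltn_ord a.2); rewrite aj ltnNge nj.
Qed.

Lemma taft_monE i j (ltj : (j < n)%N) :
  taft_mon i j = bas F (Ordinal (ltn_pmod i n_gt0), Ordinal ltj).
Proof. by apply/ffunP=> -[a b]; rewrite !ffunE. Qed.

Lemma taft_basE (a : tidx) : bas F a = taft_mon a.1 a.2.
Proof. by case: a => a b; apply/ffunP=> -[c d]; rewrite !ffunE modn_small. Qed.

Lemma taft_expand (u : taft) : u = \sum_(a : tidx) u a *: taft_mon a.1 a.2.
Proof.
apply/ffunP=> b; rewrite sum_ffunE (bigD1 b) //= big1 => [|a ab].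
  by rewrite addr0 -taft_basE !ffunE eqxx [_ *: _]mulr1.
by rewrite -taft_basE !ffunE eq_sym (negPf ab) [_ *: _]mulr0.
Qed.

Lemma taft_mul_mon i j i' j' :
  taft_mul (taft_mon i j) (taft_mon i' j') =
  z ^- (j * i') *: taft_mon (i + i') (j + j').
Proof.
have [nj|ltj] := leqP n j.
  rewrite (@taft_mon0 i) // (@taft_mon0 _ (j + j')) ?(leq_trans nj) ?leq_addr //.
  by rewrite scaler0 taft_mul0l.
have [nj|ltj'] := leqP n j'.
  rewrite (@taft_mon0 i') // (@taft_mon0 _ (j + j')) ?(leq_trans nj) ?leq_addl //.
  by rewrite scaler0 linear0.
rewrite (taft_monE i ltj) (taft_monE i' ltj') /taft_mul.
set a0 := (_, Ordinal ltj); set b0 := (_, Ordinal ltj').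
rewrite (bigD1 a0) //= (bigD1 b0) //= !ffunE !eqxx !mul1r.
rewrite big1 => [|b /negPf bN]; last by rewrite !ffunE bN mulr0 mul0r scale0r.
rewrite big1 => [|a /negPf aN]; last first.
  by rewrite big1 // => b _; rewrite !ffunE aN !mul0r scale0r.
rewrite !addr0 -[taft_mon (_ + _) _]taft_mon_mod modnDm taft_mon_mod.
congr (_ *: _); congr (_^-1); rewrite [in RHS](divn_eq i' n) mulnDr exprD mulnA.
by rewrite [(_ * n)%N]mulnC [z ^+ (n * _)]exprM z_n expr1n mul1r.
Qed.

Lemma taft_mul1l u : taft_mul taft1 u = u.
Proof.
rewrite [in RHS](taft_expand u) [in LHS](taft_expand u) linear_sum.
apply: eq_bigr => a _; rewrite linearZ /= taft_mul_mon mul0n !add0n.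
by rewrite expr0 invr1 scale1r.
Qed.

Lemma taft_mul1r u : taft_mul u taft1 = u.
Proof.
rewrite [in RHS](taft_expand u) [in LHS](taft_expand u).
rewrite taft_mul_suml; apply: eq_bigr => a _.
rewrite taft_mulZl taft_mul_mon muln0 !addn0.
by rewrite expr0 invr1 scale1r.
Qed.

Lemma taft_ext (f g : {linear taft -> taft}) :
  (forall i j, f (taft_mon i j) = g (taft_mon i j)) -> f =1 g.
Proof.
move=> fg u; rewrite (taft_expand u) (linear_sum f) (linear_sum g).
by apply: eq_bigr => a _; rewrite !linearZ /= fg.
Qed.

Lemma taft_mulA u v w : taft_mul u (taft_mul v w) = taft_mul (taft_mul u v) w.
Proof.
apply: (@taft_ext (taft_mul u \o taft_mul v) (taft_mul (taft_mul u v))).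
move=> i j /=.
apply: (@taft_ext (taft_mul u \o taft_mulr (taft_mon i j))
                  (taft_mulr (taft_mon i j) \o taft_mul u)).
move=> i' j' /=.
apply: (@taft_ext (taft_mulr (taft_mul (taft_mon i' j') (taft_mon i j)))
                  (taft_mulr (taft_mon i j) \o taft_mulr (taft_mon i' j'))).
move=> a b; rewrite /= /taft_mulr !taft_mul_mon linearZ /= taft_mulZl.
rewrite !taft_mul_mon !scalerA !addnA -!invfM -!exprD.
congr (_ *: _); congr (_ ^- _).
by rewrite mulnDr mulnDl addnCA [(j' * i + _)%N]addnC.
Qed.

Definition taft_rel (A : algType F) (g x : A) : Prop :=
  [/\ g ^+ n = 1, x ^+ n = 0 & g * x = z *: (x * g)].

Definition taft_hom (A : algType F) (g x : A) (phi : taft -> A) : Prop :=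
  [/\ linear phi, phi taft1 = 1,
      forall u v, phi (taft_mul u v) = phi u * phi v,
      phi taftg = g & phi taftx = x].

Lemma taft_monX i j :
  taft_mon i j = iter i (taft_mul taftg) (iter j (taft_mul taftx) taft1).
Proof.
elim: i => [|i IHi] /=; last first.
  by rewrite -IHi taft_mul_mon mul0n expr0 invr1 scale1r add1n.
elim: j => [|j IHj] //=.
by rewrite -IHj taft_mul_mon muln0 expr0 invr1 scale1r add1n.
Qed.

Lemma taft_presentation :
  [/\ iter n (taft_mul taftg) taft1 = taft1,
      iter n (taft_mul taftx) taft1 = 0,
      taft_mul taftg taftx = z *: taft_mul taftx taftg
    & forall (A : algType F) (g x : A), taft_rel g x ->
        exists2 phi, taft_hom g x phi & forall psi, taft_hom g x psi -> psi =1 phi].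
Proof.
split.
- by rewrite -(taft_monX n 0) -taft_mon_mod modnn.
- by have := taft_monX 0 n; rewrite taft_mon0 /= => [<-|].
- rewrite !taft_mul_mon mul0n muln1 addn0 add0n expr0 invr1 scale1r scalerA.
  by rewrite expr1 divff // scale1r.
move=> A g x [gn xn gx].
pose phi (u : taft) := \sum_(a : tidx) u a *: (g ^+ a.1 * x ^+ a.2).
have phiL : linear phi.
  move=> c u v; rewrite /phi scaler_sumr -big_split; apply: eq_bigr => a _.
  by rewrite /= !ffunE scalerDl scalerA.
pose phil : {linear taft -> A} :=
  HB.pack phi (GRing.isLinear.Build F taft A _ phi phiL).
have phi0 : phi 0 = 0 := linear0 phil.
have phis (f : tidx -> taft) : phi (\sum_a f a) = \sum_a phi (f a).
  exact: (linear_sum phil).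
have phiZ c u : phi (c *: u) = c *: phi u.
  by have := phiL c u 0; rewrite phi0 !addr0.
have phim i j : phi (taft_mon i j) = g ^+ i * x ^+ j.
  have [nj|ltj] := leqP n j.
    by rewrite taft_mon0 // phi0 -(subnK nj) exprD xn !mulr0.
  rewrite (taft_monE _ ltj) /phi (bigD1 (Ordinal (ltn_pmod i n_gt0), Ordinal ltj)) //=.
  rewrite big1 => [|a /negPf aN]; last by rewrite ffunE aN scale0r.
  rewrite ffunE eqxx scale1r addr0 [in RHS](divn_eq i n) exprD mulnC exprM gn.
  by rewrite expr1n mul1r.
have xg i : x * g ^+ i = z ^- i *: (g ^+ i * x).
  elim: i => [|i IHi]; first by rewrite !expr0 invr1 scale1r mul1r mulr1.
  have xg1 : x * g = z^-1 *: (g * x) by rewrite gx scalerA mulVf // scale1r.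
  have ->: x * g ^+ i.+1 = z^-1 *: (g * (x * g ^+ i)).
    by rewrite exprS mulrA xg1 -scalerAl -!mulrA.
  by rewrite IHi -scalerAr scalerA mulrA -exprS -invfM -exprS.
have xxg j i : x ^+ j * g ^+ i = z ^- (j * i) *: (g ^+ i * x ^+ j).
  elim: j => [|j IHj]; first by rewrite !expr0 invr1 scale1r mul1r mulr1.
  have -> : x ^+ j.+1 * g ^+ i = z ^- (j * i) *: (x * g ^+ i * x ^+ j).
    by rewrite [x ^+ j.+1]exprS -mulrA IHj -scalerAr mulrA.
  rewrite xg -scalerAl scalerA.
  by rewrite -mulrA -exprS -invfM -exprD mulSn addnC.
exists phi => [|psi [psiL psi1 psiM psig psix] u].
  split=> //.
  - by rewrite phim mulr1.
  - move=> u v; rewrite (taft_expand u) (taft_mul_suml _ v) !phis mulr_suml.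
    apply: eq_bigr => a _; rewrite taft_mulZl !phiZ -scalerAl; congr (_ *: _).
    rewrite {u} (taft_expand v) (linear_sum (taft_mul (taft_mon a.1 a.2))) !phis
            mulr_sumr.
    apply: eq_bigr => b _; rewrite /= taft_mulZr !phiZ -scalerAr.
    congr (_ *: _); rewrite taft_mul_mon phiZ !phim -mulrA [x ^+ _ * _]mulrA xxg.
    by rewrite -scalerAl -scalerAr !exprD !mulrA.
  - by rewrite phim mulr1.
  - by rewrite phim mul1r.
pose psil : {linear taft -> A} :=
  HB.pack psi (GRing.isLinear.Build F taft A _ psi psiL).
have psi0 : psi 0 = 0 := linear0 psil.
have psis (f : tidx -> taft) : psi (\sum_a f a) = \sum_a psi (f a).
  exact: (linear_sum psil).
rewrite (taft_expand u) phis psis; apply: eq_bigr => a _.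
have -> c w : psi (c *: w) = c *: psi w.
  by have := psiL c w 0; rewrite psi0 !addr0.
rewrite phiZ phim; congr (_ *: _).
rewrite taft_monX; elim: (nat_of_ord a.1) => [|i IHi] /=; last first.
  by rewrite psiM IHi psig exprS mulrA.
elim: (nat_of_ord a.2) => [|j IHj] /=; first by rewrite psi1 mulr1.
by rewrite psiM IHj psix exprS !mul1r.
Qed.

End Presentation.

Definition taft_tens (u v : taft) : taft2 := [ffun p => u p.1 * v p.2].

Definition taft2_mul (U V : taft2) : taft2 :=
  \sum_(p : tidx * tidx) \sum_(q : tidx * tidx) (U p * V q) *:
    taft_tens (taft_mul (bas F p.1) (bas F q.1))
              (taft_mul (bas F p.2) (bas F q.2)).

(* Delta (g^i x^j) = (g (x) g)^i (x (x) 1 + g (x) x)^j *)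
Definition taft_comul (a : tidx) : taft2 :=
  iter a.1 (taft2_mul (taft_tens taftg taftg))
    (iter a.2 (taft2_mul (taft_tens taftx taft1 + taft_tens taftg taftx))
      (taft_tens taft1 taft1)).

(* epsilon (g^i x^j), where epsilon(g) = 1 and epsilon(x) = 0 *)
Definition taft_counit (a : tidx) : F := ((a.2 : nat) == 0%N)%:R.

End TaftAlgebra.

Section Cocycles.
Variables (k K : fieldType) (iota : {rmorphism k -> K}) (n : nat) (zeta : k).

Local Notation I := (tidx n).
Local Notation H := (taft k n).
Local Notation Delta a := (@taft_comul k n zeta a).
Local Notation hmul u v := (taft_mul zeta u v).
Local Notation ebas := (bas k).

(* A k-linear map H (x) H -> K, given by its values on the basis *)
Definition cochain := fspace K (I * I).

Definition capp (al : cochain) (u v : H) : K :=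
  \sum_(a : I) \sum_(b : I) iota (u a) * iota (v b) * al (a, b).

(* (al * be)(x, y) = al(x_1, y_1) be(x_2, y_2) *)
Definition conv (al be : cochain) : cochain :=
  [ffun ab : I * I => \sum_(p : I * I) \sum_(q : I * I)
     iota (Delta ab.1 p) * iota (Delta ab.2 q) *
       (al (p.1, q.1) * be (p.2, q.2))].

Definition conv1 : cochain :=
  [ffun ab : I * I => iota (taft_counit k ab.1) * iota (taft_counit k ab.2)].

Definition conv_invertible (al : cochain) : Prop :=
  exists be, conv al be = conv1 /\ conv be al = conv1.

(* al(x_1, y_1) al(x_2 y_2, z) = al(y_1, z_1) al(x, y_2 z_2). There is no    *)
(* normalization: the unit of the resulting algebra is al(1, 1)^-1 times the *)
(* element corresponding to 1.                                               *)
Definition cocycle_eq (al : cochain) : Prop :=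
  forall a b c : I,
    \sum_(p : I * I) \sum_(q : I * I)
      iota (Delta a p) * iota (Delta b q) *
        (al (p.1, q.1) * capp al (hmul (ebas p.2) (ebas q.2)) (ebas c))
  = \sum_(q : I * I) \sum_(r : I * I)
      iota (Delta b q) * iota (Delta c r) *
        (al (q.1, r.1) * capp al (ebas a) (hmul (ebas q.2) (ebas r.2))).

Definition two_cocycle (al : cochain) : Prop :=
  conv_invertible al /\ cocycle_eq al.

(* The space of the comodule algebra: H (x)_k K *)
Definition twist := fspace K I.

(* The element of H (x)_k K corresponding to h in H *)
Definition tw (h : H) : twist := [ffun c => iota (h c)].

(* The K-bilinear product with x . y = al(x_1, y_1) x_2 y_2 for x, y in H *)
Definition twist_mul (al : cochain) (u v : twist) : twist :=
  \sum_(a : I) \sum_(b : I) (u a * v b) *: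
    \sum_(p : I * I) \sum_(q : I * I)
      (iota (Delta a p) * iota (Delta b q) * al (p.1, q.1)) *:
        tw (hmul (ebas p.2) (ebas q.2)).

(* rho : W -> W (x)_k H, the latter with K-basis the pairs *)
Definition coact (u : twist) : fspace K (I * I) :=
  [ffun p => \sum_(a : I) u a * iota (Delta a p)].

(* T_f for f in H^*, a k-valued functional given by its values on the basis *)
Definition Top (f : fspace k I) (u : twist) : twist :=
  [ffun c => \sum_(d : I) coact u (c, d) * iota (f d)].

Definition is_one (al : cochain) (u : twist) : Prop :=
  forall w, twist_mul al u w = w /\ twist_mul al w u = w.

Definition comodule_algebra_iso (al be : cochain) (phi : 'End(twist)) : Prop :=
  [/\ bijective phi,
      forall u v, phi (twist_mul al u v) = twist_mul be (phi u) (phi v),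
      forall u, is_one al u -> is_one be (phi u)
    & forall u, coact (phi u) =
        [ffun p => phi [ffun c => coact u (c, p.2)] p.1]].

Definition cocycle_equiv (al be : cochain) : Prop :=
  exists phi, comodule_algebra_iso al be phi.

Definition gammaf : fspace k I :=
  [ffun a : I => zeta ^+ a.1 * ((a.2 : nat) == 0%N)%:R].
Definition xif : fspace k I := [ffun a : I => ((a.2 : nat) == 1%N)%:R].

(* W_{i,j}; since zeta^n = 1, i and j only matter modulo n. *)
Definition Wcomp (al : cochain) (i j : int) (y : twist) : Prop :=
  Top gammaf y = (iota zeta ^ i) *: y /\
  exists ginv : twist,
    [/\ is_one al (twist_mul al (tw (taftg k n)) ginv),
        is_one al (twist_mul al ginv (tw (taftg k n)))
      & twist_mul al (twist_mul al (tw (taftg k n)) y) ginv =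
          (iota zeta ^ j) *: y].

(* xi(t) = 1 reads: T_xi t is the unit of W. *)
Definition canonical_element (al : cochain) (t : twist) : Prop :=
  Wcomp al (-1) 1 t /\ is_one al (Top xif t).

(* b is the scalar such that t^n = b.1, t being the canonical element. *)
Definition canonical_scalar (al : cochain) (b : K) : Prop :=
  exists t one : twist,
    [/\ unique (canonical_element al) t,
        is_one al one
      & iter n (twist_mul al t) one = b *: one].

End Cocycles.

Notation tix J p q := ({ffun 'I_p -> J} * {ffun 'I_q -> J})%type.

Section Tensors.
Variables (K : fieldType) (J : finType).

(* W^{p,q} for W = K^J, in coordinates: the entry at (u, v) has upper        *)
(* (i.e. W-) indices u and lower (i.e. W^*-) indices v.                      *)
Definition tensor (p q : nat) :=
  fspace K (tix J p q).

(* A family of tensors, as a set of tensors *)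
Definition structure := forall p q, tensor p q -> Prop.

Definition joinf p q (u : {ffun 'I_p -> J}) (v : {ffun 'I_q -> J}) :
  {ffun 'I_(p + q) -> J} :=
  [ffun i => match split i with inl j => u j | inr j => v j end].
Definition lpart p q (u : {ffun 'I_(p + q) -> J}) : {ffun 'I_p -> J} :=
  [ffun i => u (lshift q i)].
Definition rpart p q (u : {ffun 'I_(p + q) -> J}) : {ffun 'I_q -> J} :=
  [ffun i => u (rshift p i)].
Definition consf p (c : J) (u : {ffun 'I_p -> J}) : {ffun 'I_p.+1 -> J} :=
  [ffun i => if unlift ord0 i is Some j then u j else c].

Definition tens_id : tensor 1 1 := 
  [ffun w : tix J 1 1 => (w.1 ord0 == w.2 ord0)%:R].

Definition tens_scalar (c : K) : tensor 0 0 := [ffun=> c].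

Definition tens_mul p q r s (x : tensor p q) (y : tensor r s) :
  tensor (p + r) (q + s) :=
  [ffun w => x (lpart w.1, lpart w.2) * y (rpart w.1, rpart w.2)].

(* Evaluation of the first copy of W^* on the first copy of W *)
Definition tens_contr p q (x : tensor p.+1 q.+1) : tensor p q :=
  [ffun w => \sum_(c : J) x (consf c w.1, consf c w.2)].

Definition tens_perm p q (s : 'S_p) (t : 'S_q) (x : tensor p q) : tensor p q :=
  [ffun w : tix J p q => x ([ffun i => w.1 (s i)], [ffun i => w.2 (t i)])].

(* The linear map W^{p,q} -> W^{a,b} given by x in W^{a+q,b+p}: the last q   *)
(* upper (resp. last p lower) indices of x are contracted with the lower     *)
(* (resp. upper) indices of the argument.                                    *)
Definition tens_act p q a b (x : tensor (a + q) (b + p)) (y : tensor p q) :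
  tensor a b :=
  [ffun w => \sum_(s : {ffun 'I_p -> J}) \sum_(r : {ffun 'I_q -> J})
     x (joinf w.1 r, joinf w.2 s) * y (s, r)].

(* S^{p,q} *)
Inductive invS (gens : structure) : forall p q, tensor p q -> Prop :=
| iS_gen p q (x : tensor p q) of gens p q x : invS gens x
| iS_id : invS gens tens_id
| iS_0 p q : invS gens (0 : tensor p q)
| iS_D p q (x y : tensor p q) of invS gens x & invS gens y :
    invS gens (x + y)
| iS_Z p q (c : rat) (x : tensor p q) of invS gens x :
    invS gens ((ratr c : K) *: x)
| iS_mul p q r s (x : tensor p q) (y : tensor r s)
    of invS gens x & invS gens y : invS gens (tens_mul x y)
| iS_contr p q (x : tensor p.+1 q.+1) of invS gens x :
    invS gens (tens_contr x)
| iS_perm p q (s : 'S_p) (t : 'S_q) (x : tensor p q) of invS gens x :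
    invS gens (tens_perm s t x)
| iS_inv (c : K) of c != 0 & invS gens (tens_scalar c) :
    invS gens (tens_scalar c^-1).

End Tensors.

(* A small category with zero object and a faithful functor F to Vec_K: a    *)
(* morphism A -> B is identified with its image F A -> F B, so composition   *)
(* and tensor product of morphisms are those of Vec_K. Only the data         *)
(* entering the construction of Ker(C)_F and of its direct limit are kept:   *)
(* neither of these refers to the tensor product of objects.                 *)
Record vcat (K : fieldType) := VCat {
  obj : Type;
  fib : obj -> vectType K;
  hom : forall A B, 'Hom(fib A, fib B) -> Prop;
  hom0 : forall A B, hom (0 : 'Hom(fib A, fib B));
  zobj : obj
}.

Arguments obj {K} v.
Arguments fib {K v} _.
Arguments hom {K v A B} _.
Arguments hom0 {K} v A B.
Arguments zobj {K} v.

Record mor (K : fieldType) (C : vcat K) := Mor {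
  dom : obj C;
  cod : obj C;
  arr : 'Hom(fib dom, fib cod);
  arrP : hom arr
}.

Section KernelCompletion.
Variables (K : fieldType) (C : vcat K).

(* ker F(f) *)
Definition kfib (f : mor C) : vectType K := subvs_of (lker (arr f)).

(* X^{f,g}. In [X_base] the good sequence is X -f1-> Y -f0-> A -f-> B, and   *)
(* the last hypothesis says that a : ker f -> ker g is the map induced by h  *)
(* through ker f = im f0 = coker f1.                                         *)
Inductive kerX : forall f g : mor C, 'Hom(kfib f, kfib g) -> Prop :=
| X_base (X Y : obj C) (f g : mor C)
    (f1 : 'Hom(fib X, fib Y)) (f0 : 'Hom(fib Y, fib (dom f)))
    (h : 'Hom(fib Y, fib (dom g))) (a : 'Hom(kfib f, kfib g)) :
    hom f1 -> hom f0 -> hom h ->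
    limg f1 = lker f0 -> limg f0 = lker (arr f) ->
    (arr g \o h = 0)%VF -> (h \o f1 = 0)%VF ->
    (forall (y : fib Y) (u : kfib f), vsval u = f0 y -> vsval (a u) = h y) ->
    kerX a
| X_0 f g : kerX (0 : 'Hom(kfib f, kfib g))
| X_D f g (a b : 'Hom(kfib f, kfib g)) of kerX a & kerX b : kerX (a + b)
| X_N f g (a : 'Hom(kfib f, kfib g)) of kerX a : kerX (- a)
| X_comp f g h (a : 'Hom(kfib f, kfib g)) (b : 'Hom(kfib g, kfib h))
    of kerX a & kerX b : kerX (b \o a)%VF
| X_inv f g (a : 'Hom(kfib f, kfib g)) (b : 'Hom(kfib g, kfib f)) :
    kerX a -> (b \o a = \1)%VF -> (a \o b = \1)%VF -> kerX b.

(* I(A) = K(A -> 0) *)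
Definition kemb (A : obj C) : mor C := Mor (hom0 C A (zobj C)).

Definition kerCat : vcat K :=
  {| obj := mor C; fib := kfib; hom := kerX; hom0 := X_0;
     zobj := kemb (zobj C) |}.

(* I on morphisms, given the isomorphism F A = ker (F A -> 0) *)
Definition klift (A B : obj C) (f : 'Hom(fib A, fib B)) :
  'Hom(kfib (kemb A), kfib (kemb B)) :=
  linfun (fun u => vsproj (lker (arr (kemb B))) (f (vsval u))).

End KernelCompletion.

Section KernelLimit.
Variables (K : fieldType) (C : vcat K).

(* The m-th category in the sequence C, Ker(C), Ker(Ker(C)), ... *)
Definition kerIter (m : nat) : vcat K := iter m (@kerCat K) C.

Fixpoint kembIter m (A : obj C) : obj (kerIter m) :=
  match m with
  | 0 => A
  | m'.+1 => kemb (kembIter m' A)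
  end.

Fixpoint kliftIter m (A B : obj C) (f : 'Hom(fib A, fib B)) :
  'Hom(fib (kembIter m A), fib (kembIter m B)) :=
  match m with
  | 0 => f
  | m'.+1 => @klift K (kerIter m') _ _ (kliftIter m' f)
  end.

(* The morphisms A -> B in the direct limit of the sequence *)
Definition limHom (A B : obj C) (f : 'Hom(fib A, fib B)) : Prop :=
  exists m, hom (kliftIter m f).

End KernelLimit.

Section FundamentalCategory.
Variables (K : fieldType) (J : finType) (gens : structure K J).

(* C_0 *)
Definition fib0 (o : nat * nat) : vectType K := tensor K J o.1 o.2.

Definition hom_0 (o o' : nat * nat) (f : fib0 o -> fib0 o') : Prop :=
  exists2 x : tensor K J (o'.1 + o.2) (o'.2 + o.1),
    invS gens x & forall y, f y = tens_act x y.

(* C_1, the additive envelope of C_0: objects are the formal sums of objects *)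
(* of C_0, and a morphism is a matrix of morphisms of C_0.                   *)
Fixpoint fib1 (s : seq (nat * nat)) : vectType K :=
  match s with
  | [::] => 'rV[K]_0
  | o :: s' => (fib0 o * fib1 s')%type
  end.

Fixpoint hom_row (o : nat * nat) (t : seq (nat * nat)) :
  (fib0 o -> fib1 t) -> Prop :=
  match t return (fib0 o -> fib1 t) -> Prop with
  | [::] => fun _ => True
  | o' :: t' => fun f =>
      @hom_0 o o' (fun y => (f y).1) /\ @hom_row o t' (fun y => (f y).2)
  end.

Fixpoint hom_mat (s t : seq (nat * nat)) : (fib1 s -> fib1 t) -> Prop :=
  match s return (fib1 s -> fib1 t) -> Prop with
  | [::] => fun _ => True
  | o :: s' => fun f =>
      @hom_row o t (fun y => f (y, 0)) /\ @hom_mat s' t (fun y => f (0, y))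
  end.

Definition hom_1 (s t : seq (nat * nat)) (f : 'Hom(fib1 s, fib1 t)) : Prop :=
  @hom_mat s t f.

Lemma hom_1_0 (s t : seq (nat * nat)) : hom_1 (0 : 'Hom(fib1 s, fib1 t)).
Proof.
have row0 o (f : fib0 o -> fib1 t) : (forall y, f y = 0) -> hom_row f.
  elim: t f => //= o' t IHt f f0; split; last by apply: IHt => y; rewrite f0.
  exists 0 => [|y]; first exact: iS_0.
  rewrite f0; apply/ffunP=> w; rewrite !ffunE big1 // => u _.
  by rewrite big1 // => v _; rewrite ffunE mul0r.
rewrite /hom_1; have: forall y, (0 : 'Hom(fib1 s, fib1 t)) y = 0.
  by move=> y; rewrite lfunE.
elim: s (fun_of_lfun _) => //= o s IHs f f0.
by split; [apply: row0 => y | apply: IHs => y]; rewrite f0.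
Qed.

Definition cat1 : vcat K :=
  {| obj := seq (nat * nat); fib := fib1; hom := hom_1; hom0 := hom_1_0;
     zobj := [::] |}.

Definition unit1 : obj cat1 := [:: (0%N, 0%N)].

(* K_0 = End(1) in C_W = lim C_m; as F(1) is one-dimensional, End(F(1)) = K. *)
Definition field_of_invariants (c : K) : Prop :=
  @limHom K cat1 unit1 unit1 (c *: \1%VF).

End FundamentalCategory.

Section ComoduleAlgebraStructure.
Variables (k K : fieldType) (iota : {rmorphism k -> K}) (n : nat) (zeta : k).
Local Notation I := (tidx n).

Definition mul_tensor (al : cochain K n) : tensor K I 1 2 :=
  [ffun w : tix I 1 2 =>
     twist_mul iota zeta al (bas K (w.2 ord0)) (bas K (w.2 ord_max))
               (w.1 ord0)].

Definition Top_tensor (f : fspace k I) : tensor K I 1 1 :=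
  [ffun w : tix I 1 1 =>
     Top iota zeta f (bas K (w.2 ord0)) (w.1 ord0)].

Inductive comodule_algebra_structure (al : cochain K n) :
  forall p q, tensor K I p q -> Prop :=
| cas_mul : comodule_algebra_structure al (mul_tensor al)
| cas_Top f : comodule_algebra_structure al (Top_tensor f).

End ComoduleAlgebraStructure.

(* Main.v *)
Require Import Defs.
From HB Require Import structures.
From mathcomp Require Import all_boot all_order all_algebra all_fingroup all_field.
From mathcomp Require boolp classical_sets.
From mathcomp Require Import ring.

(* For b in K let A_b be the algebra generated by g and x with g^n = 1, x^n = b and gx
   = zeta xg; it is a comodule algebra over the Taft algebra by the formulas for
   Delta. In a twisted algebra W, a multiple u of the element of W given by g has u^n
   = 1. The corresponding multiple of the element given by x can be shifted by a
   scalar to some X with u X = zeta X u, because the obstruction is coinvariant, hence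
   scalar; for the same reason X^n is a scalar b. So W is isomorphic to A_b, and the
   canonical element of A_b is g^(-1) x, whose n-th power is b up to a power of zeta.
   Conversely A_b is the twist by the counit applied to its product, a cocycle whose
   inverse comes from A_(-b).

   In the basis transported from A_b all structure tensors have coefficients in k0 =
   Q(zeta, b). If c is not in k0, a k0-linear endomorphism of K killing 1 but not c
   acts on every W^(p,q), hence on all kernels formed from them, and commutes with
   every morphism; so c is not an invariant. In the other direction n^2 zeta is the
   trace of T_f for f = zeta times the counit, and for b <> 0 the trace form of W is
   nondegenerate, so that it becomes invertible in the first kernel category;
   composing its inverse with two functionals of the form w |-> trace (T_f w) gives
   the scalar n^2 zeta / b. *)

Set Implicit Arguments.
Unset Strict Implicit.
Unset Printing Implicit Defensive.

Import GRing.Theory.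
Local Open Scope ring_scope.

(** * Algebras given by structure constants *)

Section Comb.
Variables (K : fieldType).

(** Why b is reached only after kernels are adjoined: give g^i x^j the degree j. No T_f raises the
    degree, and a product loses degree n for each factor b that it produces. In a closed contraction
    of structure tensors the losses sum to zero, so no b survives and S^{0,0} stays inside Q(zeta).
    The inverse of the trace form, a map from the dual of W to W, is the first operation that raises
    the degree, and this one inverse suffices. For the upper bound a map that is merely additive and
    k0-linear is enough. It is not multiplicative and hence incompatible with tensor products, but
    kernels, sums, composites and inverses never mention these; so linear algebra over k0 takes the
    place of the Galois theory of K over k0. Computations in the various products are mostly
    replaced by the universal property of A_b: a map out of it given by g and x is multiplicative,
    and two such maps are compared on g and x. The root of unity enters through Gaussian binomials,
    by (A + B)^n = A^n + B^n for AB = z^(-1) BA. *)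

Definition comb (V : lmodType K) (I : finType) (w : fspace K I) (F : I -> V) : V :=
  \sum_i w i *: F i.

Section CombI.
Variables (V : lmodType K) (I : finType).
Implicit Types (w : fspace K I) (F : I -> V).

Lemma comb_linear F : linear (fun w => comb w F).
Proof.
move=> c u v; rewrite /comb scaler_sumr -big_split; apply: eq_bigr => i _.
by rewrite !ffunE scalerDl scalerA.
Qed.

Lemma combDl F u v : comb (u + v) F = comb u F + comb v F.
Proof. by have := comb_linear F 1 u v; rewrite !scale1r. Qed.

Lemma comb0l F : comb 0 F = 0.
Proof. by rewrite /comb big1 // => i _; rewrite ffunE scale0r. Qed.

Lemma combZl F c u : comb (c *: u) F = c *: comb u F.
Proof. by have := comb_linear F c u 0; rewrite comb0l !addr0. Qed.

Lemma comb_suml (J : finType) (f : J -> fspace K I) F :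
  comb (\sum_j f j) F = \sum_j comb (f j) F.
Proof.
rewrite /comb exchange_big; apply: eq_bigr => i _.
by rewrite sum_ffunE scaler_suml.
Qed.

Lemma comb_bas F i : comb (bas K i) F = F i.
Proof.
rewrite /comb (bigD1 i) //= big1 => [|j /negPf ji]; last by rewrite ffunE ji scale0r.
by rewrite ffunE eqxx scale1r addr0.
Qed.

Lemma eq_comb w F G : F =1 G -> comb w F = comb w G.
Proof. by move=> FG; apply: eq_bigr => i _; rewrite FG. Qed.

Lemma combZr c w F : comb w (fun i => c *: F i) = c *: comb w F.
Proof.
by rewrite /comb scaler_sumr; apply: eq_bigr => i _; rewrite !scalerA mulrC.
Qed.

Lemma combDr w F G : comb w (fun i => F i + G i) = comb w F + comb w G.
Proof. by rewrite /comb -big_split; apply: eq_bigr => i _; rewrite scalerDr. Qed.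

Lemma comb_exchange (J : finType) (u : fspace K I) (v : fspace K J) (F : I -> J -> V) :
  comb u (fun i => comb v (F i)) = comb v (fun j => comb u (F^~ j)).
Proof.
rewrite /comb; under eq_bigr do rewrite scaler_sumr.
rewrite exchange_big; apply: eq_bigr => j _; rewrite scaler_sumr.
by apply: eq_bigr => i _; rewrite !scalerA mulrC.
Qed.

Lemma comb_comp (J : finType) (u : fspace K J) (w : J -> fspace K I) F :
  comb (comb u w) F = comb u (fun j => comb (w j) F).
Proof.
by rewrite {2}/comb comb_suml; apply: eq_bigr => j _; rewrite combZl.
Qed.

Lemma lin_comb (W : lmodType K) (f : V -> W) w F : linear f ->
  f (comb w F) = comb w (fun i => f (F i)).
Proof.
move=> fL; pose g : {linear V -> W} := HB.pack f (GRing.isLinear.Build K V W _ f fL).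
by rewrite /comb -[f]/(g : V -> W) linear_sum; apply: eq_bigr => i _; rewrite linearZ.
Qed.

Lemma comb_lin (W : lmodType K) (f : {linear V -> W}) w F :
  f (comb w F) = comb w (fun i => f (F i)).
Proof. exact: lin_comb (linearP f). Qed.

End CombI.

Lemma comb_id (I : finType) (w : fspace K I) : comb w (@bas K I) = w.
Proof.
apply/ffunP=> i; rewrite sum_ffunE (bigD1 i) //= big1 => [|j /negPf ji].
  by rewrite !ffunE eqxx addr0 [_ *: _]mulr1.
by rewrite !ffunE eq_sym ji [_ *: _]mulr0.
Qed.

Lemma combE (I J : finType) (w : fspace K I) (F : I -> fspace K J) j :
  comb w F j = \sum_i w i * F i j.
Proof. by rewrite sum_ffunE; apply: eq_bigr => i _; rewrite ffunE. Qed.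

Lemma lin_basP (I : finType) (V : lmodType K) (f g : fspace K I -> V) :
  linear f -> linear g -> (forall i, f (bas K i) = g (bas K i)) -> f =1 g.
Proof.
move=> fL gL fg u; rewrite -(comb_id u) !lin_comb //; exact: eq_comb.
Qed.

Definition tens (I J : finType) (u : fspace K I) (v : fspace K J) : fspace K (I * J) :=
  [ffun p => u p.1 * v p.2].

Section Tens.
Variables (I J : finType).
Implicit Types (u : fspace K I) (v : fspace K J).

Lemma tens_linearl v : linear (fun u : fspace K I => tens u v).
Proof. by move=> c u w; apply/ffunP=> p; rewrite !ffunE mulrDl -scalerAl. Qed.

Lemma tens_linearr u : linear (fun v : fspace K J => tens u v).
Proof. by move=> c v w; apply/ffunP=> p; rewrite !ffunE mulrDr -scalerAr. Qed.

Lemma tensZl c u v : tens (c *: u) v = c *: tens u v.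
Proof. by apply/ffunP=> p; rewrite !ffunE -scalerAl. Qed.

Lemma tensZr c u v : tens u (c *: v) = c *: tens u v.
Proof. by apply/ffunP=> p; rewrite !ffunE -scalerAr. Qed.

Lemma tens0r u : tens u (0 : fspace K J) = 0.
Proof. by apply/ffunP=> p; rewrite !ffunE mulr0. Qed.

Lemma tens_bas (i : I) (j : J) : tens (bas K i) (bas K j) = bas K (i, j).
Proof.
by apply/ffunP=> -[a b]; rewrite !ffunE /= -natrM mulnb xpair_eqE.
Qed.

Lemma comb_tens (V : lmodType K) u v (F : I * J -> V) :
  comb (tens u v) F = comb u (fun i => comb v (fun j => F (i, j))).
Proof.
rewrite /comb; under [RHS]eq_bigr do rewrite scaler_sumr.
rewrite pair_bigA; apply: eq_bigr => -[i j] _ /=.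
by rewrite ffunE scalerA.
Qed.

Lemma tens_combl (A : finType) (w : fspace K A) (F : A -> fspace K I) v :
  tens (comb w F) v = comb w (fun a => tens (F a) v).
Proof. exact: (lin_comb _ _ (tens_linearl v)). Qed.

Lemma tens_combr (A : finType) (w : fspace K A) (F : A -> fspace K J) u :
  tens u (comb w F) = comb w (fun a => tens u (F a)).
Proof. exact: (lin_comb _ _ (tens_linearr u)). Qed.

End Tens.
End Comb.

(** The axioms concern basis vectors only, so that they become finite identities between
    coefficients. The unit is an arbitrary vector, because that of a twisted algebra is in general
    only a multiple of the basis vector of 1. *)
Record scalg (K : fieldType) (I : finType) := ScAlg {
  sc : I -> I -> fspace K I;
  sc1 : fspace K I;
  scA : forall a b c,
    comb (sc a b) (fun d => sc d c) = comb (sc b c) (sc a);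
  sc1l : forall a, comb sc1 (fun d => sc d a) = bas K a;
  sc1r : forall a, comb sc1 (sc a) = bas K a;
  sc1_neq0 : sc1 != 0
}.

Section StructureConstants.
Variables (K : fieldType) (I : finType) (A : scalg K I).

(* The phantom A makes the type determine the product. *)
Definition scT : Type := let _ := A in fspace K I.
HB.instance Definition _ := GRing.Lmodule.copy scT (fspace K I).

Definition scmul (u v : scT) : scT := comb u (fun a => comb v (sc A a)).

Lemma scmulA : associative scmul.
Proof.
move=> u v w; rewrite /scmul comb_comp; apply: eq_comb => a.
rewrite !comb_comp; apply: eq_comb => b.
rewrite comb_exchange comb_comp; apply: eq_comb => c.
by rewrite scA.
Qed.

Lemma scmul1l : left_id (sc1 A : scT) scmul.
Proof.
move=> u; rewrite /scmul comb_exchange -[RHS]comb_id.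
by apply: eq_comb => a; rewrite sc1l.
Qed.

Lemma scmul1r : right_id (sc1 A : scT) scmul.
Proof.
by move=> u; rewrite /scmul -[RHS]comb_id; apply: eq_comb => a; rewrite sc1r.
Qed.

Lemma scmulDl : left_distributive scmul +%R.
Proof. by move=> u v w; rewrite /scmul combDl. Qed.

Lemma scmulDr : right_distributive scmul +%R.
Proof.
by move=> u v w; rewrite /scmul -combDr; apply: eq_comb => a; rewrite combDl.
Qed.

HB.instance Definition _ := GRing.Zmodule_isNzRing.Build scT
  scmulA scmul1l scmul1r scmulDl scmulDr (sc1_neq0 A).

Lemma scmulZl (c : K) (u v : scT) : c *: (u * v) = (c *: u) * v.
Proof. by rewrite /GRing.mul /= /scmul combZl. Qed.

HB.instance Definition _ := GRing.Lmodule_isLalgebra.Build K scT scmulZl.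

Lemma scmulZr (c : K) (u v : scT) : c *: (u * v) = u * (c *: v).
Proof.
rewrite /GRing.mul /= /scmul -combZr.
by apply: eq_comb => a; rewrite combZl.
Qed.

HB.instance Definition _ := GRing.Lalgebra_isAlgebra.Build K scT scmulZr.

Lemma sc_bas a b : (bas K a : scT) * (bas K b : scT) = sc A a b.
Proof. by rewrite /GRing.mul /= /scmul !comb_bas. Qed.

Lemma scmulE (u v : scT) : u * v = comb u (fun a => comb v (sc A a)).
Proof. by []. Qed.

Lemma sc1E : 1 = sc1 A :> scT. Proof. by []. Qed.

Lemma sc_basP (R : algType K) (f : scT -> R) : linear f ->
  (forall a b, f (sc A a b) = f (bas K a) * f (bas K b)) ->
  forall u v : scT, f (u * v) = f u * f v.
Proof.
move=> fL fM u v; rewrite scmulE (lin_comb _ _ fL).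
rewrite -[in f u](comb_id u) (lin_comb _ _ fL) /comb mulr_suml.
apply: eq_bigr => a _; rewrite -scalerAl; congr (_ *: _).
rewrite -[in f v](comb_id v) -/(comb _ _) !(lin_comb _ _ fL) /comb mulr_sumr.
by apply: eq_bigr => b _; rewrite -scalerAr fM.
Qed.

End StructureConstants.

Section TensorAlgebra.
Variables (K : fieldType) (I J : finType) (A : scalg K I) (B : scalg K J).

(** The tensor product algebra, needed as the target of the coaction, which is an algebra morphism
    from W to W (x) H. *)
Definition tsc (p q : I * J) : fspace K (I * J) :=
  tens (sc A p.1 q.1) (sc B p.2 q.2).

Lemma tscA a b c : comb (tsc a b) (fun d => tsc d c) = comb (tsc b c) (tsc a).
Proof.
rewrite /tsc !comb_tens /=.
under eq_comb do rewrite -tens_combr scA.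
by rewrite -tens_combl scA tens_combl; apply: eq_comb => a'; rewrite tens_combr.
Qed.

Lemma tsc1l a : comb (tens (sc1 A) (sc1 B)) (fun d => tsc d a) = bas K a.
Proof.
case: a => a b; rewrite /tsc comb_tens /=.
by under eq_comb do rewrite -tens_combr sc1l; rewrite -tens_combl sc1l tens_bas.
Qed.

Lemma tsc1r a : comb (tens (sc1 A) (sc1 B)) (tsc a) = bas K a.
Proof.
case: a => a b; rewrite /tsc comb_tens /=.
by under eq_comb do rewrite -tens_combr sc1r; rewrite -tens_combl sc1r tens_bas.
Qed.

Lemma tsc1_neq0 : tens (sc1 A) (sc1 B) != 0.
Proof.
apply/eqP=> t0; have [a Aa] : exists a, sc1 A a != 0.
  apply/existsP; apply: contraNT (sc1_neq0 A) => /existsPn A0.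
  by apply/eqP/ffunP=> a; rewrite ffunE; apply/eqP/negPn/A0.
have [b Bb] : exists b, sc1 B b != 0.
  apply/existsP; apply: contraNT (sc1_neq0 B) => /existsPn B0.
  by apply/eqP/ffunP=> b; rewrite ffunE; apply/eqP/negPn/B0.
by have /eqP := congr1 (fun f : fspace K (I * J) => f (a, b)) t0;
   rewrite !ffunE mulf_eq0 (negPf Aa) (negPf Bb).
Qed.

Definition tensalg := ScAlg tscA tsc1l tsc1r tsc1_neq0.

Lemma tensM (u u' : scT A) (v v' : scT B) :
  (tens u v : scT tensalg) * (tens u' v' : scT tensalg) = tens (u * u') (v * v').
Proof.
rewrite !scmulE comb_tens tens_combl; apply: eq_comb => a.
rewrite tens_combr.
under [RHS]eq_comb do rewrite tens_combl.
rewrite [RHS]/=; apply: eq_comb => b.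
rewrite comb_tens; apply: eq_comb => a'.
by rewrite tens_combr.
Qed.

End TensorAlgebra.

(** * Gaussian binomials *)

Section QBinomial.
Variables (K : fieldType) (q : K).

(** Gaussian binomials by Pascal's rule and not as quotients of [qfact], since these factorials
    vanish from [n] on when q is a primitive n-th root of unity. *)
Fixpoint qbin (j l : nat) : K :=
  match j, l with
  | _, 0 => 1
  | 0, _.+1 => 0
  | j'.+1, l'.+1 => q ^+ l * qbin j' l + qbin j' l'
  end.

Definition qnum (m : nat) : K := \sum_(i < m) q ^+ i.
Definition qfact (m : nat) : K := \prod_(i < m) qnum i.+1.

Lemma qbin0 j : qbin j 0 = 1. Proof. by case: j. Qed.

Lemma qbin_gt j l : (j < l)%N -> qbin j l = 0.
Proof.
elim: j l => [|j IHj] [|l] //= jl.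
by rewrite !IHj ?mulr0 ?addr0 // (leq_trans _ jl).
Qed.

Lemma qbinn j : qbin j j = 1.
Proof. by elim: j => //= j ->; rewrite qbin_gt // mulr0 add0r. Qed.

Lemma qnumS m : qnum m.+1 = qnum m + q ^+ m.
Proof. by rewrite /qnum big_ord_recr. Qed.

Lemma qnumD l m : qnum (l + m) = qnum l + q ^+ l * qnum m.
Proof.
elim: m => [|m IHm]; first by rewrite addn0 {3}/qnum big_ord0 mulr0 addr0.
by rewrite addnS !qnumS IHm mulrDr addrA exprD.
Qed.

Lemma qfactS m : qfact m.+1 = qfact m * qnum m.+1.
Proof. by rewrite /qfact big_ord_recr. Qed.

(** Stated without division, so that it holds at roots of unity as well. Pascal's rule lowers l or
    m, and the two contributions add up through [qnumD]; hence the induction on l + m. *)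
Lemma qbin_fact l m : qfact l * qfact m * qbin (l + m) l = qfact (l + m).
Proof.
have f0 : qfact 0 = 1 by rewrite /qfact big_ord0.
have [N] := ubnP (l + m); elim: N l m => // N IHN [|l] [|m] lmN.
- by rewrite qbin0 f0 !mulr1.
- by rewrite qbin0 f0 !mulr1 mul1r.
- by rewrite addn0 qbinn f0 !mulr1.
rewrite addSn /= mulrDr.
have E1 : qfact l.+1 * qfact m.+1 * (q ^+ l.+1 * qbin (l + m.+1) l.+1) =
          q ^+ l.+1 * qnum m.+1 * qfact (l + m.+1).
  have H : qfact l.+1 * qfact m * qbin (l + m.+1) l.+1 = qfact (l + m.+1).
    by rewrite -addSnnS IHN // -ltnS (leq_trans _ lmN) // !addSn !addnS.
  by rewrite -H [qfact m.+1]qfactS; ring.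
have E2 : qfact l.+1 * qfact m.+1 * qbin (l + m.+1) l =
          qnum l.+1 * qfact (l + m.+1).
  rewrite -IHN ?(leq_trans _ lmN) // qfactS; ring.
by rewrite E1 E2 qfactS -mulrDl mulrC addrC -qnumD addSn.
Qed.

(** Multiplying B^l A^(j-l) on the left by A costs q^l, and by B nothing, which is Pascal's rule. *)
Lemma qbinomial (R : algType K) (A B : R) j : A * B = q *: (B * A) ->
  (A + B) ^+ j = \sum_(l < j.+1) qbin j l *: (B ^+ l * A ^+ (j - l)).
Proof.
move=> AB; have ABl l : A * B ^+ l = q ^+ l *: (B ^+ l * A).
  elim: l => [|l IHl]; first by rewrite !expr0 scale1r mulr1 mul1r.
  rewrite [B ^+ _]exprS mulrA AB -scalerAl -[B * A * _]mulrA IHl -scalerAr scalerA.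
  by rewrite mulrA -exprS [q ^+ l.+1]exprS.
elim: j => [|j IHj].
  by rewrite big_ord1 /= scale1r !expr0 mulr1.
rewrite exprS IHj mulrDl !mulr_sumr [in RHS]big_ord_recl /= scale1r.
rewrite expr0 mul1r subn0.
have -> : \sum_(i < j.+1) A * (qbin j i *: (B ^+ i * A ^+ (j - i))) =
   A ^+ j.+1 + \sum_(i < j.+1)
      (q ^+ i.+1 * qbin j i.+1) *: (B ^+ i.+1 * A ^+ (j - i)).
  rewrite big_ord_recl [in RHS]big_ord_recr /= (@qbin_gt j j.+1) // mulr0 scale0r addr0.
  rewrite qbin0 scale1r expr0 mul1r subn0 exprS; congr (_ + _).
  apply: eq_bigr => i _; rewrite -scalerAr mulrA ABl -scalerAl scalerA mulrC.
  by rewrite -mulrA -exprS /bump /= add1n subnSK.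
rewrite -addrA -big_split; congr (_ + _); apply: eq_bigr => i _ /=.
by rewrite /bump /= add1n subSS scalerDl -scalerAr mulrA -exprS.
Qed.

Section Root.
Variables (n : nat) (n_gt1 : (1 < n)%N) (qP : n.-primitive_root q).

Lemma prim_neq1 : q != 1.
Proof.
apply/eqP=> q1; have := prim_order_dvd qP 1; rewrite q1 expr1 eqxx.
by rewrite dvdn1 => /eqP n1; have := n_gt1; rewrite n1.
Qed.

Lemma qnum_neq0 m : (0 < m < n)%N -> qnum m != 0.
Proof.
case/andP=> m0 mn; apply/eqP=> E.
have /eqP : q ^+ m - 1 = 0 by rewrite subrX1 -/(qnum m) E mulr0.
by rewrite subr_eq0 -(prim_order_dvd qP) gtnNdvd.
Qed.

Lemma qnum_prim0 : qnum n = 0.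
Proof.
have /eqP := subrX1 q n; rewrite prim_expr_order // subrr eq_sym mulf_eq0.
by rewrite subr_eq0 (negPf prim_neq1) => /eqP.
Qed.

Lemma qfact_neq0 m : (m < n)%N -> qfact m != 0.
Proof.
move=> mn; apply/prodf_neq0 => i _; apply: qnum_neq0 => /=.
exact: leq_ltn_trans mn.
Qed.

(** In [qbin_fact] the right side contains the factor [qnum n] = 0, whereas the factorials of l and
    n - l are nonzero. *)
Lemma qbin_prim0 l : (0 < l < n)%N -> qbin n l = 0.
Proof.
case/andP=> l0 ln; have := qbin_fact l (n - l); rewrite subnKC 1?ltnW //.
have -> : qfact n = 0.
  by rewrite -(prednK (ltnW n_gt1)) qfactS prednK 1?ltnW // qnum_prim0 mulr0.
move/eqP; rewrite !mulf_eq0 (negPf (qfact_neq0 ln)).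
by rewrite (negPf (qfact_neq0 _)) ?ltn_subrL ?l0 1?ltnW //= => /eqP.
Qed.

(** Both sides are the Gaussian multinomial of l, m and j - l - m; the bound j < n makes the
    factorials cancellable. This is the coefficient identity behind coassociativity. *)
Lemma qbin_trinomial j l m : (l + m <= j < n)%N ->
  qbin j l * qbin (j - l) m = qbin j (l + m) * qbin (l + m) l.
Proof.
case/andP=> lmj jn; pose r := (j - (l + m))%N.
have lt k : (k <= j)%N -> (k < n)%N by move/leq_ltn_trans; apply.
have lj : (l <= j)%N := leq_trans (leq_addr _ _) lmj.
have mj : (m <= j)%N := leq_trans (leq_addl _ _) lmj.
apply: (mulfI (qfact_neq0 (lt _ lj))); apply: (mulfI (qfact_neq0 (lt _ mj))).
apply: (mulfI (qfact_neq0 (lt r (leq_subr _ _)))).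
have E1 := qbin_fact l (m + r); have E2 := qbin_fact m r.
have E3 := qbin_fact (l + m) r; have E4 := qbin_fact l m.
have jE : j = (l + m + r)%N by rewrite subnKC.
have jE' : j = (l + (m + r))%N by rewrite addnA.
have -> : (j - l = m + r)%N by rewrite jE' addKn.
rewrite -jE in E3; rewrite -jE' in E1.
transitivity (qfact j); first by rewrite -E1 -E2; ring.
by rewrite -E3 -E4; ring.
Qed.

(** Only the two extreme terms survive. Applied to x (x) 1 + g (x) x, this shows that the coaction
    respects the relation x^n = b. *)
Lemma qbinomial_prim (R : algType K) (A B : R) : A * B = q *: (B * A) ->
  (A + B) ^+ n = A ^+ n + B ^+ n.
Proof.
move=> AB; have n0 := ltnW n_gt1; rewrite (qbinomial n AB).
rewrite (bigD1 ord0) //= (bigD1 ord_max) /=; last by rewrite -val_eqE /= -lt0n.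
rewrite big1 => [|i /andP[i0 im]].
  by rewrite addr0 qbinn qbin0 !scale1r subn0 subnn !expr0 mul1r mulr1.
rewrite qbin_prim0 ?scale0r //; rewrite -!val_eqE /= in i0 im.
by rewrite lt0n i0 ltn_neqAle im -ltnS ltn_ord.
Qed.

End Root.
End QBinomial.

(** * The algebra with generators g, x and relations g^n = 1, x^n = b, gx = z xg *)

Section Model.
Variables (K : fieldType) (n : nat) (z : K).
Hypotheses (n_gt1 : (1 < n)%N) (zP : n.-primitive_root z).

Let n_gt0 : (0 < n)%N. Proof. exact: ltnW. Qed.
Let z_n : z ^+ n = 1. Proof. exact: prim_expr_order. Qed.

Lemma prim_neq0 : z != 0.
Proof. by rewrite -unitfE -(unitrX_pos _ n_gt0) z_n unitr1. Qed.

Lemma primV : n.-primitive_root z^-1.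
Proof.
apply/andP; split=> //; apply/forallP=> i.
by rewrite unity_rootE exprVn invr_eq1 -unity_rootE; case/andP: zP => _ /forallP.
Qed.

Local Notation I := (tidx n).
Local Notation e := (@bas K I).

Definition ix (i j : nat) : I :=
  (Ordinal (ltn_pmod i n_gt0), Ordinal (ltn_pmod j n_gt0)).

Lemma ixE (a : I) : ix a.1 a.2 = a.
Proof.
by case: a => i j; congr (_, _); apply/val_inj; rewrite /= modn_small.
Qed.

Lemma eq_ix i j i' j' :
  i = i' %[mod n] -> j = j' %[mod n] -> ix i j = ix i' j'.
Proof. by move=> ii jj; congr (_, _); apply/val_inj. Qed.

(* g^i x^j, with exponents not reduced modulo n. *)
Definition mon (b : K) (i j : nat) : fspace K I := b ^+ (j %/ n) *: e (ix i j).

Lemma mon_small b i j : (j < n)%N -> mon b i j = e (ix i j).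
Proof. by move=> jn; rewrite /mon divn_small // expr0 scale1r. Qed.

Lemma e_mon b (a : I) : e a = mon b a.1 a.2.
Proof. by rewrite mon_small ?ixE. Qed.

Lemma mon_mod b i j : mon b (i %% n) j = mon b i j.
Proof. by congr (_ *: e _); apply: eq_ix; rewrite ?modn_mod. Qed.

Lemma mon_ge b i j : mon b i (n + j) = b *: mon b i j.
Proof.
rewrite /mon divnDl // divnn n_gt0 exprD expr1 scalerA; congr (_ *: e _).
by apply: eq_ix; rewrite ?modnDl.
Qed.

Definition msc b (a c : I) : fspace K I :=
  z ^- (a.2 * c.1) *: mon b (a.1 + c.1) (a.2 + c.2).

Lemma z_mod m : z ^+ (m %% n) = z ^+ m.
Proof. exact: expr_mod. Qed.

Lemma zV_eq m m' : m = m' %[mod n] -> z ^- m = z ^- m'.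
Proof. by move=> mm; rewrite -(z_mod m) mm z_mod. Qed.

Lemma comb_mon b (V : lmodType K) i j (F : I -> V) :
  comb (mon b i j) F = b ^+ (j %/ n) *: F (ix i j).
Proof. by rewrite combZl comb_bas. Qed.

(** The carry in adding j mod n and l mod n accounts for the missing power of b. With unreduced
    exponents allowed, associativity becomes an identity between exponents. *)
Lemma msc_mon b i j k l :
  comb (mon b i j) (fun a => comb (mon b k l) (msc b a)) =
  z ^- (j * k) *: mon b (i + k) (j + l).
Proof.
rewrite !comb_mon /msc /mon !scalerA /=.
congr (_ *: e _); last by apply: eq_ix; rewrite modnDm.
have -> : z ^- (j %% n * (k %% n)) = z ^- (j * k).
  by apply: zV_eq; rewrite modnMm.
have -> : ((j + l) %/ n = j %/ n + (l %/ n + (j %% n + l %% n) %/ n))%N.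
  by rewrite {1}(divn_eq j n) {1}(divn_eq l n) addnACA -mulnDl divnMDl // addnA.
rewrite !exprD; move: (z ^- _) (b ^+ (j %/ n)) (b ^+ (l %/ n)) (b ^+ (_ %/ n)).
by move=> *; ring.
Qed.

Lemma mscA b a c d :
  comb (msc b a c) (fun x => msc b x d) = comb (msc b c d) (msc b a).
Proof.
have E i j a' : comb (mon b i j) (fun x => msc b x a') =
    z ^- (j * a'.1) *: mon b (i + a'.1) (j + a'.2).
  rewrite -msc_mon -e_mon; apply: eq_comb => x; by rewrite comb_bas.
have E' i j a' : comb (mon b i j) (msc b a') =
    z ^- (a'.2 * i) *: mon b (a'.1 + i) (a'.2 + j).
  by rewrite -msc_mon -e_mon comb_bas.
rewrite [comb (msc b a c) _]combZl [comb (msc b c d) _]combZl E E'.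
rewrite !scalerA -!invfM -!exprD !addnA; congr (_ *: _); congr (_ ^- _ * _); ring.
Qed.

Lemma msc1l b a : comb (mon b 0 0) (fun x => msc b x a) = e a.
Proof.
have := msc_mon b 0 0 a.1 a.2; rewrite mul0n expr0 invr1 scale1r !add0n -e_mon => <-.
by apply: eq_comb => x; rewrite comb_bas.
Qed.

Lemma msc1r b a : comb (mon b 0 0) (msc b a) = e a.
Proof.
have := msc_mon b a.1 a.2 0 0; rewrite muln0 expr0 invr1 scale1r !addn0 -e_mon.
by rewrite comb_bas.
Qed.

Lemma e_neq0 a : e a != 0.
Proof.
apply/eqP=> /(congr1 (fun f : fspace K I => f a)) /eqP.
by rewrite !ffunE eqxx oner_eq0.
Qed.

Lemma mon1_neq0 b : mon b 0 0 != 0.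
Proof. by rewrite mon_small // e_neq0. Qed.

Definition model b : scalg K I :=
  ScAlg (mscA b) (msc1l b) (msc1r b) (mon1_neq0 b).

Local Notation mo b i j := (mon b i j : scT (model b)).

Lemma monM b i j k l :
  mo b i j * mo b k l = z ^- (j * k) *: mon b (i + k) (j + l).
Proof. exact: msc_mon. Qed.

Lemma mon1E b : mon b 0 0 = 1 :> scT (model b). Proof. by []. Qed.

(** The x^j of each factor passes the g^i of all later factors, with one z^(-ij) for each of the
    C(m,2) pairs. *)
Lemma monX b i j m : mo b i j ^+ m =
  z ^- (i * j * 'C(m, 2)) *: mon b (m * i) (m * j).
Proof.
elim: m => [|m IHm]; first by rewrite bin0n muln0 !mul0n expr0 invr1 scale1r.
rewrite exprS IHm -scalerAr monM scalerA -invfM -exprD -!mulSn; congr (_ *: _); congr (_ ^- _).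
by rewrite binS bin1; ring.
Qed.

Lemma monE b i j :
  mon b i j = mo b 1 0 ^+ i * mo b 0 1 ^+ j.
Proof.
rewrite (monX b 1 0) (monX b 0 1) !muln0 !mul0n !muln1 expr0 invr1 !scale1r monM.
by rewrite mul0n expr0 invr1 scale1r addn0 add0n.
Qed.

Lemma model_rel b : [/\ mo b 1 0 ^+ n = 1,
  mo b 0 1 ^+ n = b%:A &
  mo b 1 0 * mo b 0 1 = z *: (mo b 0 1 * mo b 1 0)].
Proof.
split.
- rewrite monX muln0 mul0n expr0 invr1 scale1r muln1 muln0.
  by rewrite -mon_mod modnn.
- rewrite monX mul0n expr0 invr1 scale1r muln1 muln0.
  by have := mon_ge b 0 0; rewrite addn0.
- rewrite !monM !mul0n !muln1 addn0 add0n expr0 invr1 scale1r expr1 scalerA.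
  by rewrite mulfV ?scale1r // prim_neq0.
Qed.

Section Universal.
Variables (b : K) (R : algType K) (G X : R).
Hypotheses (Gn : G ^+ n = 1) (Xn : X ^+ n = b%:A) (GX : G * X = z *: (X * G)).

Definition ev (u : scT (model b)) : R := comb u (fun a => G ^+ a.1 * X ^+ a.2).

Lemma ev_linear : linear ev. Proof. exact: comb_linear. Qed.

Lemma ev_mon i j : ev (mon b i j) = G ^+ i * X ^+ j.
Proof.
rewrite /ev comb_mon /= (expr_mod _ Gn).
by rewrite {3}(divn_eq j n) exprD mulnC exprM Xn exprZn expr1n -scalerAl mul1r -scalerAr.
Qed.

Lemma ev_e a : ev (e a) = G ^+ a.1 * X ^+ a.2.
Proof. by rewrite /ev comb_bas. Qed.

Lemma skew_comm i j : X ^+ j * G ^+ i = z ^- (j * i) *: (G ^+ i * X ^+ j).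
Proof.
have z0 := prim_neq0.
have XG : X * G = z^-1 *: (G * X) by rewrite GX scalerA mulVf // scale1r.
have XGi k : X * G ^+ k = z ^- k *: (G ^+ k * X).
  elim: k => [|k IHk]; first by rewrite !expr0 invr1 scale1r mul1r mulr1.
  rewrite exprS mulrA XG -scalerAl -[G * X * _]mulrA IHk -scalerAr scalerA.
  by rewrite -invfM mulrA -!exprS.
elim: j => [|j IHj]; first by rewrite !expr0 invr1 scale1r mul1r mulr1.
rewrite [in LHS]exprS -mulrA IHj -scalerAr [X * _]mulrA XGi -scalerAl scalerA.
by rewrite -[_ * X * _]mulrA -exprS -invfM -exprD mulSn addnC.
Qed.

Lemma evM u v : ev (u * v) = ev u * ev v.
Proof.
apply: sc_basP; first exact: ev_linear.
move=> a c; rewrite /= /msc -[ev _]/(ev (_ *: _)) /ev combZl -/(ev _) ev_mon.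
rewrite -!/(ev _) !ev_e -mulrA [X ^+ _ * _]mulrA skew_comm -scalerAl -scalerAr.
by rewrite !exprD !mulrA.
Qed.

Lemma ev1 : ev 1 = 1.
Proof. by rewrite -mon1E ev_mon mulr1. Qed.

(** The uniqueness half of the universal property; it will show that a morphism defined on
    generators is colinear. *)
Lemma ev_uniq (f : scT (model b) -> R) : linear f -> f 1 = 1 ->
  (forall u v, f (u * v) = f u * f v) ->
  f (mon b 1 0) = G -> f (mon b 0 1) = X -> f =1 ev.
Proof.
move=> fL f1 fM fG fX; apply: lin_basP => //; first exact: ev_linear.
have fXn u m : f (u ^+ m) = f u ^+ m.
  by elim: m => [|m IHm]; rewrite ?expr0 // !exprS fM IHm.
by move=> a; rewrite ev_e (e_mon b) monE fM !fXn fG fX.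
Qed.

End Universal.
End Model.

(** * The coaction on the model algebras *)

Section Comul.
Variables (K : fieldType) (n : nat) (z : K).
Hypotheses (n_gt1 : (1 < n)%N) (zP : n.-primitive_root z).

Let n_gt0 : (0 < n)%N. Proof. exact: ltnW. Qed.
Let z_n : z ^+ n = 1. Proof. exact: prim_expr_order. Qed.

Local Notation I := (tidx n).
Local Notation e := (@bas K I).
Local Notation ix := (ix n_gt1).
Local Notation mon := (mon n_gt1).
Local Notation model b := (model n_gt1 zP b).
Local Notation mo b i j := (mon b i j : scT (model b)).
Local Notation q := z^-1.

(** The expansion of (g (x) g)^i (x (x) 1 + g (x) x)^j. The parameter is z^(-1) because (x (x) 1)(g
    (x) x) = z^(-1) (g (x) x)(x (x) 1). *)
Definition comul (a : I) : fspace K (I * I) :=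
  \sum_(l < a.2.+1) qbin q a.2 l *: bas K (ix (a.1 + l) (a.2 - l), ix a.1 l).

Definition cocond (a c d : I) : bool :=
  [&& (d.1 == a.1), (c.1 == (a.1 + d.2) %% n :> nat) & (c.2 + d.2 == a.2)]%N.

Lemma comulE a c d : comul a (c, d) = (cocond a c d)%:R * qbin q a.2 d.2.
Proof.
rewrite sum_ffunE; under eq_bigr do rewrite !ffunE /=.
have [|ncd] := boolP (cocond a c d); last first.
  rewrite mul0r big1 // => l _; rewrite [_ *: _]mulrC.
  case: eqP => [[cE dE]|]; last by rewrite mul0r.
  case/negP: ncd; rewrite /cocond cE dE -!val_eqE /=.
  have ln : (l < n)%N := leq_ltn_trans (ltn_ord l : l <= a.2)%N (ltn_ord a.2).
  rewrite (modn_small (ltn_ord a.1)) (modn_small ln) !eqxx /=.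
  rewrite (@modn_small (a.2 - l)) ?(leq_ltn_trans (leq_subr _ _)) //.
  by rewrite subnK // -ltnS.
case/and3P=> /eqP d1 /eqP c1 /eqP c2; rewrite mul1r.
have dl : (d.2 < a.2.+1)%N by rewrite ltnS -c2 leq_addl.
rewrite (bigD1 (Ordinal dl)) //= big1 => [|l lN]; last first.
  case: eqP => [[_ dE]|]; last by rewrite [_ *: _]mulr0.
  have ln : (l < n)%N := leq_ltn_trans (ltn_ord l : l <= a.2)%N (ltn_ord a.2).
  by case/negP: lN; rewrite -val_eqE /= dE /= modn_small.
have cE : c = ix (a.1 + d.2) (a.2 - d.2).
  rewrite -[LHS](ixE n_gt1); apply: eq_ix; first by rewrite c1 modn_mod.
  by rewrite -c2 addnK.
have dE : d = ix a.1 d.2 by rewrite -[LHS](ixE n_gt1) d1.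
by rewrite addr0 -cE -dE eqxx [_ *: _]mulr1.
Qed.

Definition eps (a : I) : K := (a.2 == 0 :> nat)%:R.

Lemma counitl (V : lmodType K) a (F : I -> V) :
  comb (comul a) (fun p => eps p.1 *: F p.2) = F a.
Proof.
rewrite /comb (bigD1 (ix (a.1 + a.2) 0, a)) //= comulE /cocond /eps /=.
rewrite !eqxx mod0n add0n eqxx qbinn mul1r !scale1r.
rewrite big1 ?addr0 // => -[c d] /= cdN; rewrite comulE /eps.
have [c0|] := eqVneq (c.2 : nat) 0%N; last by rewrite !scale0r scaler0.
have [/and3P[/eqP d1 /eqP c1 /eqP c2]|] := boolP (cocond a c d); last first.
  by rewrite mul0r scale0r.
case/negP: cdN; rewrite c0 add0n in c2.
have dE : d = a by case: d a c2 d1 {c1 c0} => ? ? [? ?] /= /val_inj -> ->.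
apply/eqP; congr (_, _) => //; rewrite -[c]ixE c0; apply: eq_ix => //.
by rewrite c1 modn_mod dE.
Qed.

Lemma counitr (V : lmodType K) a (F : I -> V) :
  comb (comul a) (fun p => eps p.2 *: F p.1) = F a.
Proof.
rewrite /comb (bigD1 (a, ix a.1 0)) //= comulE /cocond /eps /=.
rewrite !mod0n !addn0 -val_eqE /= modn_small // !eqxx qbin0 mul1r !scale1r.
rewrite big1 ?addr0 // => -[c d] /= cdN; rewrite comulE /eps.
have [d0|] := eqVneq (d.2 : nat) 0%N; last by rewrite !scale0r scaler0.
have [/and3P[/eqP d1 /eqP c1 /eqP c2]|] := boolP (cocond a c d); last first.
  by rewrite mul0r scale0r.
case/negP: cdN; rewrite d0 addn0 in c2; rewrite d0 addn0 modn_small // in c1.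
apply/eqP; congr (_, _); last by rewrite -[d]ixE d0 d1.
by case: c a c2 c1 {d1} => ? ? [? ?] /= /val_inj -> /val_inj ->.
Qed.

(** On either side at most one [i] contributes, and under the same condition on b, c, d; what
    remains is [qbin_trinomial]. *)
Lemma coassoc_coef a b c d :
  \sum_i comul a (i, d) * comul i (b, c) = \sum_i comul a (b, i) * comul i (c, d).
Proof.
have qnz : n.-primitive_root q := primV n_gt1 zP.
have modS i j : ((i %% n + j) %% n = (i + j) %% n)%N by rewrite modnDml.
have [cd|Ncd] := boolP [&& d.1 == a.1, (c.1 == (a.1 + d.2) %% n :> nat),
   (b.1 == (a.1 + (c.2 + d.2)) %% n :> nat) & b.2 + c.2 + d.2 == a.2]%N; last first.
  rewrite !big1 // => i _; rewrite !comulE /cocond.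
    have [/and3P[/eqP E1 /eqP E2 /eqP E3]|] := boolP [&& _, _ & _]; last first.
      by rewrite !mul0r.
    have [/and3P[/eqP F1 /eqP F2 /eqP F3]|] := boolP [&& _, _ & _]; last first.
      by rewrite mul0r mulr0.
    case/negP: Ncd; apply/and4P; split; apply/eqP.
    - by rewrite F1 -E1.
    - by rewrite F2 -E1.
    - by rewrite E2 -F3.
    - by rewrite -addnA F3.
  have [/and3P[/eqP E1 /eqP E2 /eqP E3]|] := boolP [&& _, _ & _]; last first.
    by rewrite !mul0r.
  have [/and3P[/eqP F1 /eqP F2 /eqP F3]|] := boolP [&& _, _ & _]; last first.
    by rewrite mul0r mulr0.
  case/negP: Ncd; apply/and4P; split; apply/eqP.
  - by rewrite E1.
  - by rewrite F1 E2.
  - by rewrite F2 E2 modS -addnA [(d.2 + _)%N]addnC.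
  - by rewrite F3.
case/and4P: cd => /eqP d1 /eqP c1 /eqP b1 /eqP b2.
have cdn : (c.2 + d.2 < n)%N.
  by rewrite (leq_ltn_trans _ (ltn_ord a.2)) // -b2 -addnA leq_addl.
have bcn : (b.2 + c.2 < n)%N.
  by rewrite (leq_ltn_trans _ (ltn_ord a.2)) // -b2 leq_addr.
rewrite (bigD1 (ix (a.1 + d.2) (b.2 + c.2))) //= big1 ?addr0; last first.
  move=> i iN; rewrite !comulE /cocond.
  have [/and3P[/eqP E1 /eqP E2 /eqP E3]|] := boolP [&& _, _ & _]; last first.
    by rewrite !mul0r.
  have [/and3P[/eqP F1 /eqP F2 /eqP F3]|] := boolP [&& _, _ & _]; last first.
    by rewrite mul0r mulr0.
  case/negP: iN; apply/eqP; rewrite -[i]ixE; apply: eq_ix; first by rewrite E2 modn_mod.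
  by rewrite F3.
rewrite (bigD1 (ix d.1 (c.2 + d.2))) //= big1 ?addr0; last first.
  move=> i iN; rewrite !comulE /cocond.
  have [/and3P[/eqP E1 /eqP E2 /eqP E3]|] := boolP [&& _, _ & _]; last first.
    by rewrite !mul0r.
  have [/and3P[/eqP F1 /eqP F2 /eqP F3]|] := boolP [&& _, _ & _]; last first.
    by rewrite mul0r mulr0.
  case/negP: iN; apply/eqP; rewrite -[i]ixE; apply: eq_ix; first by rewrite F1.
  by rewrite F3.
rewrite !comulE /cocond /= -!val_eqE /= !(modn_small bcn) !(modn_small cdn).
rewrite d1 c1 b1 b2 (modn_small (ltn_ord a.1)) modS !addnA !eqxx /=.
rewrite [(a.1 + d.2 + c.2)%N]addnAC b2 !eqxx !mul1r.
have -> : (b.2 + c.2 = a.2 - d.2)%N by rewrite -b2 addnK.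
rewrite [(c.2 + d.2)%N]addnC (@qbin_trinomial _ q n) //.
by rewrite ltn_ord andbT -b2 addnC -addnA leq_addl.
Qed.

(** The Sweedler form: the two ways of splitting a into three parts may be exchanged inside any
    expression in them. *)
Lemma coassoc (V : lmodType K) a (F : I -> I -> I -> V) :
  comb (comul a) (fun p => comb (comul p.2) (fun r => F p.1 r.1 r.2)) =
  comb (comul a) (fun p => comb (comul p.1) (fun r => F r.1 r.2 p.2)).
Proof.
have E1 (w : fspace K (I * I)) (G : I -> I -> V) :
    comb w (fun p => G p.1 p.2) = \sum_b \sum_c w (b, c) *: G b c.
  by rewrite pair_bigA /=; apply: eq_bigr => -[].
rewrite (E1 _ (fun b i => comb (comul i) (fun r => F b r.1 r.2))).
rewrite (E1 _ (fun i d => comb (comul i) (fun r => F r.1 r.2 d))).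
under eq_bigr => b _ do under eq_bigr => i _ do rewrite (E1 _ (fun c d => F b c d)).
under [RHS]eq_bigr => i _ do under eq_bigr => d _ do rewrite (E1 _ (fun b c => F b c d)).
transitivity (\sum_b \sum_c \sum_d (\sum_i comul a (b, i) * comul i (c, d)) *: F b c d).
  apply: eq_bigr => b _; under eq_bigr do rewrite scaler_sumr.
  rewrite exchange_big; apply: eq_bigr => c _; under eq_bigr do rewrite scaler_sumr.
  rewrite exchange_big; apply: eq_bigr => d _; rewrite scaler_suml.
  by apply: eq_bigr => i _; rewrite scalerA.
transitivity (\sum_b \sum_c \sum_d (\sum_i comul a (i, d) * comul i (b, c)) *: F b c d).
  apply: eq_bigr => b _; apply: eq_bigr => c _; apply: eq_bigr => d _.
  by rewrite coassoc_coef.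
symmetry; rewrite exchange_big.
transitivity (\sum_d \sum_b \sum_i \sum_c (comul a (i, d) * comul i (b, c)) *: F b c d).
  apply: eq_bigr => d _; rewrite exchange_big; apply: eq_bigr => i _.
  rewrite scaler_sumr; apply: eq_bigr => b _; rewrite scaler_sumr.
  by apply: eq_bigr => c _; rewrite scalerA.
rewrite exchange_big; apply: eq_bigr => b _.
rewrite [RHS]exchange_big; apply: eq_bigr => d _.
by rewrite exchange_big; apply: eq_bigr => c _; rewrite scaler_suml.
Qed.

(** One linear map for all algebras: the models and the twisted algebras have H as underlying
    comodule, and neither b nor the cocycle enters. *)
Definition rho (u : fspace K I) : fspace K (I * I) := comb u comul.

Lemma rho_linear : linear rho. Proof. exact: comb_linear. Qed.

Lemma rho_e a : rho (e a) = comul a. Proof. exact: comb_bas. Qed.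

Section Rel.
Variable b : K.
Local Notation T := (tensalg (model b) (model 0)).

Lemma tens_exp (I' J' : finType) (A : scalg K I') (B : scalg K J')
    (u : scT A) (v : scT B) m :
  (tens u v : scT (tensalg A B)) ^+ m = tens (u ^+ m) (v ^+ m).
Proof. by elim: m => [|m IHm] //; rewrite !exprS IHm tensM. Qed.

Definition GT : scT T := tens (mo b 1 0) (mo 0 1 0).
Definition XT1 : scT T := tens (mo b 0 1) (mo 0 0 0).
Definition XT2 : scT T := tens (mo b 1 0) (mo 0 0 1).

Lemma rel_XT : XT1 * XT2 = q *: (XT2 * XT1).
Proof.
have [_ _ gx] := model_rel n_gt1 zP b; have z0 := prim_neq0 n_gt1 zP.
have xg : mo b 0 1 * mo b 1 0 = q *: (mo b 1 0 * mo b 0 1).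
  by rewrite gx scalerA mulVf // scale1r.
rewrite !tensM xg tensZl; congr (_ *: tens _ _).
by rewrite mon1E mul1r mulr1.
Qed.

Lemma GT_n : GT ^+ n = 1.
Proof.
have [gn _ _] := model_rel n_gt1 zP b; have [gn0 _ _] := model_rel n_gt1 zP 0.
by rewrite tens_exp gn gn0.
Qed.

(** The power is x^n (x) 1 + g^n (x) x^n, and x^n = 0 in the second tensor factor. *)
Lemma XT_n : (XT1 + XT2) ^+ n = b%:A.
Proof.
have [gn xn _] := model_rel n_gt1 zP b; have [_ xn0 _] := model_rel n_gt1 zP 0.
rewrite (qbinomial_prim n_gt1 (primV n_gt1 zP) rel_XT) !tens_exp xn xn0 gn.
by rewrite mon1E expr1n tensZl scale0r tens0r addr0.
Qed.

Lemma GT_XT : GT * (XT1 + XT2) = z *: ((XT1 + XT2) * GT).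
Proof.
have [_ _ gx] := model_rel n_gt1 zP b; have [_ _ gx0] := model_rel n_gt1 zP 0.
rewrite mulrDr mulrDl scalerDr !tensM gx gx0 tensZl tensZr mon1E mulr1 mul1r.
by [].
Qed.

(** The explicit [rho] is recognized as the algebra morphism that the presentation of A_b provides,
    from which its multiplicativity follows. *)
Lemma rho_ev : rho =1 @ev K n z n_gt1 zP b _ GT (XT1 + XT2).
Proof.
apply: lin_basP; [exact: rho_linear|exact: comb_linear|] => a.
rewrite rho_e ev_e (qbinomial _ rel_XT) mulr_sumr; apply: eq_bigr => l _.
have ln : (l < n)%N := leq_ltn_trans (ltn_ord l : l <= a.2)%N (ltn_ord a.2).
have aln : (a.2 - l < n)%N by rewrite (leq_ltn_trans (leq_subr _ _)).
rewrite -scalerAr !tens_exp !tensM mon1E expr1n mulr1 mulrA -exprD -!monE.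
by rewrite !mon_small // tens_bas.
Qed.

Lemma rhoM (u v : scT (model b)) : rho (u * v) = (rho u : scT T) * rho v.
Proof. by rewrite !rho_ev (evM GT_n XT_n GT_XT). Qed.

Lemma rho1 : rho (1 : scT (model b)) = (1 : scT T).
Proof. by rewrite rho_ev (ev1 _ _ GT_n XT_n). Qed.

End Rel.

Lemma comul_ix0 i : comul (ix i 0) = bas K (ix i 0, ix i 0).
Proof.
rewrite /comul /= mod0n big_ord1 /= scale1r addn0 subn0.
by congr (bas K (_, _)); apply: eq_ix; rewrite ?modn_mod.
Qed.

Lemma comul_ix1 i : comul (ix i 1) = bas K (ix i 1, ix i 0) + bas K (ix i.+1 0, ix i 1).
Proof.
rewrite /comul /= modn_small // big_ord_recl big_ord1 /= /bump /=.
rewrite expr1 mulr0 add0r !scale1r subn0 subnn addn0 addn1.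
have E c c' d d' : c = c' -> d = d' -> bas K (c, d) = bas K (c', d') by move=> -> ->.
congr (_ + _); apply: E; apply: eq_ix; rewrite ?modn_mod //.
by rewrite -addn1 modnDml addn1.
Qed.

Lemma taft_mon_mon i j : taft_mon K n i j = mon 0 i j.
Proof.
have [jn|nj] := ltnP j n.
  rewrite mon_small //; apply/ffunP=> -[a c]; rewrite !ffunE.
  by rewrite xpair_eqE -!val_eqE /= (modn_small jn).
rewrite taft_mon0 //; apply/esym; rewrite /mon.
by rewrite expr0n -leqn0 leqNgt divn_gt0 // nj scale0r.
Qed.

Lemma taft_mulE (u v : scT (model 0)) : taft_mul z u v = u * v.
Proof.
rewrite scmulE /taft_mul /comb; apply: eq_bigr => a _; rewrite scaler_sumr.
by apply: eq_bigr => c _; rewrite taft_mon_mon -!scalerA.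
Qed.

Lemma taft_tensE u v : taft_tens u v = tens u v :> fspace K (I * I).
Proof. by apply/ffunP=> p; rewrite !ffunE. Qed.

Lemma taft2_mulE (U V : scT (tensalg (model 0) (model 0))) : taft2_mul z U V = U * V.
Proof.
rewrite scmulE /taft2_mul /comb; apply: eq_bigr => p _; rewrite scaler_sumr.
apply: eq_bigr => r _; rewrite taft_tensE -scalerA; congr (_ *: (_ *: tens _ _)).
  by rewrite taft_mulE sc_bas.
by rewrite taft_mulE sc_bas.
Qed.

Lemma taft_comulE a : taft_comul z a = comul a.
Proof.
rewrite -rho_e (rho_ev 0) ev_e /taft_comul !taft_tensE /taftg /taftx /taft1 !taft_mon_mon.
have itM (X Y : scT (tensalg (model 0) (model 0))) m :
    iter m (taft2_mul z X) Y = X ^+ m * Y.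
  by elim: m => [|m IHm] /=; rewrite ?mul1r // taft2_mulE IHm exprS mulrA.
by rewrite itM itM -[RHS]mulr1 -mulrA.
Qed.

End Comul.

(** * Twisted algebras are model algebras *)

Section Twist.
Variables (K : fieldType) (n : nat) (z : K).
Hypotheses (n_gt1 : (1 < n)%N) (zP : n.-primitive_root z).

Local Notation I := (tidx n).
Local Notation e := (@bas K I).
Local Notation ix := (ix n_gt1).
Local Notation comul := (comul z n_gt1).
Local Notation rho := (rho z n_gt1).
Local Notation M := (msc z n_gt1 0).
Local Notation e0 := (ix 0 0).
Local Notation coassoc := (coassoc n_gt1 zP).
Local Notation H0 := (model n_gt1 zP 0).

(** Coassociativity in both arguments at once, as a twisted product splits two elements in
    parallel. *)
Lemma coassoc2 (V : lmodType K) (F : I -> I -> I -> I -> I -> I -> V) a b :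
  comb (comul a) (fun p => comb (comul b) (fun r =>
    comb (comul p.2) (fun p' => comb (comul r.2) (fun r' =>
      F p.1 p'.1 p'.2 r.1 r'.1 r'.2)))) =
  comb (comul a) (fun p => comb (comul b) (fun r =>
    comb (comul p.1) (fun p' => comb (comul r.1) (fun r' =>
      F p'.1 p'.2 p.2 r'.1 r'.2 r.2)))).
Proof.
pose G x y t := comb (comul b) (fun r => comb (comul r.1) (fun r' =>
      F x y t r'.1 r'.2 r.2)).
transitivity (comb (comul a) (fun p => comb (comul p.2) (fun p' => G p.1 p'.1 p'.2))).
  apply: eq_comb => p; rewrite comb_exchange; apply: eq_comb => p'.
  exact: (coassoc _ (fun x y t => F p.1 p'.1 p'.2 x y t)).
rewrite coassoc; apply: eq_comb => p; rewrite comb_exchange; apply: eq_comb => p'.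
by [].
Qed.

Lemma rho_msc a b : rho (M a b) = comb (comul a) (fun p => comb (comul b) (fun r =>
    tens (M p.1 r.1) (M p.2 r.2))).
Proof.
have := rhoM (e a : scT H0) (e b : scT H0).
rewrite sc_bas => ->; rewrite !rho_e scmulE.
by [].
Qed.

Section Cocycle.
Variable al : I -> I -> K^o.

Definition csc (a b : I) : fspace K I :=
  comb (comul a) (fun p => comb (comul b) (fun r => al p.1 r.1 *: M p.2 r.2)).

Definition cocycleP := forall a b c,
  comb (comul a) (fun p => comb (comul b) (fun r =>
     al p.1 r.1 *: comb (M p.2 r.2) (fun d => al d c))) =
  comb (comul b) (fun r => comb (comul c) (fun s =>
     al r.1 s.1 *: comb (M r.2 s.2) (al a))).

Definition convP (be : I -> I -> K^o) := forall a b,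
  comb (comul a) (fun p => comb (comul b) (fun r => al p.1 r.1 *: be p.2 r.2)) =
  eps K a * eps K b.

Hypothesis alC : cocycleP.

Lemma comb_csc (V : lmodType K) a b (F : I -> V) : comb (csc a b) F =
  comb (comul a) (fun p => comb (comul b) (fun r => al p.1 r.1 *: comb (M p.2 r.2) F)).
Proof.
rewrite comb_comp; apply: eq_comb => p; rewrite comb_comp; apply: eq_comb => r.
by rewrite combZl.
Qed.

Lemma comb_rho (V : lmodType K) u (F : I * I -> V) :
  comb (rho u) F = comb u (fun d => comb (comul d) F).
Proof. exact: comb_comp. Qed.

Lemma comb_msc (V : lmodType K) a b (F : I -> I -> V) :
  comb (M a b) (fun d => comb (comul d) (fun p => F p.1 p.2)) =
  comb (comul a) (fun p => comb (comul b) (fun r =>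
    comb (M p.1 r.1) (fun d => comb (M p.2 r.2) (F d)))).
Proof.
rewrite -comb_rho rho_msc comb_comp; apply: eq_comb => p.
rewrite comb_comp; apply: eq_comb => r.
by rewrite comb_tens.
Qed.

Lemma comb_scale (J : finType) (V : lmodType K) (w : fspace K J) (f : J -> K^o) (v : V) :
  (comb w f : K) *: v = comb w (fun i => (f i : K) *: v).
Proof. by rewrite /comb scaler_suml; apply: eq_bigr => i _; rewrite scalerA. Qed.

(** In Sweedler notation (ab)c is al(a_1,b_1) al(a_2 b_2, c_1) a_3 b_3 c_2, and a(bc) is al(b_1,c_1)
    al(a_1, b_2 c_2) a_2 b_3 c_3, with products in H. Regrouped by coassociativity, the scalars are
    the two sides [Z1] and [Z2] of the cocycle identity, and what follows them is a product in H. *)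
Lemma cscA a b c : comb (csc a b) (fun d => csc d c) = comb (csc b c) (csc a).
Proof.
have mA p r s : comb (M p r) (fun d => M d s) = comb (M r s) (M p).
  exact: (scA H0).
pose Z1 a b c : K := comb (comul a) (fun p => comb (comul b) (fun r =>
     al p.1 r.1 *: comb (M p.2 r.2) (fun d => al d c))).
pose Z2 a b c : K := comb (comul b) (fun r => comb (comul c) (fun s =>
     al r.1 s.1 *: comb (M r.2 s.2) (al a))).
transitivity (comb (comul a) (fun p => comb (comul b) (fun r => comb (comul c)
   (fun s => Z1 p.1 r.1 s.1 *: comb (M p.2 r.2) (fun d => M d s.2))))).
  rewrite comb_csc.
  have L p r : comb (M p r) (fun d => csc d c) =
    comb (comul p) (fun p' => comb (comul r) (fun r' =>
      comb (M p'.1 r'.1) (fun d => comb (M p'.2 r'.2) (fun t =>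
        comb (comul c) (fun s => al d s.1 *: M t s.2))))).
    exact: (comb_msc _ _ (fun d t => comb (comul c) (fun s => al d s.1 *: M t s.2))).
  under eq_comb => p do under eq_comb => r do rewrite L -combZr.
  under eq_comb => p do under eq_comb => r do under eq_comb => p' do rewrite -combZr.
  apply: (etrans (coassoc2 (fun x y t x' y' t' => al x x' *: comb (M y y') (fun d =>
     comb (M t t') (fun u => comb (comul c) (fun s => al d s.1 *: M u s.2)))) a b)).
  apply: eq_comb => p; apply: eq_comb => r.
  symmetry; under eq_comb => s do rewrite comb_scale.
  rewrite comb_exchange; apply: eq_comb => p'.
  under eq_comb => s do rewrite comb_scale.
  rewrite comb_exchange; apply: eq_comb => r'.
  under eq_comb => s do rewrite -scalerA comb_scale.
  rewrite combZr; congr (_ *: _); rewrite comb_exchange; apply: eq_comb => d.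
  by rewrite [RHS]comb_exchange; apply: eq_comb => s; rewrite combZr.
have Z12 p r s : Z1 p r s = Z2 p r s by exact: alC.
rewrite comb_csc.
have L r s : comb (M r s) (csc a) =
    comb (comul a) (fun p => comb (comul r) (fun r' => comb (comul s) (fun s' =>
      comb (M r'.1 s'.1) (fun d => comb (M r'.2 s'.2) (fun t =>
        al p.1 d *: M p.2 t))))).
  rewrite [LHS]comb_exchange; apply: eq_comb => p.
  exact: (comb_msc _ _ (fun d t => al p.1 d *: M p.2 t)).
transitivity (comb (comul b) (fun r => comb (comul c) (fun s =>
   comb (comul r.2) (fun r' => comb (comul s.2) (fun s' => al r.1 s.1 *:
     comb (comul a) (fun p => comb (M r'.1 s'.1) (fun d => comb (M r'.2 s'.2) (fun t =>
        al p.1 d *: M p.2 t)))))))); last first.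
  apply: eq_comb => r; apply: eq_comb => s; rewrite L.
  rewrite [in RHS]comb_exchange -[RHS]combZr; apply: eq_comb => r'.
  by rewrite [in RHS]comb_exchange -[RHS]combZr.
symmetry; apply: (etrans (coassoc2 (fun x y t x' y' t' => al x x' *:
     comb (comul a) (fun p => comb (M y y') (fun d => comb (M t t') (fun u =>
        al p.1 d *: M p.2 u)))) b c)).
symmetry; rewrite comb_exchange; apply: eq_comb => r.
rewrite comb_exchange; apply: eq_comb => s.
under eq_comb => p do rewrite Z12 comb_scale.
rewrite comb_exchange; apply: eq_comb => r'.
under eq_comb => p do rewrite comb_scale.
rewrite comb_exchange; apply: eq_comb => s'.
under eq_comb => p do rewrite -scalerA comb_scale.
rewrite combZr; congr (_ *: _); apply: eq_comb => p; apply: eq_comb => d.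
by rewrite combZr mA.
Qed.

Section Unit.
Variable be : I -> I -> K^o.
Hypothesis al_be : convP be.

Let al00 : K := al e0 e0.

Lemma e0_mon : e e0 = mon n_gt1 0 0 0 :> fspace K I.
Proof. by rewrite mon_small // ltnW. Qed.

Lemma M0l a : M e0 a = e a.
Proof.
by have := msc1l n_gt1 zP 0 a; rewrite -e0_mon comb_bas.
Qed.

Lemma M0r a : M a e0 = e a.
Proof.
by have := msc1r n_gt1 zP 0 a; rewrite -e0_mon comb_bas.
Qed.

(** In the convolution algebra the hypotheses read x h = h h and h h' = eps; multiplying the first
    by h' on the right gives x eps = h. *)
Lemma unit_fun (h h' : I -> K^o) (x : K) :
  (forall c, x * h c = comb (comul c) (fun s => h s.1 *: h s.2)) ->
  (forall c, comb (comul c) (fun s => h s.1 *: h' s.2) = eps K c) ->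
  forall c, h c = x * eps K c.
Proof.
move=> hh hh' c.
transitivity (comb (comul c) (fun p => (x * h p.1 : K) *: h' p.2)); last first.
  rewrite -hh' /comb mulr_sumr; apply: eq_bigr => p _.
  by rewrite -scalerA; apply: mulrCA.
rewrite -[LHS](counitr z n_gt1 c h); transitivity (comb (comul c) (fun p =>
   comb (comul p.2) (fun r => h p.1 *: (h r.1 *: h' r.2)))).
  by apply: eq_comb => p; rewrite combZr hh'; apply: mulrC.
rewrite (coassoc c (fun x y t => h x *: (h y *: h' t))); apply: eq_comb => p.
by rewrite hh comb_scale; apply: eq_comb => r; rewrite scalerA.
Qed.

Lemma comul_e0 : comul e0 = bas K (e0, e0).
Proof. exact: comul_ix0. Qed.

(** The cocycle identity at (1, 1, c) says al(1,1) al(1,c) = al(1,c_1) al(1,c_2), and be(1,-) is a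
    convolution inverse of al(1,-): [unit_fun] applies. *)
Lemma al_0l c : al e0 c = al00 * eps K c.
Proof.
apply: (@unit_fun (al e0) (be e0)) => {}c; last first.
  have := al_be e0 c; rewrite comul_e0 comb_bas /= => ->.
  by rewrite {1}/eps /= mod0n eqxx mul1r.
have := alC e0 e0 c; rewrite comul_e0 !comb_bas /= M0l comb_bas => -[] .
move=> E; apply: (etrans E); apply: eq_comb => s; by rewrite M0l comb_bas.
Qed.

Lemma al_0r a : al a e0 = al00 * eps K a.
Proof.
apply: (@unit_fun (al^~ e0) (be^~ e0)) => {}c; last first.
  have := al_be c e0; rewrite comul_e0 /= => E.
  transitivity (eps K c * eps K e0); last by rewrite {2}/eps /= mod0n eqxx mulr1.
  by rewrite -E; apply: eq_comb => p; rewrite comb_bas.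
have := alC c e0 e0; rewrite comul_e0 !comb_bas /= M0l comb_bas => E.
apply: (etrans (esym E)).
by apply: eq_comb => s; rewrite comb_bas /= M0r comb_bas.
Qed.

Lemma al_ix0 i j : al (ix i 0) (ix j 0) != 0.
Proof.
have := al_be (ix i 0) (ix j 0); rewrite !comul_ix0 !comb_bas /eps /= mod0n eqxx mulr1.
move=> E; apply/eqP=> al0; have := E; rewrite al0 scale0r => /eqP.
by rewrite eq_sym oner_eq0.
Qed.

Definition csc1 : fspace K I := al00^-1 *: e e0.

Lemma csc1l a : comb csc1 (fun d => csc d a) = e a.
Proof.
rewrite combZl comb_bas /csc comul_e0 comb_bas.
under eq_comb => r do rewrite M0l al_0l -scalerA.
by rewrite combZr scalerA mulVf ?al_ix0 // scale1r counitl.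
Qed.

Lemma csc1r a : comb csc1 (csc a) = e a.
Proof.
rewrite combZl comb_bas /csc.
under eq_comb => r do rewrite comul_e0 comb_bas /= M0r al_0r -scalerA.
by rewrite combZr scalerA mulVf ?al_ix0 // scale1r counitl.
Qed.

Lemma csc1_neq0 : csc1 != 0.
Proof. by rewrite scaler_eq0 invr_eq0 (negPf (al_ix0 _ _)) e_neq0. Qed.

Definition Walg : scalg K I := ScAlg cscA csc1l csc1r csc1_neq0.

Lemma rho_csc a b : rho (csc a b) = comb (comul a) (fun p => comb (comul b) (fun r =>
    tens (csc p.1 r.1) (M p.2 r.2))).
Proof.
rewrite {1}/csc (lin_comb _ _ (rho_linear _ _)).
under eq_comb => p do rewrite (lin_comb _ _ (rho_linear _ _)).
have rhoZ c u : rho (c *: u) = c *: rho u by exact: combZl.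
under eq_comb => p do under eq_comb => r do rewrite rhoZ rho_msc -combZr.
under eq_comb => p do under eq_comb => r do under eq_comb => p' do rewrite -combZr.
apply: (etrans (coassoc2 (fun x y t x' y' t' => al x x' *: tens (M y y') (M t t')) a b)).
apply: eq_comb => p; apply: eq_comb => r; rewrite tens_combl; apply: eq_comb => p'.
by rewrite tens_combl; apply: eq_comb => r'; rewrite [RHS]tensZl.
Qed.

Lemma rhoWM (u v : scT Walg) :
  rho (u * v) = (rho u : scT (tensalg Walg H0)) * rho v.
Proof.
apply: (@sc_basP _ _ Walg (scT (tensalg Walg H0))); first exact: rho_linear.
by move=> a b; rewrite rho_csc !rho_e.
Qed.

Lemma rhoW1 : rho (1 : scT Walg) = (1 : scT (tensalg Walg H0)).
Proof.
rewrite !sc1E /= /csc1 [rho _]combZl comb_bas comul_e0 tensZl -e0_mon.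
by rewrite tens_bas.
Qed.

End Unit.
End Cocycle.
End Twist.

Section Structure.
Variables (K : closedFieldType) (n : nat) (z : K).
Hypotheses (n_gt1 : (1 < n)%N) (zP : n.-primitive_root z).

Local Notation I := (tidx n).
Local Notation e := (@bas K I).
Local Notation ix := (ix n_gt1).
Local Notation comul := (comul z n_gt1).
Local Notation rho := (rho z n_gt1).
Local Notation M := (msc z n_gt1 0).
Local Notation e0 := (ix 0 0).
Local Notation H0 := (model n_gt1 zP 0).
Local Notation model b := (model n_gt1 zP b).

Definition tmul (al : I -> I -> K^o) (u v : fspace K I) : fspace K I :=
  comb u (fun a => comb v (csc z n_gt1 al a)).

Definition tmap (f : fspace K I -> fspace K I) (w : fspace K (I * I)) :
  fspace K (I * I) := comb w (fun p => tens (f (e p.1)) (e p.2)).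

Definition model_iso (al : I -> I -> K^o) (b : K) (phi : 'End(fspace K I)) :=
  [/\ bijective phi,
      forall u v : scT (model b), phi (u * v) = tmul al (phi u) (phi v)
    & forall u, rho (phi u) = tmap phi (rho u)].

Lemma tmap_linear f : linear (tmap f). Proof. exact: comb_linear. Qed.

Lemma tmap_tens f u v : linear f -> tmap f (tens u v) = tens (f u) v.
Proof.
move=> fL; rewrite /tmap comb_tens /=.
under eq_comb do rewrite -tens_combr comb_id.
by rewrite -tens_combl -(lin_comb _ _ fL) comb_id.
Qed.

(** Apply eps (x) id: the left side becomes v by the counit law. With d the index of 1 this says
    that coinvariants are scalars. *)
Lemma semi_invariant v d : rho v = tens v (e d) -> exists c, v = c *: e d.
Proof.
move=> vE; exists (\sum_a v a * eps K a).
have : comb (rho v) (fun p => eps K p.1 *: e p.2) = v.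
  rewrite /rho comb_comp -[RHS]comb_id; apply: eq_comb => a.
  exact: counitl.
rewrite vE comb_tens => E; rewrite -[LHS]E.
under eq_comb do rewrite combZr comb_bas.
by rewrite /comb scaler_suml; apply: eq_bigr => a _; rewrite scalerA.
Qed.

Section Iso.
Variables (al be : I -> I -> K^o).
Hypotheses (alC : cocycleP z n_gt1 al) (al_be : convP z n_gt1 al be).
Local Notation W := (Walg zP alC al_be).
Local Notation WH := (tensalg W H0).

Lemma W1 : (1 : scT W) = (al e0 e0)^-1 *: e e0.
Proof. by []. Qed.

Lemma e0_W1 : e e0 = (al e0 e0 : K) *: (1 : scT W).
Proof. by rewrite W1 scalerA mulfV ?scale1r // (al_ix0 al_be). Qed.

Lemma W_gpow i j : (e (ix i 0) : scT W) * e (ix j 0) =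
  (al (ix i 0) (ix j 0) : K) *: e (ix (i + j) 0).
Proof.
rewrite sc_bas /= /csc !comul_ix0 !comb_bas /= /msc /= !mod0n mul0n expr0 invr1 scale1r.
by rewrite mon_small ?(ltnW n_gt1) //; congr (_ *: e _); apply: eq_ix; rewrite ?modnDm.
Qed.

Definition wg : scT W := e (ix 1 0).

Lemma wgX m : exists2 c, c != 0 & wg ^+ m = c *: e (ix m 0).
Proof.
elim: m => [|m [c c0 cE]].
  by exists (al e0 e0 : K)^-1; rewrite ?invr_neq0 ?(al_ix0 al_be).
exists (c * al (ix 1 0) (ix m 0)); first by rewrite mulf_neq0 ?(al_ix0 al_be).
by rewrite exprS cE -scalerAr W_gpow scalerA add1n.
Qed.

(** wg^n is a nonzero multiple of 1, as al has invertible values at pairs of powers of g; the field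
    being algebraically closed, the multiple can be absorbed into wg. *)
Lemma wg_norm : exists2 lam : K, lam != 0 & (lam *: wg) ^+ n = 1.
Proof.
have [c c0 cE] := wgX n; have a0 := al_ix0 al_be 0 0.
have ca0 : c * al e0 e0 != 0 by rewrite mulf_neq0.
have [lam lamE] := @solve_monicpoly K n
  (fun i => if i == 0%N then (c * al e0 e0)^-1 else 0) (ltnW n_gt1).
have {}lamE : lam ^+ n = (c * al e0 e0)^-1.
  rewrite lamE (bigD1 (Ordinal (ltnW n_gt1))) //= expr0 mulr1 big1 ?addr0 //.
  by move=> i /negPf iN; rewrite -val_eqE /= in iN; rewrite iN mul0r.
exists lam.
  apply/eqP=> l0; move/eqP: lamE; rewrite l0 expr0n gtn_eqF ?(ltnW n_gt1) //=.
  by rewrite eq_sym invr_eq0 (negPf ca0).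
have eE : e (ix n 0) = e e0 by congr (e _); apply: eq_ix; rewrite ?modnn ?mod0n.
rewrite exprZn cE eE e0_W1 !scalerA lamE.
by rewrite -[_ * c * _]mulrA mulVf ?mul1r.
Qed.

Lemma structure_theorem : exists b phi, model_iso al b phi.
Proof.
have [lam lam0 un] := wg_norm; pose u : scT W := lam *: wg.
have n0 := ltnW n_gt1; have z0 := prim_neq0 n_gt1 zP; have z1 := prim_neq1 n_gt1 zP.
rewrite -/u in un.
pose g : scT H0 := e (ix 1 0); pose x : scT H0 := e (ix 0 1).
have gE : g = mon n_gt1 0 1 0 by rewrite mon_small.
have xE : x = mon n_gt1 0 0 1 by rewrite mon_small.
have H1 : e e0 = 1 :> scT H0 by rewrite -mon1E mon_small.
have [gn xn gx] := model_rel n_gt1 zP 0; rewrite -gE -xE in gn xn gx.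
have rhoZ c v : rho (c *: v) = c *: rho v by exact: combZl.
have rhoD v w : rho (v + w) = rho v + rho w by exact: combDl.
have rM := @rhoWM _ _ _ n_gt1 zP al alC be al_be.
have r1 := @rhoW1 _ _ _ n_gt1 zP al alC be al_be.
have rho_u : rho u = tens u g.
  by rewrite rhoZ [rho _]comb_bas comul_ix0 -(tens_bas K (ix 1 0) (ix 1 0)) -tensZl.
(* The factor is the same [lam] as in [u], so that the second term in the coaction of y0 is u (x) x
   with this very u. *)
pose y0 : scT W := lam *: e (ix 0 1).
have rho_y : rho y0 = tens y0 (1 : scT H0) + tens u x.
  rewrite rhoZ [rho _]comb_bas comul_ix1 // -(tens_bas K (ix 0 1) e0).
  rewrite -(tens_bas K (ix 1 0) (ix 0 1)) scalerDr -!tensZl H1.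
  by [].
have coinv (v : scT W) : rho v = tens v (1 : scT H0) -> exists c, v = c *: 1.
  rewrite -H1 => /semi_invariant [c ->]; exists (c * al e0 e0).
  by rewrite e0_W1 scalerA.
pose uV : scT W := u ^+ n.-1; pose gV : scT H0 := g ^+ n.-1.
have uuV : u * uV = 1 by rewrite -exprS prednK.
have uVu : uV * u = 1 by rewrite -exprSr prednK.
have ggV : g * gV = 1 by rewrite -exprS prednK.
have rho_uV : rho uV = tens uV gV.
  rewrite /uV /gV; elim: n.-1 => [|m IHm]; first exact: r1.
  by rewrite !exprS rM IHm rho_u tensM.
(* The term z u (x) x occurs in the coactions of both u y0 u^(-1) and z y0 and cancels, so that the
   difference is coinvariant. *)
have [d dE] : exists d, u * y0 * uV - z *: y0 = d *: 1.
  apply: coinv; have E : rho (u * y0 * uV) = tens (u * y0 * uV) (1 : scT H0) + z *: tens u x.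
    rewrite !rM rho_u rho_y rho_uV mulrDr mulrDl !tensM mulr1 ggV; congr (_ + _).
    rewrite -[u * u * uV]mulrA uuV mulr1 gx -[z *: _ * _]scalerAl tensZr.
    by rewrite -[x * g * gV]mulrA ggV mulr1.
  have tensB v w t : tens (v - z *: w) t = tens v t - z *: tens w t :> fspace K (I * I).
    by apply/ffunP=> p; rewrite !ffunE mulrBl -scalerAl.
  rewrite tensB -scaleN1r rhoD rhoZ rhoZ scaleN1r E rho_y scalerDr opprD.
  by rewrite addrACA subrr addr0.
(* Shifting y0 by c changes the obstruction d into d + c - z c, which vanishes for this c; z differs
   from 1 because n > 1. *)
pose c := d / (z - 1); pose X := y0 + c *: (1 : scT W).
have rhoX : rho X = tens X (1 : scT H0) + tens u x.
  have tensD v w t : tens (v + c *: w) t = tens v t + c *: tens w t :> fspace K (I * I).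
    by apply/ffunP=> p; rewrite !ffunE mulrDl -scalerAl.
  by rewrite rhoD (rhoZ c) r1 rho_y addrAC tensD.
have uX : u * X = z *: (X * u).
  have uy : u * y0 = z *: (y0 * u) + d *: u.
    have /eqP := congr1 (fun v => v * u) dE.
    rewrite mulrBl -[_ * uV * u]mulrA uVu mulr1 -[z *: y0 * u]scalerAl -[d *: 1 * u]scalerAl mul1r.
    rewrite subr_eq addrC.
    by move/eqP.
  have dc : d + c = z * c.
    by rewrite /c; field; rewrite subr_eq0.
  rewrite mulrDr [X * u]mulrDl uy -[u * (c *: 1)]scalerAr mulr1 -[c *: 1 * u]scalerAl mul1r.
  by rewrite scalerDr [z *: (c *: u)]scalerA -addrA -scalerDl dc.
(* The two terms of rho X commute up to z^(-1), and the n-th power of u (x) x is 0; hence X^n is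
   coinvariant. *)
have [b bE] : exists b, X ^+ n = b *: 1.
  apply: coinv; have rhoXn m : rho (X ^+ m) = (rho X : scT WH) ^+ m.
    by elim: m => [|m IHm]; [rewrite r1|rewrite !exprS rM IHm].
  rewrite rhoXn rhoX (qbinomial_prim n_gt1 (primV n_gt1 zP)).
    rewrite !tens_exp expr1n xn un; rewrite scale0r tens0r addr0 //.
  have Xu : X * u = z^-1 *: (u * X) by rewrite uX scalerA mulVf ?scale1r.
  by rewrite !tensM mulr1 mul1r Xu tensZl.
pose f := @ev K n z n_gt1 zP b (scT W) u X.
have fL : linear f by exact: ev_linear.
pose F : {linear fspace K I -> fspace K I} :=
  HB.pack f (GRing.isLinear.Build K (fspace K I) (fspace K I) _ f fL).
exists b, (linfun F).
have fM : forall v w, f (v * w) = f v * f w := evM un bE uX.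
have f1 : f 1 = 1 := ev1 _ _ un bE.
have fg : f (e (ix 1 0)) = u.
  by rewrite -(mon_small n_gt1 b 1 n0) /f (ev_mon _ _ un bE) expr1 expr0 mulr1.
have fx : f (e (ix 0 1)) = X.
  by rewrite -(mon_small n_gt1 b 0 n_gt1) /f (ev_mon _ _ un bE) expr1 expr0 mul1r.
have tmapM (v w : scT (tensalg (model b) H0)) :
    tmap f (v * w) = (tmap f v : scT WH) * tmap f w.
  apply: (@sc_basP _ _ _ (scT WH)); first exact: tmap_linear.
  move=> p r; rewrite /= /tsc tmap_tens // /tmap !comb_bas tensM -fM.
  by rewrite !sc_bas.
(* Both sides are algebra morphisms out of the model with the values rho u and rho X on the
   generators. *)
have rho_f v : rho (f v) = tmap f (rho v).
  transitivity (@ev K n z n_gt1 zP b (scT WH) (rho u) (rho X) v).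
    apply: (@ev_uniq _ _ _ _ zP b _ _ _ (fun v => rho (f v) : scT WH)).
    - by move=> a v1 v2; rewrite fL; apply: rho_linear.
    - by rewrite f1 r1.
    - by move=> v1 v2; rewrite fM rM.
    - by rewrite mon_small // fg.
    - by rewrite mon_small // fx.
  symmetry; apply: (@ev_uniq _ _ _ _ zP b _ _ _ (fun v => tmap f (rho v) : scT WH)).
  - by move=> a v1 v2; rewrite rho_linear; apply: tmap_linear.
  - by rewrite (rho1 n_gt1 zP b) tmap_tens // f1.
  - by move=> v1 v2; rewrite (@rhoM _ _ _ n_gt1 zP b) tmapM.
  - rewrite mon_small // [X in tmap _ X]comb_bas comul_ix0 -(tens_bas K (ix 1 0) (ix 1 0)).
    by rewrite tmap_tens // fg rho_u.
  - rewrite mon_small // [X in tmap _ X]comb_bas comul_ix1 // -(tens_bas K (ix 0 1) e0).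
    rewrite -(tens_bas K (ix 1 0) (ix 0 1)) /tmap combDl -!/(tmap _ _) !tmap_tens //.
    by rewrite fx fg rhoX H1.
have u_neq0 m : u ^+ m != 0.
  apply: contraTneq (oner_neq0 (scT W)) => um0; apply/negPn/eqP.
  have -> : 1 = u ^+ m * uV ^+ m :> scT W.
    rewrite -exprMn_comm ?uuV ?expr1n //.
    by rewrite /GRing.comm uuV uVu.
  by rewrite um0 mul0r.
(* Take an index a of largest x-degree with v a nonzero. In (f (x) id)(rho v) the component along
   e_a comes from Delta(e_a) alone and is v_a u^(a.1 + a.2), where u is invertible. *)
have f_inj v : f v = 0 -> v = 0.
  move=> fv0; apply/eqP; apply/negPn/negP=> v0.
  have [a0 va0] : exists a, v a != 0.
    apply/existsP; apply: contraNT v0 => /existsPn va; apply/eqP/ffunP=> a.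
    by rewrite ffunE; apply/eqP/negPn/va.
  case: (@arg_maxnP _ a0 (fun a => v a != 0) (fun a => a.2 : nat) va0) => a va amax.
  have : tmap f (rho v) = 0 by rewrite -rho_f fv0 [rho 0]comb0l.
  move/(congr1 (fun w : fspace K (I * I) => finfun (fun c => w (c, a)))).
  pose S := v a *: f (e (ix (a.1 + a.2) 0)).
  have -> : [ffun c => (tmap f (rho v)) (c, a)] = S :> fspace K I.
    apply/ffunP=> c'; rewrite ffunE /tmap comb_rho combE.
    rewrite (bigD1 a) //= big1 ?addr0 => [|d' da].
      rewrite combE (bigD1 (ix (a.1 + a.2) 0, a)) //= big1 ?addr0 => [|p pN].
        rewrite comulE /cocond /= eqxx mod0n add0n !eqxx /= mul1r qbinn.
        by rewrite !ffunE eqxx mulr1 mul1r.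
      rewrite !ffunE; have [pa|] := eqVneq a p.2; last by rewrite !mulr0.
      rewrite [p]surjective_pairing comulE /cocond -pa.
      have [/and3P[_ /eqP p1 /eqP p2]|] := boolP [&& _, _ & _]; last by rewrite !mul0r.
      case/negP: pN; rewrite [p]surjective_pairing -pa xpair_eqE eqxx andbT.
      apply/eqP; rewrite -[LHS](ixE n_gt1); apply: eq_ix; first by rewrite p1 modn_mod.
      by move: p2; rewrite -[RHS]add0n => /addIn ->.
    have [->|vd] := eqVneq (v d') 0; first by rewrite mul0r.
    rewrite combE big1 ?mulr0 // => p _; rewrite !ffunE.
    have [pa|] := eqVneq a p.2; last by rewrite !mulr0.
    rewrite [p]surjective_pairing comulE /cocond -pa.
    have [/and3P[/eqP a1 /eqP p1 /eqP p2]|] := boolP [&& _, _ & _]; last by rewrite !mul0r.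
    have p0 : p.1.2 = 0%N :> nat.
      by apply/eqP; rewrite -leqn0 -(leq_add2r a.2) add0n p2; exact: amax.
    rewrite p0 add0n in p2; case/negP: da.
    by rewrite -[d'](ixE n_gt1) -[a](ixE n_gt1) -a1 p2.
  have -> : [ffun c => (0 : fspace K (I * I)) (c, a)] = 0 :> fspace K I.
    by apply/ffunP=> c'; rewrite !ffunE.
  move/eqP; rewrite /S scaler_eq0 (negPf va) /= -(mon_small n_gt1 b _ n0).
  by rewrite /f (ev_mon _ _ un bE) expr0 mulr1 (negPf (u_neq0 _)).
split.
- have kF : lker (linfun F) == 0%VS.
    apply/lker0P=> v w; rewrite !lfunE /= => fvw; apply/eqP; rewrite -subr_eq0.
    apply/eqP/f_inj; rewrite -[f _]/(F (v - w)) linearB; apply/eqP.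
    by rewrite subr_eq0; apply/eqP.
  exists (linfun F)^-1%VF; first exact: lker0_lfunK.
  exact: lker0_lfunVK.
- by move=> v w; rewrite !lfunE /= fM.
- move=> v; rewrite lfunE /= rho_f; apply: eq_comb => p.
  by congr (tens _ _); apply/esym/(lfunE F).
Qed.

End Iso.
End Structure.

(** * Cocycles that realize the model algebras *)

Section ModelCocycle.
Variables (K : closedFieldType) (n : nat) (z : K).
Hypotheses (n_gt1 : (1 < n)%N) (zP : n.-primitive_root z).

Local Notation I := (tidx n).
Local Notation e := (@bas K I).
Local Notation ix := (ix n_gt1).
Local Notation comul := (comul z n_gt1).
Local Notation rho := (rho z n_gt1).
Local Notation M := (msc z n_gt1 0).
Local Notation csc := (csc z n_gt1).

(* The counit of the underlying coalgebra applied to the product of the model algebra. *)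
Definition model_cocycle (b : K) (a c : I) : K^o := comb (msc z n_gt1 b a c) (@eps K n : I -> K^o).
Local Notation alb := model_cocycle.

(** A product in A_b is recovered by eps (x) id from its coaction, and the coaction is
    multiplicative with values in A_b (x) H. This yields eps(a_1 c_1) a_2 c_2, which is the twisted
    product. *)
Lemma csc_model b a c : csc (alb b) a c = msc z n_gt1 b a c.
Proof.
rewrite -[RHS]comb_id.
transitivity (comb (rho (msc z n_gt1 b a c)) (fun p => eps K p.1 *: e p.2)); last first.
  by rewrite comb_rho; apply: eq_comb => d; rewrite counitl.
have := @rhoM _ _ _ n_gt1 zP b (e a : scT (model n_gt1 zP b)) (e c : scT _).
rewrite sc_bas !rho_e => ->; rewrite scmulE comb_comp; apply: eq_comb => p.
rewrite comb_comp; apply: eq_comb => r; rewrite comb_tens.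
by under [RHS]eq_comb do rewrite combZr comb_id; rewrite -comb_scale.
Qed.

(** By [csc_model] both sides are eps of the triple product a c d in A_b. *)
Lemma model_cocycleP b : cocycleP z n_gt1 (alb b).
Proof.
move=> a c d; rewrite -(comb_csc z n_gt1 (alb b) a c (fun x => alb b x d)).
rewrite -(comb_csc z n_gt1 (alb b) c d (alb b a)).
rewrite !csc_model; apply: (etrans (esym (comb_comp _ _ _))).
apply: (etrans _ (comb_comp _ _ _)).
by congr (comb _ (@eps K n : I -> K^o)); exact: (mscA n_gt1 zP).
Qed.

(** The coefficient of b in the cocycle: eps kills every product of two basis monomials except those
    of total x-degree 0 and of total x-degree exactly n, the latter being z^(-jk) b times a power of
    g. *)
Definition ndeg (a c : I) : K := z ^- (a.2 * c.1) * (a.2 + c.2 == n)%N%:R.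

Lemma model_cocycleE b a c : alb b a c = eps K a * eps K c + b * ndeg a c.
Proof.
rewrite /alb combZl comb_mon /eps /ndeg /=.
have [lt|] := ltnP (a.2 + c.2) n.
  rewrite divn_small // modn_small // expr0 scale1r (ltn_eqF lt) !mulr0 addr0.
  rewrite addn_eq0 -natrM mulnb; have [->|_] := eqVneq (a.2 : nat) 0%N.
    by rewrite mul0n expr0 invr1 scale1r.
  by rewrite scaler0.
have lt2 : (a.2 + c.2 < n + n)%N by rewrite -addnS leq_add // ltnW.
move=> ge; have a0 : (0 < a.2)%N.
  rewrite lt0n; apply: contraTneq ge => ->; by rewrite -ltnNge add0n.
rewrite (gtn_eqF a0) mul0r add0r.
have sE : (a.2 + c.2 = n + (a.2 + c.2 - n))%N by rewrite subnKC.
have rn : (a.2 + c.2 - n < n)%N by rewrite ltn_subLR.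
rewrite sE divnDl // divnn (ltnW n_gt1) divn_small // modnDl modn_small // expr1.
have -> m : ((n + m == n) = (m == 0))%N by rewrite -{2}[n]addn0 eqn_add2l.
by rewrite /GRing.scale /=; ring.
Qed.

Lemma comul_deg a p : comul a p != 0 -> (p.1.2 + p.2.2 = a.2)%N.
Proof.
rewrite [p]surjective_pairing comulE.
by case: (boolP (cocond _ _ _)) => [/and3P[_ _ /eqP]|]; rewrite ?mul0r ?eqxx.
Qed.

(** With N for [ndeg], the convolution of eps + b N and eps - b N is eps - b^2 N N. A nonzero value
    of N N would need total x-degree 2n, and two basis monomials reach at most 2n - 2. *)
Lemma model_convP b : convP z n_gt1 (alb b) (alb (- b)).
Proof.
move=> a c; transitivity (comb (comul a) (fun p => comb (comul c) (fun r =>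
  eps K p.1 *: (eps K r.1 *: alb (- b) p.2 r.2) +
  eps K p.2 *: (eps K r.2 *: (b * ndeg p.1 r.1 : K^o))))).
  apply: eq_bigr => p _; have [->|/comul_deg pa] := eqVneq (comul a p) 0.
    by rewrite !scale0r.
  congr (_ *: _); apply: eq_bigr => r _.
  have [->|/comul_deg rc] := eqVneq (comul c r) 0; first by rewrite !scale0r.
  congr (_ *: _); rewrite !model_cocycleE /GRing.scale /=.
  suff : ndeg p.1 r.1 * ndeg p.2 r.2 = 0.
    move=> N0; transitivity (eps K p.1 * (eps K r.1 * (eps K p.2 * eps K r.2 +
      - b * ndeg p.2 r.2)) + eps K p.2 * (eps K r.2 * (b * ndeg p.1 r.1))
      - b ^+ 2 * (ndeg p.1 r.1 * ndeg p.2 r.2)); first by ring.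
    by rewrite N0 mulr0 subr0.
  rewrite /ndeg; case: eqP => [e1|]; last by rewrite !mulr0 mul0r.
  case: eqP => [e2|]; last by rewrite !mulr0.
  have : (a.2 + c.2 = n + n)%N by rewrite -pa -rc addnACA e1 e2.
  have : (a.2 + c.2 < n + n)%N by rewrite -addnS leq_add // ltnW.
  by move=> lt E; rewrite E ltnn in lt.
transitivity (comb (comul a) (fun p => eps K p.1 *: alb (- b) p.2 c +
  eps K p.2 *: (b * ndeg p.1 c : K^o))).
  apply: eq_comb => p; rewrite combDr combZr [X in _ + X]combZr.
  rewrite (counitl z n_gt1 c (fun r => alb (- b) p.2 r)).
  by rewrite (counitr z n_gt1 c (fun r => b * ndeg p.1 r : K^o)).
rewrite combDr (counitl z n_gt1 a (fun p => alb (- b) p c)).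
rewrite (counitr z n_gt1 a (fun p => b * ndeg p c : K^o)) model_cocycleE; ring.
Qed.

Lemma model_cocycle_iso b : model_iso n_gt1 zP (alb b) b \1%VF.
Proof.
split; first by exists id => u; rewrite id_lfunE.
- move=> u v; rewrite !id_lfunE scmulE; apply: eq_comb => a; apply: eq_comb => c.
  by rewrite csc_model.
- move=> u; rewrite id_lfunE -[LHS]comb_id; apply: eq_comb => -[p r].
  by rewrite id_lfunE tens_bas.
Qed.

End ModelCocycle.

(** * The canonical element and the classification *)

Section Bridge.
Variables (k : fieldType) (K : closedFieldType) (iota : {rmorphism k -> K}).
Variables (n : nat) (zeta : k).
Hypotheses (n_gt1 : (1 < n)%N) (zetaP : n.-primitive_root zeta).

Local Notation I := (tidx n).
Local Notation e := (@bas K I).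
Local Notation ix := (ix n_gt1).
Local Notation z := (iota zeta).

Lemma prim_iota : n.-primitive_root z.
Proof. by rewrite fmorph_primitive_root. Qed.

Local Notation zP := prim_iota.

Local Notation comul := (comul z n_gt1).
Local Notation rho := (rho z n_gt1).
Local Notation M := (msc z n_gt1 0).

Lemma iota_qbin q j l : iota (qbin q j l) = qbin (iota q) j l.
Proof.
elim: j l => [|j IHj] [|l] /=; rewrite ?rmorph1 ?rmorph0 //.
by rewrite rmorphD rmorphM rmorphXn !IHj.
Qed.

Lemma iota_comul a p : iota (taft_comul zeta a p) = comul a p.
Proof.
rewrite (@taft_comulE k n zeta n_gt1 zetaP) [p]surjective_pairing !comulE rmorphM rmorph_nat.
by rewrite iota_qbin fmorphV.
Qed.

Lemma iota_mul a b : tw iota (taft_mul zeta (bas k a) (bas k b)) = M a b.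
Proof.
rewrite (@taft_mulE k n zeta n_gt1 zetaP) sc_bas; apply/ffunP=> d; rewrite !ffunE.
by rewrite !rmorphM !rmorph_nat fmorphV rmorphXn rmorphXn rmorph0.
Qed.

Definition acochain (al : cochain K n) (a b : I) : K^o := al (a, b).

Lemma twist_mulE al u v : twist_mul iota zeta al u v = tmul z n_gt1 (acochain al) u v.
Proof.
rewrite /tmul /comb; apply: eq_bigr => a _; rewrite scaler_sumr.
apply: eq_bigr => b _; rewrite -scalerA; congr (_ *: (_ *: _)).
apply: eq_bigr => p _; rewrite scaler_sumr; apply: eq_bigr => r _.
by rewrite !iota_comul iota_mul !scalerA.
Qed.

Lemma coactE u : coact iota zeta u = rho u.
Proof.
apply/ffunP=> p; rewrite ffunE combE; apply: eq_bigr => a _.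
by rewrite iota_comul.
Qed.

Lemma TopE f u : Top iota zeta f u =
  comb (rho u) (fun p => iota (f p.2) *: e p.1).
Proof.
apply/ffunP=> c; rewrite ffunE combE coactE.
rewrite [RHS](eq_bigr (fun p => rho u (p.1, p.2) * (iota (f p.2) * (c == p.1)%:R))).
  rewrite -(pair_bigA _ (fun x y => rho u (x, y) * (iota (f y) * (c == x)%:R))) /=.
  rewrite [RHS](bigD1 c) //= [X in _ + X]big1 ?addr0 => [|d dc].
    by apply: eq_bigr => d _; rewrite eqxx mulr1.
  by rewrite big1 // => y _; rewrite eq_sym (negPf dc) !mulr0.
by case=> x y _; rewrite !ffunE.
Qed.

Lemma tw_g : tw iota (taftg k n) = e (ix 1 0).
Proof.
rewrite /taftg (taft_mon_mon k n_gt1) mon_small ?(ltnW n_gt1) //.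
by apply/ffunP=> d; rewrite !ffunE rmorph_nat.
Qed.

Lemma cappl al u c : capp iota al u (bas k c) = comb (tw iota u) (fun d => acochain al d c).
Proof.
apply: eq_bigr => a _; rewrite (bigD1 c) //= big1 ?addr0 => [|d /negPf dc].
  by rewrite !ffunE eqxx rmorph1 mulr1.
by rewrite !ffunE dc rmorph0 mulr0 mul0r.
Qed.

Lemma cappr al a v : capp iota al (bas k a) v = comb (tw iota v) (acochain al a).
Proof.
rewrite /capp (bigD1 a) //= [X in _ + X]big1 ?addr0 => [|d /negPf da].
  by apply: eq_bigr => b _; rewrite !ffunE eqxx rmorph1 mul1r.
by rewrite big1 // => b _; rewrite !ffunE da rmorph0 !mul0r.
Qed.

Lemma sum2E (V : lmodType K) a b (F : I * I -> I * I -> V) :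
  \sum_p \sum_q (iota (taft_comul zeta a p) * iota (taft_comul zeta b q)) *: F p q =
  comb (comul a) (fun p => comb (comul b) (F p)).
Proof.
apply: eq_bigr => p _; rewrite scaler_sumr; apply: eq_bigr => q _.
by rewrite !iota_comul scalerA.
Qed.

Lemma cocycle_eqE al : cocycle_eq iota zeta al <-> cocycleP z n_gt1 (acochain al).
Proof.
have E1 a b c : \sum_p \sum_q iota (taft_comul zeta a p) * iota (taft_comul zeta b q) *
        (al (p.1, q.1) * capp iota al (taft_mul zeta (bas k p.2) (bas k q.2)) (bas k c)) =
    comb (comul a) (fun p => comb (comul b) (fun r =>
     acochain al p.1 r.1 *: comb (M p.2 r.2) (fun d => acochain al d c))).
  rewrite -(@sum2E K^o); apply: eq_bigr => p _; apply: eq_bigr => r _.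
  by rewrite cappl iota_mul.
have E2 a b c : \sum_p \sum_q iota (taft_comul zeta b p) * iota (taft_comul zeta c q) *
        (al (p.1, q.1) * capp iota al (bas k a) (taft_mul zeta (bas k p.2) (bas k q.2))) =
    comb (comul b) (fun p => comb (comul c) (fun r =>
     acochain al p.1 r.1 *: comb (M p.2 r.2) (acochain al a))).
  rewrite -(@sum2E K^o); apply: eq_bigr => p _; apply: eq_bigr => r _.
  by rewrite cappr iota_mul.
by split=> alC a b c; have := alC a b c; rewrite E1 E2.
Qed.

Lemma conv1E (a b : I) : conv1 iota n (a, b) = eps K a * eps K b.
Proof. by rewrite ffunE /= /taft_counit !rmorph_nat. Qed.

Lemma convE (al be : cochain K n) a b : conv iota zeta al be (a, b) =
  comb (comul a) (fun p => comb (comul b) (fun r =>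
    acochain al p.1 r.1 *: acochain be p.2 r.2)).
Proof. by rewrite ffunE -(@sum2E K^o). Qed.

Lemma conv_eq1 al be : conv iota zeta al be = conv1 iota n <->
  convP z n_gt1 (acochain al) (acochain be).
Proof.
split=> [E a b|E]; first by rewrite -convE E conv1E.
by apply/ffunP=> -[a b]; rewrite convE conv1E; apply: E.
Qed.

Definition cochain_of (f : I -> I -> K^o) : cochain K n := [ffun ab => f ab.1 ab.2].

Lemma cochain_ofK f : acochain (cochain_of f) = f.
Proof. by apply/boolp.funext=> a; apply/boolp.funext=> b; rewrite /acochain ffunE. Qed.

Lemma two_cocycleP al : two_cocycle iota zeta al ->
  exists b phi, model_iso n_gt1 zP (acochain al) b phi.
Proof.
case=> -[be [/conv_eq1 albe _]] /cocycle_eqE alC.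
exact: structure_theorem alC albe.
Qed.

Lemma model_two_cocycle b : two_cocycle iota zeta (cochain_of (model_cocycle z n_gt1 b)).
Proof.
split; last by apply/cocycle_eqE; rewrite cochain_ofK; apply: model_cocycleP zP _.
exists (cochain_of (model_cocycle z n_gt1 (- b))); split; apply/conv_eq1.
  by rewrite !cochain_ofK; apply: model_convP.
by rewrite !cochain_ofK -{2}[b]opprK; apply: model_convP.
Qed.

Lemma Top_gamma v : Top iota zeta (gammaf n zeta) v = comb v (fun a => z ^+ a.1 *: e a).
Proof.
rewrite TopE comb_rho; apply: eq_comb => a.
rewrite -(counitr z n_gt1 a (fun c => z ^+ a.1 *: e c)).
apply: eq_bigr => -[c d] _; rewrite comulE /=.
have [/and3P[/eqP d1 _ _]|] := boolP (cocond a c d); last by rewrite mul0r !scale0r.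
by congr (_ *: _); rewrite ffunE rmorphM rmorphXn rmorph_nat /= d1 [RHS]scalerA mulrC.
Qed.

Lemma Top_xi i : Top iota zeta (xif k n) (e (ix i 1)) = e (ix i.+1 0).
Proof.
rewrite TopE [rho _]comb_bas comul_ix1 // combDl !comb_bas !ffunE /= mod0n modn_small //.
by rewrite rmorph0 rmorph1 scale0r add0r scale1r.
Qed.

Section Canonical.
Variables (al : cochain K n) (b : K) (phi : 'End(fspace K I)).
Hypothesis phiP : model_iso n_gt1 zP (acochain al) b phi.
Local Notation A := (model n_gt1 zP b).
Local Notation mul := (twist_mul iota zeta al).

Let phiM (u v : scT A) : mul (phi u) (phi v) = phi (u * v).
Proof. by case: phiP => _ -> _; rewrite twist_mulE. Qed.

Let phi_inj : injective phi. Proof. by case: phiP => /bij_inj. Qed.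

Let phi_onto w : exists v, w = phi v.
Proof. by case: phiP => -[psi _ psiK] _ _; exists (psi w); rewrite psiK. Qed.

Let rho_phi u : rho (phi u) = tmap phi (rho u). Proof. by case: phiP. Qed.

Lemma is_one_phi v : is_one iota zeta al (phi v) <-> v = (1 : scT A).
Proof.
split=> [v1|->]; last first.
  by move=> w; have [u ->] := phi_onto w; rewrite !phiM mul1r mulr1.
by have [] := v1 (phi (1 : scT A)); rewrite phiM mulr1 => /phi_inj.
Qed.

Lemma Top_phi f v : Top iota zeta f (phi v) = phi (Top iota zeta f v).
Proof.
rewrite !TopE rho_phi comb_lin comb_comp; apply: eq_comb => p.
by rewrite comb_tens /= linearZ /=; under eq_comb do rewrite comb_bas /=; rewrite combZr comb_id.
Qed.

Let gA : scT A := e (ix 1 0).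

(** An isomorphism need not send g to the element given by g, but the image has the same coaction
    type and is a multiple of that element by [semi_invariant]. The factor disappears under
    conjugation. *)
Lemma phi_g : exists2 l, l != 0 & e (ix 1 0) = phi (l *: gA).
Proof.
have : rho (phi gA) = tens (phi gA) (e (ix 1 0)).
  rewrite rho_phi /gA [rho _]comb_bas comul_ix0 -(tens_bas K (ix 1 0) (ix 1 0)) tmap_tens //.
  exact: linearP.
move/(semi_invariant) => [c cE].
have c0 : c != 0.
  apply/eqP=> c0; move: cE; rewrite c0 scale0r => /eqP.
  by rewrite -(linear0 phi) (inj_eq phi_inj) (negPf (e_neq0 _ _)).
by exists c^-1; rewrite ?invr_neq0 // linearZ /= cE scalerA mulVf ?scale1r.
Qed.

Let gA_mon : gA = mon n_gt1 b 1 0. Proof. by rewrite mon_small // ltnW. Qed.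

Let gVA : scT A := gA ^+ n.-1.
Let gn : gA ^+ n = 1. Proof. by rewrite gA_mon; case: (model_rel n_gt1 zP b). Qed.
Let ggV : gA * gVA = 1. Proof. by rewrite -exprS prednK // ltnW. Qed.
Let gVg : gVA * gA = 1. Proof. by rewrite -exprSr prednK // ltnW. Qed.

Lemma Wcomp_phi v : Wcomp iota zeta al (-1) 1 (phi v) <->
  Top iota zeta (gammaf n zeta) v = z^-1 *: v /\ gA * (v : scT A) = z *: ((v : scT A) * gA).
Proof.
have [l l0 lE] := phi_g; rewrite /Wcomp Top_phi exprN1 expr1z -linearZ tw_g lE; split.
  case=> /phi_inj -> [ginv]; have [h ->] := phi_onto ginv.
  rewrite !phiM -linearZ /= => -[/is_one_phi gh /is_one_phi hg /phi_inj E]; split=> //.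
  have : (l *: gA) * (v : scT A) = z *: ((v : scT A) * (l *: gA)).
    by rewrite -[LHS]mulr1 -hg mulrA E -scalerAl.
  by rewrite -scalerAl -scalerAr scalerA mulrC -scalerA => /(scalerI l0).
case=> -> gv; split=> //; exists (phi (l^-1 *: gVA)).
rewrite !phiM; split.
- by apply/is_one_phi; rewrite -scalerAl -scalerAr scalerA mulfV // scale1r.
- by apply/is_one_phi; rewrite -scalerAl -scalerAr scalerA mulVf // scale1r.
rewrite -linearZ /= -!scalerAl -scalerAr scalerA mulfV // scale1r; congr (phi _).
by rewrite gv -scalerAl -mulrA ggV mulr1.
Qed.

Let scal1_inj (c d : K) : c *: (1 : scT A) = d *: (1 : scT A) -> c = d.
Proof.
move=> /eqP; rewrite -subr_eq0 -scalerBl => /eqP cd; apply/eqP; rewrite -subr_eq0.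
apply: contraT => cd0; have /eqP := oner_neq0 (scT A); case.
by rewrite -[1](scalerK cd0) cd scaler0.
Qed.

Let ea : I := ix n.-1 1.

(** Each condition fixes one datum of v = c g^i x^j: the eigenvalue z^(-1) of gamma gives i = n - 1,
    conjugation by g gives j = 1, and xi gives c = 1. *)
Lemma canonical_phi v : canonical_element iota zeta al (phi v) <-> v = e ea.
Proof.
have n0 := ltnW n_gt1; have z0 := prim_neq0 n_gt1 zP.
have Top_ea c : Top iota zeta (xif k n) (c *: e ea) = c *: (1 : scT A).
  rewrite TopE [rho _]combZl combZl -[comb _ _]TopE Top_xi prednK //.
  congr (_ *: _); rewrite -(mon1E n_gt1 zP b) mon_small //; congr (e _).
  by apply: eq_ix; rewrite ?modnn ?mod0n.
have zpow i : z ^+ i = z^-1 -> (i < n)%N -> i = n.-1.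
  move=> /(congr1 (fun x => z * x)); rewrite mulfV // -exprS => /eqP.
  rewrite -(prim_order_dvd zP) => /dvdn_leq => /(_ isT) ni lt.
  by apply/eqP; rewrite -eqSS prednK // eqn_leq lt ni.
rewrite /canonical_element Top_phi.
split=> [[/Wcomp_phi [vg gv] /is_one_phi vx]|->]; last first.
  split; last by apply/is_one_phi; rewrite -[e ea]scale1r Top_ea scale1r.
  apply/Wcomp_phi.
  rewrite Top_gamma comb_bas /= modn_small ?ltn_predL //; split.
    congr (_ *: _); apply: (mulfI z0); rewrite mulfV // -exprS prednK //.
    exact: (prim_expr_order zP).
  have -> : e ea = mon n_gt1 b n.-1 1 by rewrite mon_small.
  rewrite gA_mon !monM mul0n muln1 expr0 invr1 scale1r expr1 scalerA mulfV // scale1r.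
  by rewrite addnC.
have va a : v a != 0 -> a = ea.
  move=> va0; have a1 : (a.1 : nat) = n.-1.
    apply: zpow (ltn_ord _); move: vg; rewrite Top_gamma => /(congr1 (fun w : fspace K I => w a)).
    rewrite combE (bigD1 a) //= big1 ?addr0 => [|d /negPf da]; last first.
      by rewrite !ffunE eq_sym da [_ *: _]mulr0 mulr0.
    rewrite !ffunE eqxx [_ *: 1]mulr1 [RHS]mulrC; exact: mulfI.
  have a2 : (a.2 : nat) = 1%N.
    (* The commutation relation, multiplied on the left by g^(-1), says coordinatewise that v_d (1 -
       z z^(-d.2)) = 0. *)
    have E : comb v (fun d => (1 - z * z ^- d.2) *: e d) = 0.
      have vgc : (v : scT A) * gA = comb v (fun d => z ^- d.2 *: (gA * e d)).
        rewrite scmulE; apply: eq_comb => d; rewrite comb_bas gA_mon (e_mon n_gt1 b d) monM.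
        rewrite mul0n expr0 invr1 scale1r -[LHS]/(z ^- (d.2 * (ix 1 0).1) *:
          mon n_gt1 b (d.1 + (ix 1 0).1) (d.2 + (ix 1 0).2)) /= mod0n modn_small //.
        by rewrite muln1 addn0 add1n addn1.
      have gvc : gA * (v : scT A) = comb v (fun d => gA * e d).
        rewrite -[v in LHS]comb_id /comb mulr_sumr; apply: eq_bigr => i _.
        by rewrite scalerAr.
      transitivity (gVA * (gA * (v : scT A) - z *: ((v : scT A) * gA))); last first.
        by rewrite gv subrr mulr0.
      rewrite vgc gvc -combZr -scaleN1r -combZr -combDr /comb mulr_sumr.
      apply: eq_bigr => d _; rewrite -scalerAr; congr (_ *: _).
      rewrite !scalerA mulN1r mulrDr -!scalerAr mulrA gVg mul1r.
      by rewrite scalerBl scale1r mulNr scaleNr.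
    have := congr1 (fun w : fspace K I => w a) E.
    rewrite combE (bigD1 a) //= big1 ?addr0 => [|d /negPf da]; last first.
      by rewrite !ffunE eq_sym da [_ *: _]mulr0 mulr0.
    rewrite !ffunE eqxx [_ *: 1]mulr1 => /eqP; rewrite mulf_eq0 (negPf va0) subr_eq0 /=.
    move/eqP/(congr1 (fun x => x * z ^+ a.2)); rewrite mul1r mulfVK ?expf_neq0 // => /eqP.
    rewrite -{2}[z]expr1 (eq_prim_root_expr zP) !modn_small // => /eqP.
    by [].
  by rewrite -[a](ixE n_gt1) a1 a2.
have vE : v = v ea *: e ea.
  rewrite -[LHS]comb_id /comb (bigD1 ea) //= big1 ?addr0 // => a ane.
  have [->|/va aE] := eqVneq (v a) 0; first by rewrite scale0r.
  by rewrite aE eqxx in ane.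
move: vE vx; set c := v ea => ->; rewrite Top_ea -[RHS]scale1r => /scal1_inj ->.
by rewrite scale1r.
Qed.

(* The canonical element of the model algebra is g^(-1) x, and (g^(-1) x)^n is
   [root_unit] times x^n. *)
Definition root_unit : K := z ^- (n.-1 * 'C(n, 2)).

Lemma canonical_scalar_phi c :
  canonical_scalar iota zeta al c <-> c = root_unit * b.
Proof.
have iterE v m : iter m (mul (phi v)) (phi (1 : scT A)) = phi ((v : scT A) ^+ m).
  by elim: m => [|m IHm] //=; rewrite IHm phiM exprS.
have n0 := ltnW n_gt1.
have tn : (e ea : scT A) ^+ n = (root_unit * b) *: 1.
  have -> : e ea = mon n_gt1 b n.-1 1 by rewrite mon_small.
  have -> : root_unit * b *: (1 : scT A) = root_unit *: mon n_gt1 b 0 (n + 0).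
    by rewrite mon_ge (mon1E n_gt1 zP b) [RHS]scalerA.
  by rewrite monX muln1 -mon_mod modnMr muln1 addn0.
split=> [[t [one [[tc _] one1]]]|->].
  have [v tE] := phi_onto t; have [w wE] := phi_onto one.
  rewrite {}tE {}wE in tc one1 *; move/canonical_phi: tc => ->; move/is_one_phi: one1 => ->.
  rewrite iterE => E; apply/esym/scal1_inj/phi_inj.
  by rewrite -tn E [phi (c *: _)]linearZ.
exists (phi (e ea)), (phi (1 : scT A)); split.
- split; first exact/canonical_phi.
  by move=> t; have [v ->] := phi_onto t; move/canonical_phi=> ->.
- exact/is_one_phi.
- by rewrite iterE tn linearZ.
Qed.

End Canonical.

Lemma root_unit_neq0 : root_unit != 0.
Proof. by rewrite invr_neq0 // expf_neq0 // (prim_neq0 n_gt1 zP). Qed.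

End Bridge.

(** * Equivalence of cocycles and equality of canonical scalars *)

Section Classification.
Variables (k : fieldType) (K : closedFieldType) (iota : {rmorphism k -> K}).
Variables (n : nat) (zeta : k).
Hypotheses (n_gt1 : (1 < n)%N) (zetaP : n.-primitive_root zeta).

Local Notation I := (tidx n).
Local Notation e := (@bas K I).
Local Notation z := (iota zeta).
Local Notation rho := (rho z n_gt1).
Local Notation model_iso := (model_iso n_gt1 (prim_iota iota zetaP)).
Local Notation cocycle := (two_cocycle iota zeta).
Local Notation cscalar := (canonical_scalar iota zeta).
Local Notation s := (root_unit iota n zeta).
Implicit Types al be : cochain K n.

Lemma tmapE (f : {linear fspace K I -> fspace K I}) w :
  tmap f w = [ffun p => f [ffun c => w (c, p.2)] p.1].
Proof.
apply/ffunP=> -[x y]; rewrite ffunE /= combE.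
rewrite -[[ffun c => _]]comb_id comb_lin combE.
rewrite [LHS](eq_bigr (fun p => w (p.1, p.2) * (f (e p.1) x * (y == p.2)%:R))); last first.
  by case=> a b _; rewrite !ffunE.
rewrite -(pair_bigA _ (fun a b => w (a, b) * (f (e a) x * (y == b)%:R))) /=.
apply: eq_bigr => a _; rewrite (bigD1 y) //= eqxx mulr1 big1 ?addr0 ?ffunE // => b.
by rewrite eq_sym => /negPf ->; rewrite !mulr0.
Qed.

Lemma iso_comp al be b phi psi : comodule_algebra_iso iota zeta al be psi ->
  model_iso (acochain al) b phi -> model_iso (acochain be) b (psi \o phi)%VF.
Proof.
case=> psi_bij psiM _ psi_co [phi_bij phiM phi_co]; split.
- by apply: (eq_bij (bij_comp psi_bij phi_bij)) => u; rewrite comp_lfunE.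
- by move=> u v; rewrite !comp_lfunE phiM -!(twist_mulE _ n_gt1 zetaP) psiM.
move=> u; rewrite comp_lfunE -(coactE _ n_gt1 zetaP) psi_co -tmapE.
rewrite (coactE _ n_gt1 zetaP) phi_co /tmap comb_comp; apply: eq_comb => p.
by rewrite comp_lfunE -[LHS]/(tmap psi _) tmap_tens //; apply: linearP.
Qed.

Lemma iso_trans al be b phi psi : model_iso (acochain al) b phi ->
  model_iso (acochain be) b psi -> cocycle_equiv iota zeta al be.
Proof.
move=> phiP psiP; have [phi_bij phiM phi_co] := phiP; have [psi_bij psiM psi_co] := psiP.
have kphi : lker phi == 0%VS by apply/lker0P; apply: bij_inj.
pose th := (psi \o phi^-1)%VF; exists th.
have thE u : th (phi u) = psi u by rewrite comp_lfunE lker0_lfunK.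
have onto w : exists u, w = phi u by exists (phi^-1%VF w); rewrite lker0_lfunVK.
split.
- have [psi' pK pK'] := psi_bij; exists (fun w => phi (psi' w)) => w.
    by rewrite comp_lfunE pK lker0_lfunVK.
  by rewrite thE pK'.
- move=> u v; have [u' ->] := onto u; have [v' ->] := onto v.
  by rewrite !thE !(twist_mulE _ n_gt1 zetaP) -phiM -psiM thE.
- move=> u; have [u' ->] := onto u; rewrite thE.
  by move/(is_one_phi phiP) => ->; apply/(is_one_phi psiP).
move=> u; have [u' ->] := onto u.
rewrite -tmapE !(coactE _ n_gt1 zetaP) thE phi_co psi_co [RHS]comb_comp.
apply: eq_comb => p; rewrite -[RHS]/(tmap th _) tmap_tens ?thE //; exact: linearP.
Qed.

Lemma cscalar_exists al : cocycle al -> exists! b : K, cscalar al b.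
Proof.
move=> /(two_cocycleP n_gt1 zetaP) [b [phi phiP]]; exists (s * b).
by split=> [|c]; [apply/(canonical_scalar_phi phiP)|move/(canonical_scalar_phi phiP)].
Qed.

Lemma cscalar_equiv al be a b : cocycle al -> cocycle be ->
  cscalar al a -> cscalar be b -> (cocycle_equiv iota zeta al be <-> a = b).
Proof.
move=> /(two_cocycleP n_gt1 zetaP) [a' [phi phiP]].
move=> /(two_cocycleP n_gt1 zetaP) [b' [psi psiP]].
move=> /(canonical_scalar_phi phiP) -> /(canonical_scalar_phi psiP) ->.
split=> [[th thP]|/(mulfI (root_unit_neq0 _ n_gt1 zetaP)) ab].
  (* Composition with th presents the second algebra on the model of the first, which determines its
     canonical scalar. *)
  apply/(canonical_scalar_phi psiP)/(canonical_scalar_phi (iso_comp thP phiP)).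
  by [].
by rewrite -ab in psiP; apply: iso_trans phiP psiP.
Qed.

Lemma cscalar_onto b : exists2 al : cochain K n, cocycle al & cscalar al b.
Proof.
(* Compensates the factor [root_unit] between x^n and the n-th power of the canonical element. *)
pose c := s^-1 * b; exists (cochain_of (model_cocycle z n_gt1 c)).
  exact: model_two_cocycle.
have : model_iso (acochain (cochain_of (model_cocycle z n_gt1 c))) c \1%VF.
  by rewrite cochain_ofK; apply: model_cocycle_iso.
move/canonical_scalar_phi=> ->.
by rewrite /c mulVKf // (root_unit_neq0 _ n_gt1 zetaP).
Qed.

End Classification.

(** * Upper bound for the field of invariants *)

Section GenField.
Variables (K : fieldType) (A : K -> Prop).
Local Notation k0 := (gen_field A).

Lemma gf0 : k0 0. Proof. by rewrite -[0](subrr 1); apply: gf_B; apply: gf_1. Qed.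

Lemma gfN x : k0 x -> k0 (- x).
Proof. by move=> kx; rewrite -sub0r; apply: gf_B kx; apply: gf0. Qed.

Lemma gfD x y : k0 x -> k0 y -> k0 (x + y).
Proof. by move=> kx ky; rewrite -[y]opprK; apply: gf_B (gfN ky). Qed.

Lemma gfV x : k0 x -> k0 x^-1.
Proof. by move=> kx; rewrite -div1r; apply: gf_div kx; apply: gf_1. Qed.

Lemma gfM x y : k0 x -> k0 y -> k0 (x * y).
Proof. by move=> kx ky; rewrite -[y]invrK; apply: gf_div (gfV ky). Qed.

Lemma gfX x m : k0 x -> k0 (x ^+ m).
Proof.
by move=> kx; elim: m => [|m IHm]; [exact: gf_1|rewrite exprS; apply: gfM].
Qed.

Lemma gf_nat m : k0 m%:R.
Proof.
elim: m => [|m IHm]; first exact: gf0.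
by rewrite -natr1; apply: gfD IHm _; apply: gf_1.
Qed.

Lemma gf_int (m : int) : k0 m%:~R.
Proof.
case: m => m; first exact: gf_nat.
by rewrite NegzE rmorphN; apply/gfN/gf_nat.
Qed.

Lemma gf_rat (c : rat) : k0 (ratr c).
Proof. exact: gf_div (gf_int _) (gf_int _). Qed.

Lemma gf_sum (I : finType) (F : I -> K) : (forall i, k0 (F i)) -> k0 (\sum_i F i).
Proof. by move=> kF; apply: big_ind => //; [exact: gf0|exact: gfD]. Qed.

(* A k0-subspace of K containing 1 and maximal for not containing c is a
   complement of the line k0 c; the projection onto this line is the required map. *)
Lemma gf_separation c : ~ k0 c -> exists p : K -> K,
  [/\ {morph p : x y / x - y}, forall l x, k0 l -> p (l * x) = l * p x,
      p 1 = 0 & p c = 1].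
Proof.
move=> kc.
(* [Zorn_bigcup] also considers the empty chain, so the empty set must satisfy [P], and 1 in U
   cannot be required. Avoiding the whole coset c + k0 instead lets 1 be added afterwards. *)
pose P (U : classical_sets.set K) := [/\ forall x y, U x -> U y -> U (x - y),
  forall l x, k0 l -> U x -> U (l * x) & forall a, k0 a -> ~ U (c - a)].
have [|U [PU Umax]] := @classical_sets.Zorn_bigcup K P.
  move=> F FP Ftot; split.
  - move=> x y [X FX Xx] [Y FY Yy].
    have [XB _ _] := FP X FX; have [YB _ _] := FP Y FY.
    have [XY|YX] := Ftot X Y FX FY.
      by exists Y => //; apply: YB => //; apply: XY.
    by exists X => //; apply: XB => //; apply: YX.
  - move=> l x kl [X FX Xx]; exists X => //.
    by have [_ XZ _] := FP X FX; apply: XZ.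
  - by move=> a ka [X FX Xc]; have [_ _ XN] := FP X FX; apply: XN Xc.
have {}Umax (V : classical_sets.set K) : (forall x, U x -> V x) -> P V -> forall x, V x -> U x.
  move=> UV PV x Vx; apply: boolp.contrapT => Ux; apply: (Umax V) PV.
  by split=> [//|VU]; apply/Ux/VU.
have [UB UZ Uc] := PU.
have UN x : U x -> U (- x).
  by move=> Ux; rewrite -mulN1r; apply: UZ => //; apply/gfN/gf_1.
have U1 : U 1.
  (* The first disjunct keeps k0 inside the enlarged set even if U is empty. *)
  apply: (Umax (fun x => k0 x \/ exists2 a, k0 a & U (x - a))); last by left; apply: gf_1.
    by move=> x Ux; right; exists 0; rewrite ?subr0 //; apply: gf0.
  split=> [x y [kx|[a ka Ua]] [ky|[b kb Ub]]|l x kl [kx|[a ka Ua]]|d kd [kcd|[a ka Ua]]].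
  - by left; apply: gf_B.
  - right; exists (x - b); first exact: gf_B.
    by rewrite (_ : x - y - (x - b) = - (y - b)); [exact: UN|ring].
  - right; exists (a - y); first exact: gf_B.
    by rewrite (_ : x - y - (a - y) = x - a); last ring.
  - right; exists (a - b); first exact: gf_B.
    by rewrite (_ : x - y - (a - b) = x - a - (y - b)); [exact: UB|ring].
  - by left; apply: gfM.
  - by right; exists (l * a); [exact: gfM|rewrite -mulrBr; apply: UZ].
  - by apply: kc; rewrite -[c](subrK d); apply: gfD.
  - by apply: (Uc (d + a)); [exact: gfD|rewrite opprD addrA].
have Uk a : k0 a -> U a by move=> ka; rewrite -[a]mulr1; apply: UZ.
have Uc0 : ~ U c by have := Uc 0 gf0; rewrite subr0.
(* If x is not in U, maximality makes U + k0 x meet c + k0; the coefficient of x there is nonzero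
   and can be divided out. *)
have line x : exists m, k0 m /\ U (x - m * c).
  have [Ux|Ux] := boolp.EM (U x).
    by exists 0; rewrite mul0r subr0; split=> //; apply: gf0.
  have [l [kl [a [ka Ul]]]] : exists l, k0 l /\ exists a, k0 a /\ U (c - a - l * x).
    apply: boolp.contrapT => nE; apply: Ux.
    apply: (Umax (fun y => exists2 l, k0 l & U (y - l * x))).
    - by move=> y Uy; exists 0; rewrite ?mul0r ?subr0 //; apply: gf0.
    - split=> [y y' [l kl Ul] [l' kl' Ul']|l y kl [l' kl' Ul']|a ka [l kl Ul]].
      + exists (l - l'); first exact: gf_B.
        by rewrite (_ : y - y' - (l - l') * x = y - l * x - (y' - l' * x)); [exact: UB|ring].
      + by exists (l * l'); [exact: gfM|rewrite -mulrA -mulrBr; apply: UZ].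
      + by apply: nE; exists l; split=> //; exists a.
    - by exists 1; [exact: gf_1|rewrite mul1r subrr; apply/Uk/gf0].
  have l0 : l != 0 by apply/eqP=> l0; apply: (Uc a ka); rewrite l0 mul0r subr0 in Ul.
  exists l^-1; split; first exact: gfV.
  rewrite (_ : x - l^-1 * c = l^-1 * - (c - a - l * x) - l^-1 * a); last by field.
  apply: UB; first by apply: UZ; [exact: gfV|exact: UN].
  by apply/Uk/gfM => //; apply: gfV.
have line_uniq x m m' : k0 m -> k0 m' -> U (x - m * c) -> U (x - m' * c) -> m = m'.
  move=> km km' Um Um'; apply/eqP; rewrite -subr_eq0; apply/negPn/negP=> mm.
  apply: Uc0; rewrite (_ : c = (m - m')^-1 * ((x - m' * c) - (x - m * c))).
    by apply: UZ; [apply/gfV/gf_B|apply: UB].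
  by field.
pose p x := projT1 (boolp.cid (line x)).
have pP x : k0 (p x) /\ U (x - p x * c) by rewrite /p; case: boolp.cid.
have pE x m : k0 m -> U (x - m * c) -> p x = m.
  by move=> km Um; have [kp Up] := pP x; apply: line_uniq Up Um.
exists p; split=> [x y|l x kl||].
- have [kx Ux] := pP x; have [ky Uy] := pP y; apply: pE; first exact: gf_B.
  by rewrite (_ : _ - _ = x - p x * c - (y - p y * c)); [exact: UB|ring].
- have [kx Ux] := pP x; apply: pE; first exact: gfM.
  by rewrite -mulrA -mulrBr; apply: UZ.
- by apply: pE; [exact: gf0|rewrite mul0r subr0].
- by apply: pE; [exact: gf_1|rewrite mul1r subrr; apply/Uk/gf0].
Qed.

End GenField.

(** * Additive endomorphisms of the fibres and their extension to kernels *)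

Section Projections.
Variable K : fieldType.

(* An additive endomorphism of each F(A) commuting with all morphisms: the action
   on the objects of a category of a fixed endomorphism of K which is linear over
   the field of definition of the morphisms. *)
Record pist (C : vcat K) := Pist {
  pmap : forall A : obj C, fib A -> fib A;
  pmapB : forall A : obj C, {morph @pmap A : u v / u - v};
  pmapH : forall (A B : obj C) (f : 'Hom(fib A, fib B)), Defs.hom f ->
    forall v, f (@pmap A v) = @pmap B (f v)
}.

Section Kernel.
Variables (C : vcat K) (p : pist C).

Lemma pmap0 A : pmap p (0 : fib A) = 0.
Proof. by rewrite -[0 in LHS](subrr 0) pmapB subrr. Qed.

Definition kpmap (f : mor C) (u : kfib f) : kfib f :=
  vsproj (lker (arr f)) (pmap p (vsval u)).

Lemma vsval_kpmap f (u : kfib f) : vsval (kpmap u) = pmap p (vsval u).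
Proof.
apply: vsprojK; rewrite memv_ker (pmapH p (arrP f)).
by have := subvsP u; rewrite memv_ker => /eqP ->; rewrite pmap0.
Qed.

Lemma kpmapB f : {morph @kpmap f : u v / u - v}.
Proof.
move=> u v; apply: subvs_inj.
by rewrite [RHS]linearB /= !vsval_kpmap linearB pmapB.
Qed.

(** In the base case an element of ker f is lifted through f0 to Y, where h commutes with the
    action. The other rules follow by additivity, and because an inverse commutes with everything
    that the original map commutes with. *)
Lemma kpmapH f g (a : 'Hom(kfib f, kfib g)) : kerX a ->
  forall v, a (kpmap v) = kpmap (a v).
Proof.
have kB := kpmapB.
have k0 h : @kpmap h 0 = 0 by rewrite -[0 in LHS](subrr 0) kB subrr.
have kN h (u : kfib h) : kpmap (- u) = - kpmap u by rewrite -sub0r kB k0 sub0r.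
have kD h (u v : kfib h) : kpmap (u + v) = kpmap u + kpmap v.
  by rewrite -[v in LHS]opprK kB kN opprK.
elim=> {f g a} [X Y f g f1 f0 h a f1P f0P hP f10 f0f gh hf1 aE u|f g v|f g a b _ IHa _ IHb v
  |f g a _ IHa v|f g h a b _ IHa _ IHb v|f g a b _ IHa ba ab v].
- have : vsval u \in limg f0 by rewrite f0f subvsP.
  case/memv_imgP=> y _ uy; apply: subvs_inj.
  rewrite (aE (pmap p y)); last by rewrite vsval_kpmap uy (pmapH p f0P).
  by rewrite vsval_kpmap (aE y) // (pmapH p hP).
- by rewrite !lfunE /= k0.
- by rewrite !add_lfunE kD IHa IHb.
- by rewrite !opp_lfunE kN IHa.
- by rewrite !comp_lfunE IHa IHb.
- have abE w : a (b w) = w by rewrite -comp_lfunE ab id_lfunE.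
  have baE w : b (a w) = w by rewrite -comp_lfunE ba id_lfunE.
  by rewrite -{1}[v]abE -IHa baE.
Qed.

Definition kpist : pist (kerCat C) := @Pist (kerCat C) kpmap kpmapB kpmapH.

End Kernel.

Section Iterate.
Variables (C : vcat K) (p : pist C).

Fixpoint kpistIter m : pist (kerIter C m) :=
  match m with 0 => p | m'.+1 => kpist (kpistIter m') end.

Lemma klift_E (D : vcat K) (A B : obj D) (f : 'Hom(fib A, fib B)) u :
  klift f u = vsproj (lker (arr (kemb B))) (f (vsval u)).
Proof. exact: (lfunE (vsproj _ \o f \o vsval)). Qed.

Lemma mem_kemb (D : vcat K) (A : obj D) (u : fib A) : u \in lker (arr (kemb A)).
Proof. by rewrite memv_ker lfunE /= eqxx. Qed.

Lemma vsval_klift (D : vcat K) (A B : obj D) (f : 'Hom(fib A, fib B)) u :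
  vsval (klift f u) = f (vsval u).
Proof. by rewrite klift_E vsprojK //; apply: mem_kemb. Qed.

(** The embedding of A into ker(A -> 0) is bijective and carries one action to the other, so
    commutation descends level by level. *)
Lemma kliftIter_comm m A B (f : 'Hom(fib A, fib B)) :
  (forall u, kliftIter m f (pmap (kpistIter m) u) = pmap (kpistIter m) (kliftIter m f u)) ->
  forall v, f (pmap p v) = pmap p (f v).
Proof.
elim: m => [|m IHm] //= fp; apply: IHm => v.
have vK w : vsval (vsproj (lker (arr (kemb (kembIter m A)))) w) = w.
  by apply/vsprojK/mem_kemb.
pose u : kfib (kemb (kembIter m A)) := vsproj (lker (arr (kemb (kembIter m A)))) v.
have E := congr1 vsval (fp u).
have E1 := vsval_klift (kliftIter m f) (kpmap (kpistIter m) u).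
have E2 := vsval_klift (kliftIter m f) u.
rewrite vsval_kpmap !vK in E1; rewrite vK in E2.
apply: (etrans (esym E1)); apply: (etrans E).
apply: (etrans (vsval_kpmap (kpistIter m) (klift (kliftIter m f) u))).
by congr (pmap _ _); exact: E2.
Qed.

Lemma limHom_comm A B (f : 'Hom(fib A, fib B)) : limHom f ->
  forall v, f (pmap p v) = pmap p (f v).
Proof. by case=> m fm; apply: (@kliftIter_comm m) => u; apply: pmapH. Qed.

End Iterate.
End Projections.

(** * Change of basis for mixed tensors *)

Section MultiIndex.
Variables (K : fieldType) (J : finType).

Lemma lpart_joinf p q (u : {ffun 'I_p -> J}) (v : {ffun 'I_q -> J}) :
  lpart (joinf u v) = u.
Proof. by apply/ffunP=> i; rewrite !ffunE (unsplitK (inl i)). Qed.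

Lemma rpart_joinf p q (u : {ffun 'I_p -> J}) (v : {ffun 'I_q -> J}) :
  rpart (joinf u v) = v.
Proof. by apply/ffunP=> i; rewrite !ffunE (unsplitK (inr i)). Qed.

Lemma joinf_parts p q (u : {ffun 'I_(p + q) -> J}) : joinf (lpart u) (rpart u) = u.
Proof.
apply/ffunP=> i; rewrite ffunE -[in RHS](splitK i).
by case: (split i) => j; rewrite ffunE.
Qed.

Lemma sum_joinf (V : nmodType) p q (F : {ffun 'I_(p + q) -> J} -> V) :
  \sum_u F u = \sum_u \sum_v F (joinf u v).
Proof.
rewrite pair_bigA /=.
rewrite (reindex (fun uv : {ffun 'I_p -> J} * {ffun 'I_q -> J} => joinf uv.1 uv.2)) //.
exists (fun u : {ffun 'I_(p + q) -> J} => (lpart u, rpart u)) => [[u v] _|u _] /=.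
  by rewrite lpart_joinf rpart_joinf.
by rewrite joinf_parts.
Qed.

Definition tailf p (u : {ffun 'I_p.+1 -> J}) : {ffun 'I_p -> J} :=
  [ffun i => u (lift ord0 i)].

Lemma consf0 p c (u : {ffun 'I_p -> J}) : consf c u ord0 = c.
Proof. by rewrite ffunE unlift_none. Qed.

Lemma consfS p c (u : {ffun 'I_p -> J}) i : consf c u (lift ord0 i) = u i.
Proof. by rewrite ffunE liftK. Qed.

Lemma consf_tailf p (u : {ffun 'I_p.+1 -> J}) : consf (u ord0) (tailf u) = u.
Proof.
apply/ffunP=> i; case: (unliftP ord0 i) => [j|] ->; last by rewrite consf0.
by rewrite consfS ffunE.
Qed.

Lemma sum_consf (V : nmodType) p (F : {ffun 'I_p.+1 -> J} -> V) :
  \sum_u F u = \sum_c \sum_u F (consf c u).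
Proof.
rewrite pair_bigA /=.
rewrite (reindex (fun cu : J * {ffun 'I_p -> J} => consf cu.1 cu.2)) //.
exists (fun u : {ffun 'I_p.+1 -> J} => (u ord0, tailf u)) => [[c u] _|u _] /=; last by rewrite consf_tailf.
by rewrite consf0; congr (_, _); apply/ffunP=> i; rewrite ffunE consfS.
Qed.

Lemma sum_ffun1 (F : {ffun 'I_1 -> J} -> K) :
  \sum_u F u = \sum_c F [ffun=> c].
Proof.
rewrite (reindex (fun c : J => [ffun=> c] : {ffun 'I_1 -> J})) //.
exists (fun a : {ffun 'I_1 -> J} => a ord0) => [c _|a _]; first by rewrite ffunE.
by apply/ffunP=> i; rewrite ffunE (ord1 i).
Qed.

Lemma sum_ffun2 (F : {ffun 'I_2 -> J} -> K) :
  \sum_u F u = \sum_c \sum_d F (consf c [ffun=> d]).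
Proof. by rewrite sum_consf; apply: eq_bigr => c _; rewrite sum_ffun1. Qed.

Lemma ord_max2 : ord_max = lift ord0 ord0 :> 'I_2.
Proof. exact/val_inj. Qed.

(** The entries of the p-th tensor power of the matrix M. *)
Definition mkern (M : J -> J -> K) p (u v : {ffun 'I_p -> J}) : K :=
  \prod_i M (u i) (v i).

Lemma mkern_joinf M p q (u u' : {ffun 'I_p -> J}) (v v' : {ffun 'I_q -> J}) :
  mkern M (joinf u v) (joinf u' v') = mkern M u u' * mkern M v v'.
Proof.
rewrite /mkern big_split_ord; congr (_ * _); apply: eq_bigr => i _.
  by rewrite !ffunE !(unsplitK (inl i)).
by rewrite !ffunE !(unsplitK (inr i)).
Qed.

Lemma mkern_consf M p c c' (u u' : {ffun 'I_p -> J}) :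
  mkern M (consf c u) (consf c' u') = M c c' * mkern M u u'.
Proof.
rewrite /mkern big_ord_recl !consf0; congr (_ * _).
by apply: eq_bigr => i _; rewrite !consfS.
Qed.

Lemma mkern_perm M p (s : 'S_p) (u v : {ffun 'I_p -> J}) :
  mkern M [ffun i => u (s i)] [ffun i => v (s i)] = mkern M u v.
Proof.
rewrite /mkern [RHS](reindex_inj (@perm_inj _ s)) /=.
by apply: eq_bigr => i _; rewrite !ffunE.
Qed.

Lemma mkern1 M (u v : {ffun 'I_1 -> J}) : mkern M u v = M (u ord0) (v ord0).
Proof. by rewrite /mkern big_ord1. Qed.

Lemma mkern_comp M N p (u v : {ffun 'I_p -> J}) :
  (forall a b, \sum_c M a c * N c b = (a == b)%:R) ->
  \sum_w mkern M u w * mkern N w v = (u == v)%:R.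
Proof.
move=> MN; transitivity (\prod_i \sum_c M (u i) c * N c (v i)).
  by rewrite bigA_distr_bigA; apply: eq_bigr => w _; rewrite /mkern big_split.
under eq_bigr do rewrite MN.
have [->|uv] := eqVneq u v; first by rewrite big1 // => i _; rewrite eqxx.
have [i ui] : exists i, u i != v i.
  apply/existsP; apply: contraNT uv => /existsPn uv; apply/eqP/ffunP=> i.
  by apply/eqP/negPn/uv.
by rewrite (bigD1 i) //= (negPf ui) mul0r.
Qed.

Lemma perm_ffunK p (s : 'S_p) :
  cancel (fun u : {ffun 'I_p -> J} => [ffun i => u (s i)] : {ffun 'I_p -> J})
         (fun u : {ffun 'I_p -> J} => [ffun i => u ((s^-1)%g i)]).
Proof. by move=> u; apply/ffunP=> i; rewrite !ffunE permKV. Qed.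

Lemma sum_perm (V : nmodType) p (s : 'S_p) (F : {ffun 'I_p -> J} -> V) :
  \sum_u F u = \sum_(u : {ffun 'I_p -> J}) F [ffun i => u (s i)].
Proof. exact: (reindex_inj (can_inj (perm_ffunK s))). Qed.

(* The components of a tensor in the basis given by the columns of P, where Q = P^-1. *)
Definition tbase (P Q : J -> J -> K) p q (x : tensor K J p q) : tensor K J p q :=
  [ffun w => \sum_u \sum_v x (u, v) * (mkern Q w.1 u * mkern P v w.2)].

Section Base.
Variables (P Q : J -> J -> K).
Hypothesis PQ : forall a b, \sum_c P a c * Q c b = (a == b)%:R.
Local Notation T := (tbase P Q).

Lemma tbase_linear p q : linear (T (p := p) (q := q)).
Proof.
move=> c x y; apply/ffunP=> w; rewrite !ffunE.
rewrite [X in _ = X + _]mulr_sumr -big_split; apply: eq_bigr => u _.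
rewrite [X in _ = X + _]mulr_sumr -big_split; apply: eq_bigr => v _.
by rewrite /= !ffunE mulrDl; congr (_ + _); apply/esym/mulrA.
Qed.

Lemma tbase_mul p q r s (x : tensor K J p q) (y : tensor K J r s) :
  T (tens_mul x y) = tens_mul (T x) (T y).
Proof.
apply/ffunP=> -[u v]; rewrite !ffunE /= -(joinf_parts u) -(joinf_parts v).
rewrite !lpart_joinf !rpart_joinf.
move: (lpart u) (rpart u) (lpart v) (rpart v) => {u v} u1 u2 v1 v2.
rewrite sum_joinf mulr_suml; apply: eq_bigr => a1 _.
under [LHS]eq_bigr do rewrite /= sum_joinf.
rewrite exchange_big mulr_suml; apply: eq_bigr => b1 _.
rewrite mulr_sumr; apply: eq_bigr => a2 _.
rewrite mulr_sumr; apply: eq_bigr => b2 _.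
by rewrite !ffunE /= !lpart_joinf !rpart_joinf !mkern_joinf; ring.
Qed.

Lemma tbase_contr p q (x : tensor K J p.+1 q.+1) : T (tens_contr x) = tens_contr (T x).
Proof.
apply/ffunP=> -[u v]; rewrite !ffunE /=.
under [RHS]eq_bigr do rewrite ffunE /= sum_consf.
(* The contracted pair is decoupled by a Kronecker symbol, which is then expanded as the product of
   P, from the lower index, and Q, from the upper one. *)
transitivity (\sum_a \sum_b \sum_a' \sum_b' (b == a)%:R *
   (x (consf a a', consf b b') * (mkern Q u a' * mkern P b' v))).
  transitivity (\sum_a \sum_a' \sum_b' (x (consf a a', consf a b') *
      (mkern Q u a' * mkern P b' v))).
    under eq_bigr do under eq_bigr do rewrite ffunE mulr_suml.
    under eq_bigr do rewrite exchange_big.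
    by rewrite exchange_big.
  apply: eq_bigr => a _; rewrite [RHS](bigD1 a) //= [X in _ + X]big1 ?addr0.
    by apply: eq_bigr => a' _; apply: eq_bigr => b' _; rewrite eqxx mul1r.
  move=> b /negPf ba; rewrite big1 // => a' _; rewrite big1 // => b' _.
  by rewrite ba mul0r.
rewrite [RHS]exchange_big; apply: eq_bigr => a _.
under [RHS]eq_bigr do under eq_bigr do rewrite sum_consf.
rewrite exchange_big /= [RHS]exchange_big; apply: eq_bigr => a' _.
rewrite [RHS]exchange_big; apply: eq_bigr => b _.
rewrite [RHS]exchange_big; apply: eq_bigr => b' _.
rewrite -PQ mulr_suml; apply: eq_bigr => c _.
by rewrite !mkern_consf; ring.
Qed.

Lemma tbase_perm p q (s : 'S_p) (t : 'S_q) (x : tensor K J p q) :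
  T (tens_perm s t x) = tens_perm s t (T x).
Proof.
apply/ffunP=> -[u v]; rewrite !ffunE /= [RHS](sum_perm s); apply: eq_bigr => a _.
rewrite [RHS](sum_perm t); apply: eq_bigr => b _.
by rewrite !ffunE /= !mkern_perm.
Qed.

Lemma tbase_id (QP : forall a b, \sum_c Q a c * P c b = (a == b)%:R) :
  T (tens_id K J) = tens_id K J.
Proof.
apply/ffunP=> -[u v]; rewrite !ffunE /= -QP.
rewrite sum_ffun1; apply: eq_bigr => c _; rewrite sum_ffun1 (bigD1 c) //= big1 ?addr0.
  by rewrite !ffunE /= ?ffunE eqxx mul1r !mkern1 ?ffunE.
by move=> d /negPf dc; rewrite !ffunE /= ?ffunE eq_sym dc mul0r.
Qed.

Lemma tbase_scalar c : T (tens_scalar J c) = tens_scalar J c.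
Proof.
have u0 : forall u v : {ffun 'I_0 -> J}, u = v by move=> u v; apply/ffunP; case.
have sum0 (F : {ffun 'I_0 -> J} -> K) u : \sum_a F a = F u.
  by rewrite (bigD1 u) //= big1 ?addr0 // => v; rewrite (u0 v u) eqxx.
apply/ffunP=> -[u v]; rewrite !ffunE /= (sum0 _ u) (sum0 _ v) ffunE.
by rewrite /mkern !big_ord0 !mulr1.
Qed.

(** Contragredient changes of basis in the two arguments leave a pairing unchanged. *)
Lemma dual_pairing (T : finType) (N N' : T -> T -> K) (F G : T -> K) :
  (forall t t', \sum_m N m t * N' m t' = (t == t')%:R) ->
  \sum_m (\sum_t F t * N m t) * (\sum_t G t * N' m t) = \sum_t F t * G t.
Proof.
move=> NN'; under eq_bigr do rewrite big_distrlr.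
rewrite exchange_big; apply: eq_bigr => t _; rewrite exchange_big (bigD1 t) //=.
rewrite [X in _ + X]big1 ?addr0 => [|t' /negPf tt'].
  transitivity (F t * G t * \sum_m N m t * N' m t); last by rewrite NN' eqxx mulr1.
  by rewrite mulr_sumr; apply: eq_bigr => m _; ring.
transitivity (F t * G t' * \sum_m N m t * N' m t').
  by rewrite mulr_sumr; apply: eq_bigr => m _; ring.
by rewrite NN' eq_sym tt' mulr0.
Qed.

Lemma tbase_act p q a b (x : tensor K J (a + q) (b + p)) (y : tensor K J p q) :
  T (tens_act x y) = tens_act (T x) (T y).
Proof.
apply/ffunP=> -[u v]; rewrite !ffunE /=.
(* A contracted index is a pair (s, r). [F] is x with its outer indices already in the new basis,
   and [N], [N'] are the contragredient changes of basis on the contracted ones. *)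
pose S := ({ffun 'I_p -> J} * {ffun 'I_q -> J})%type.
pose F (t : S) := \sum_A \sum_B
  x (joinf A t.2, joinf B t.1) * (mkern Q u A * mkern P B v).
pose N (m t : S) := mkern P t.1 m.1 * mkern Q m.2 t.2.
pose N' (m t : S) := mkern Q m.1 t.1 * mkern P t.2 m.2.
transitivity (\sum_t F t * y t).
  have -> : \sum_t F t * y t = \sum_s \sum_r F (s, r) * y (s, r).
    by rewrite pair_bigA; apply: eq_bigr => -[].
  transitivity (\sum_A \sum_B \sum_s \sum_r x (joinf A r, joinf B s) *
      (mkern Q u A * mkern P B v) * y (s, r)).
    apply: eq_bigr => A _; apply: eq_bigr => B _; rewrite ffunE mulr_suml.
    apply: eq_bigr => s _; rewrite mulr_suml; apply: eq_bigr => r _ /=; ring.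
  under eq_bigr do rewrite exchange_big.
  rewrite exchange_big; apply: eq_bigr => s _.
  under eq_bigr do rewrite exchange_big.
  rewrite exchange_big; apply: eq_bigr => r _; rewrite /F mulr_suml.
  by apply: eq_bigr => A _; rewrite mulr_suml.
rewrite -(dual_pairing (N := N) (N' := N')); last first.
  move=> [s r] [s' r']; rewrite xpair_eqE -mulnb natrM [r == r']eq_sym.
  rewrite -(mkern_comp s s' PQ) -(mkern_comp r' r PQ) big_distrlr /= pair_bigA /=.
  by apply: eq_bigr => -[s0 r0] _; rewrite /N /N' /=; ring.
rewrite pair_bigA /=; apply: eq_bigr => -[s0 r0] _ /=; rewrite !ffunE /=; congr (_ * _).
  have -> : \sum_t F t * N (s0, r0) t = \sum_s \sum_r F (s, r) * N (s0, r0) (s, r).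
    by rewrite pair_bigA; apply: eq_bigr => -[].
  rewrite sum_joinf; under [RHS]eq_bigr do under eq_bigr do rewrite /= sum_joinf.
  transitivity (\sum_s \sum_r \sum_A \sum_B x (joinf A r, joinf B s) *
     (mkern Q u A * mkern P B v) * N (s0, r0) (s, r)).
    apply: eq_bigr => s _; apply: eq_bigr => r _; rewrite /F mulr_suml.
    by apply: eq_bigr => A _; rewrite mulr_suml.
  under [LHS]eq_bigr do rewrite exchange_big.
  rewrite [LHS]exchange_big; apply: eq_bigr => A _.
  rewrite [LHS]exchange_big; apply: eq_bigr => r _.
  rewrite [LHS]exchange_big; apply: eq_bigr => B _; apply: eq_bigr => s _.
  by rewrite !mkern_joinf /N /=; ring.
by rewrite pair_bigA; apply: eq_bigr => -[].
Qed.

End Base.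

Lemma tbaseK (P Q : J -> J -> K) p q (x : tensor K J p q) :
  (forall a b, \sum_c P a c * Q c b = (a == b)%:R) -> tbase Q P (tbase P Q x) = x.
Proof.
move=> PQ; apply/ffunP=> -[u v]; rewrite ffunE /=.
transitivity (\sum_a \sum_b x (a, b) *
    ((\sum_a' mkern P u a' * mkern Q a' a) * (\sum_b' mkern P b b' * mkern Q b' v))).
  transitivity (\sum_a' \sum_b' \sum_a \sum_b x (a, b) *
    (mkern P u a' * mkern Q a' a * (mkern P b b' * mkern Q b' v))).
    apply: eq_bigr => a' _; apply: eq_bigr => b' _; rewrite ffunE mulr_suml.
    apply: eq_bigr => a _; rewrite mulr_suml; apply: eq_bigr => b _ /=; ring.
  under eq_bigr do rewrite exchange_big.
  rewrite exchange_big; apply: eq_bigr => a _.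
  under eq_bigr do rewrite exchange_big.
  rewrite exchange_big; apply: eq_bigr => b _.
  rewrite big_distrlr mulr_sumr; apply: eq_bigr => a' _.
  by rewrite mulr_sumr.
rewrite (bigD1 u) //= [X in _ + X]big1 ?addr0 => [|a /negPf au]; last first.
  by rewrite big1 // => b _; rewrite mkern_comp // eq_sym au mul0r mulr0.
rewrite (bigD1 v) //= [X in _ + X]big1 ?addr0 => [|b /negPf bv]; last first.
  by rewrite [X in _ * X]mulrC mkern_comp // bv mul0r mulr0.
by rewrite !mkern_comp // !eqxx !mulr1.
Qed.

End MultiIndex.

(** * Morphisms with coefficients in a subfield *)

Section Rationality.
Variables (K : fieldType) (J : finType) (gens : structure K J) (A : K -> Prop).
Variables (P Q : J -> J -> K).
Hypotheses (PQ : forall a b, \sum_c P a c * Q c b = (a == b)%:R)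
           (QP : forall a b, \sum_c Q a c * P c b = (a == b)%:R).
Local Notation k0 := (gen_field A).
Local Notation T := (tbase P Q).
Local Notation T' := (tbase Q P).
Hypothesis gensP : forall p q (x : tensor K J p q), gens x -> forall w, k0 (T x w).

(** The base change commutes with every rule generating S, and the rules use only rational scalars
    and field operations; so the generators decide. *)
Lemma invS_rational p q (x : tensor K J p q) : invS gens x -> forall w, k0 (T x w).
Proof.
elim=> {p q x} [p q x gx|||p q x y _ IHx _ IHy|p q c x _ IHx|p q r s x y _ IHx _ IHy
  |p q x _ IHx|p q s t x _ IHx|c c0 _ IHc] //.
- exact: gensP.
- by move=> w; rewrite tbase_id // ffunE; apply: gf_nat.
- move=> p q w; rewrite (_ : T 0 = 0) ?ffunE; first exact: gf0.
  apply/ffunP=> w'; rewrite !ffunE big1 // => u _; rewrite big1 // => v _.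
  by rewrite ffunE mul0r.
- move=> w; have := tbase_linear P Q 1 x y; rewrite !scale1r => ->.
  by rewrite ffunE; apply: gfD.
- move=> w; have := tbase_linear P Q (ratr c) x 0; rewrite !addr0 => ->.
  have -> : T (0 : tensor K J p q) = 0.
    by have := tbase_linear P Q (-1) x x; rewrite !scaleN1r !addNr.
  by rewrite addr0 ffunE; apply: gfM (IHx _); apply: gf_rat.
- by move=> w; rewrite tbase_mul ffunE; apply: gfM.
- by move=> w; rewrite tbase_contr // ffunE; apply: gf_sum.
- by move=> w; rewrite tbase_perm ffunE.
- by move=> w; have := IHc w; rewrite !tbase_scalar !ffunE; apply: gfV.
Qed.

Variable pi : K -> K.
Hypotheses (piB : {morph pi : x y / x - y})
           (piZ : forall l x, k0 l -> pi (l * x) = l * pi x).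

Let pi0 : pi 0 = 0. Proof. by rewrite -[0 in LHS](subrr 0) piB subrr. Qed.
Let piD : {morph pi : x y / x + y}.
Proof. by move=> x y; rewrite -[y in LHS]opprK -[- y]sub0r !piB pi0 sub0r opprK. Qed.

(** As pi is not K-linear, its coordinatewise action depends on the basis. In the one given by P the
    morphisms have entries in k0 and commute with it. *)
Definition tpi p q (x : tensor K J p q) : tensor K J p q :=
  T' [ffun w => pi (T x w)].

Lemma tpiB p q : {morph @tpi p q : x y / x - y}.
Proof.
move=> x y; rewrite /tpi.
have TB P' Q' p' q' (u v : tensor K J p' q') :
    tbase P' Q' (u - v) = tbase P' Q' u - tbase P' Q' v.
  have E := tbase_linear P' Q' (-1) v u; rewrite !scaleN1r in E.
  by rewrite [u - v]addrC E addrC.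
by rewrite -TB; congr (tbase _ _ _); apply/ffunP=> w; rewrite TB !ffunE piB.
Qed.

Lemma tpi_act p q a b (x : tensor K J (a + q) (b + p)) (y : tensor K J p q) :
  invS gens x -> tens_act x (tpi y) = tpi (tens_act x y).
Proof.
move=> Sx; rewrite -{1}[x](tbaseK _ PQ) -tbase_act //; congr (tbase _ _ _).
rewrite tbase_act //; apply/ffunP=> w.
rewrite [LHS]ffunE [RHS]ffunE [tens_act _ _ w]ffunE.
rewrite (big_morph pi piD pi0); apply: eq_bigr => s _.
rewrite (big_morph pi piD pi0); apply: eq_bigr => r _.
rewrite piZ; last exact: (invS_rational Sx).
by congr (_ * _); exact: ffunE.
Qed.

Lemma tpi_scalar c : tpi (tens_scalar J c) = tens_scalar J (pi c).
Proof.
rewrite /tpi tbase_scalar -[RHS](tbase_scalar Q P); congr (tbase _ _ _).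
by apply/ffunP=> w; rewrite !ffunE.
Qed.

Fixpoint pi1 (s : seq (nat * nat)) : fib1 K J s -> fib1 K J s :=
  match s return fib1 K J s -> fib1 K J s with
  | [::] => id
  | o :: s' => fun y => (@tpi o.1 o.2 y.1, pi1 y.2)
  end.

Lemma pi1B s : {morph @pi1 s : u v / u - v}.
Proof.
elim: s => [|o s IHs] //= u v.
by congr (_, _); [exact: (@tpiB o.1 o.2 u.1 v.1) | exact: IHs].
Qed.

Lemma pi1_0 s : pi1 (0 : fib1 K J s) = 0.
Proof. by rewrite -[0 in LHS](subrr 0) pi1B subrr. Qed.

Lemma pi1D s : {morph @pi1 s : u v / u + v}.
Proof. by move=> x y; rewrite -[y in LHS]opprK -[- y]sub0r !pi1B pi1_0 sub0r opprK. Qed.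

Lemma hom_row_pi o t (f : fib0 K J o -> fib1 K J t) :
  hom_row gens f -> forall y, f (@tpi o.1 o.2 y) = pi1 (f y).
Proof.
have rV0 (u v : 'rV[K]_0) : u = v by rewrite (thinmx0 u) (thinmx0 v).
elim: t f => [|o' t IHt] f /=; first by move=> _ y; apply: rV0.
case=> -[x Sx fx] /IHt ft y; have E : (f (tpi y)).1 = tpi (f y).1 by rewrite !fx; exact: tpi_act.
by rewrite [LHS]surjective_pairing E ft.
Qed.

Lemma hom_mat_pi s t (f : fib1 K J s -> fib1 K J t) : {morph f : u v / u + v} ->
  hom_mat gens f -> forall y, f (pi1 y) = pi1 (f y).
Proof.
move=> fD; have f0 : f 0 = 0.
  by have /eqP := fD 0 0; rewrite addr0 -[X in X == _]addr0 (inj_eq (addrI _)) => /eqP ->.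
elim: s f fD f0 => [|o s IHs] f fD f0 /=.
  by move=> _ y; rewrite (thinmx0 (y : 'rV[K]_0)) f0 pi1_0.
case=> fr fm [y1 y2] /=.
have -> : (tpi y1, pi1 y2) = (tpi y1, 0) + (0, pi1 y2) :> fib1 K J (o :: s).
  by congr (_, _); rewrite /= ?addr0 ?add0r.
have yE : (y1, y2) = (y1, 0) + (0, y2) :> fib1 K J (o :: s).
  by congr (_, _); rewrite /= ?addr0 ?add0r.
rewrite yE !fD pi1D; congr (_ + _); first exact: (hom_row_pi fr).
apply: (IHs (fun y => f (0, y))) fm _ => // u v.
by rewrite -fD; congr (f (_, _)); rewrite /= addr0.
Qed.

Lemma hom_1_pi (s t : seq (nat * nat)) (f : 'Hom(fib1 K J s, fib1 K J t)) :
  hom_1 gens f -> forall y, f (pi1 y) = pi1 (f y).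
Proof. by apply: hom_mat_pi => u v; rewrite linearD. Qed.

Definition pist1 : pist (cat1 gens) := @Pist K (cat1 gens) pi1 pi1B hom_1_pi.

End Rationality.

Lemma invariants_rational (K : fieldType) (J : finType) (gens : structure K J)
    (A : K -> Prop) (P Q : J -> J -> K) :
  (forall a b, \sum_c P a c * Q c b = (a == b)%:R) ->
  (forall a b, \sum_c Q a c * P c b = (a == b)%:R) ->
  (forall p q (x : tensor K J p q), gens p q x -> forall w, gen_field A (tbase P Q x w)) ->
  forall c, field_of_invariants gens c -> gen_field A c.
Proof.
move=> PQ QP gensP c /limHom_comm cP; apply: boolp.contrapT => /gf_separation.
case=> pi [piB piZ pi1 pic].
(* An invariant c commutes with the action on the unit object. At the scalar 1 this reads c pi(1) =
   pi(c), that is 0 = 1. *)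
have /(congr1 fst) := cP (pist1 PQ QP gensP piB piZ) (tens_scalar J 1, 0).
rewrite !scale_lfunE !id_lfunE /= tpi_scalar pi1.
have -> : c *: tens_scalar J 1 = tens_scalar J c.
  by apply/ffunP=> w; rewrite !ffunE [_ *: _]mulr1.
rewrite tpi_scalar pic => /(congr1 (fun x : tensor K J 0 0 =>
  x (ffun0 (card_ord 0), ffun0 (card_ord 0)))).
by rewrite !ffunE [_ *: _]mulr0 => /eqP; rewrite eq_sym oner_eq0.
Qed.

(** * Structure tensors in a basis transported from the model *)

Section AdaptedBasis.
Variables (k : fieldExtType rat) (K : closedFieldType) (iota : {rmorphism k -> K}).
Variables (n : nat) (zeta : k).
Hypotheses (n_gt1 : (1 < n)%N) (zetaP : n.-primitive_root zeta).

Local Notation I := (tidx n).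
Local Notation e := (@bas K I).
Local Notation z := (iota zeta).
Local Notation zP := (prim_iota iota zetaP).

Section FieldOfDefinition.
Variable A : K -> Prop.
Hypothesis Az : A z.
Local Notation k0 := (gen_field A).

Lemma gf_iota : <<1%VS; zeta>>%VS = fullv -> forall x, k0 (iota x).
Proof.
move=> kgen x; have : x \in <<1; zeta>>%VS by rewrite kgen memvf.
case/Fadjoin_polyP => p /polyOverP p1 ->.
rewrite horner_coef rmorph_sum; apply: gf_sum => i; rewrite rmorphM rmorphXn.
apply: gfM; last exact/gfX/gf_in.
have /vlineP [c ->] := p1 i.
by have := fmorph_eq_rat (iota \o in_alg k) c; rewrite /= => ->; apply: gf_rat.
Qed.

Lemma gf_qbin q j l : k0 q -> k0 (qbin q j l).
Proof.
move=> kq; elim: j l => [|j IHj] [|l] /=; try exact: gf_1; first exact: gf0.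
by apply: gfD => //; apply: gfM => //; apply: gfX.
Qed.

Lemma gf_comul a p : k0 (comul z n_gt1 a p).
Proof.
rewrite [p]surjective_pairing comulE; apply: gfM; first exact: gf_nat.
by apply/gf_qbin/gfV/gf_in.
Qed.

Lemma gf_msc b a c d : k0 b -> k0 (msc z n_gt1 b a c d).
Proof.
move=> kb; rewrite !ffunE; apply: gfM; first by apply/gfV/gfX/gf_in.
by apply: gfM; [apply: gfX|apply: gf_nat].
Qed.

End FieldOfDefinition.

Section Basis.
Variables (al : cochain K n) (b : K) (phi : 'End(fspace K I)).
Hypothesis phiP : model_iso n_gt1 zP (acochain al) b phi.

Definition bmat (c a : I) : K := phi (e a) c.
Definition bmatV (a c : I) : K := phi^-1%VF (e c) a.

Lemma iso_ker : lker phi == 0%VS.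
Proof. by apply/lker0P; case: phiP => /bij_inj. Qed.

Lemma bmat_mulV a c : \sum_d bmat a d * bmatV d c = (a == c)%:R.
Proof.
have := congr1 (fun w : fspace K I => w a) (lker0_lfunVK iso_ker (e c)).
rewrite -[phi^-1%VF _]comb_id comb_lin combE ffunE => <-.
by apply: eq_bigr => d _; rewrite mulrC.
Qed.

Lemma bmatV_coord w a : phi^-1%VF w a = \sum_c w c * bmatV a c.
Proof. by rewrite -[w in LHS]comb_id comb_lin combE. Qed.

Lemma bmat_Vmul a c : \sum_d bmatV a d * bmat d c = (a == c)%:R.
Proof.
have := congr1 (fun w : fspace K I => w a) (lker0_lfunK iso_ker (e c)).
by rewrite /= bmatV_coord ffunE => <-; apply: eq_bigr => d _; rewrite mulrC.
Qed.

Lemma tbase_mul_tensor w : tbase bmat bmatV (mul_tensor iota zeta al) w =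
  msc z n_gt1 b (w.2 ord0) (w.2 ord_max) (w.1 ord0).
Proof.
have [_ phiM _] := phiP.
have -> : msc z n_gt1 b (w.2 ord0) (w.2 ord_max) = phi^-1%VF
    (tmul z n_gt1 (acochain al) (phi (e (w.2 ord0))) (phi (e (w.2 ord_max)))).
  by rewrite -phiM lker0_lfunK ?iso_ker // sc_bas.
rewrite bmatV_coord.
case: w => u v; rewrite ffunE /= sum_ffun1; apply: eq_bigr => c _.
rewrite sum_ffun2 /tmul combE mulr_suml; apply: eq_bigr => a' _.
rewrite combE mulr_sumr mulr_suml; apply: eq_bigr => d' _.
rewrite mkern1 /mkern big_ord_recl big_ord1 [mul_tensor _ _ _ _]ffunE /= ord_max2.
by rewrite !consf0 !consfS !ffunE twist_mulE // /tmul !comb_bas /bmat; ring.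
Qed.

Lemma tbase_Top_tensor f w : tbase bmat bmatV (Top_tensor iota zeta f) w =
  Top iota zeta f (e (w.2 ord0)) (w.1 ord0).
Proof.
rewrite -[Top _ _ _ (e _)](lker0_lfunK iso_ker) -(Top_phi phiP) bmatV_coord.
case: w => u v; rewrite ffunE /= sum_ffun1; apply: eq_bigr => c _.
rewrite sum_ffun1 -[phi (e _)]comb_id.
have TL : linear (Top iota zeta f).
  by move=> x v1 v2; rewrite !(TopE _ n_gt1 zetaP) rho_linear comb_linear.
rewrite (lin_comb _ _ TL) combE mulr_suml; apply: eq_bigr => d _.
by rewrite !ffunE /= !mkern1 !ffunE /bmat; ring.
Qed.

(** In the basis phi(e_a) the product has the structure constants of A_b and T_f is given by Delta
    and f, so all entries lie in the field. It contains b because a is a power of z times b. *)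
Lemma invariants_in_field a : <<1%VS; zeta>>%VS = fullv ->
  canonical_scalar iota zeta al a -> forall c,
  field_of_invariants (comodule_algebra_structure iota zeta al) c ->
  gen_field (fun x => x = z \/ x = a) c.
Proof.
move=> kgen ab; have {}ab := (canonical_scalar_phi phiP a).1 ab.
set A := fun x => _; have Az : A z by left.
have kb : gen_field A b.
  have -> : b = (root_unit iota n zeta)^-1 * a.
    by rewrite ab mulKf // (root_unit_neq0 _ n_gt1 zetaP).
  by apply: gfM; [apply/gfV/gfV/gfX/gf_in|apply: gf_in; right].
apply: (invariants_rational bmat_mulV bmat_Vmul).
move=> _ _ _ [|f] w; first by rewrite tbase_mul_tensor; apply: gf_msc.
rewrite tbase_Top_tensor (TopE _ n_gt1 zetaP) [rho _ _ _]comb_bas combE.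
apply: gf_sum => p; apply: gfM; first exact: gf_comul.
by rewrite !ffunE; apply: gfM; [apply: gf_iota|apply: gf_nat].
Qed.

End Basis.
End AdaptedBasis.

(** * Lower bound for the field of invariants *)

Section LevelOne.
Variables (K : fieldType) (C : vcat K).

(** The good sequence is 0 -> A -> A -> 0 with the identity in the middle, which must therefore be a
    morphism of C. *)
Lemma klift_hom (A B : obj C) (f : 'Hom(fib A, fib B)) :
  Defs.hom (\1%VF : 'Hom(fib A, fib A)) -> Defs.hom f -> kerX (klift f).
Proof.
move=> idP fP; pose zA : 'Hom(fib (@zobj _ C), fib A) := 0.
have zE v : zA v = 0 by rewrite lfunE.
apply: (@X_base _ _ (@zobj _ C) A (kemb A) (kemb B) zA \1%VF f).
- exact: hom0.
- exact: idP.
- exact: fP.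
- apply/vspaceP=> v; rewrite memv_ker id_lfunE.
  apply/memv_imgP/eqP => [[u _ ->]|->]; first exact: zE.
  by exists 0; rewrite ?mem0v ?zE.
- apply/vspaceP=> v; rewrite mem_kemb; apply/memv_imgP; exists v; rewrite ?memvf //.
  by rewrite id_lfunE.
- by apply/lfunP=> v; rewrite comp_lfunE !lfunE.
- by apply/lfunP=> v; rewrite comp_lfunE zE linear0 lfunE.
- by move=> y u uy; rewrite vsval_klift uy id_lfunE.
Qed.

Lemma klift_comp (A B D : obj C) (f : 'Hom(fib A, fib B)) (g : 'Hom(fib B, fib D)) :
  klift (g \o f)%VF = (klift g \o klift f)%VF.
Proof.
apply/lfunP=> u; apply: subvs_inj.
by rewrite comp_lfunE !vsval_klift comp_lfunE.
Qed.

Lemma klift1 (A : obj C) : klift (\1%VF : 'Hom(fib A, fib A)) = \1%VF.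
Proof. by apply/lfunP=> u; apply: subvs_inj; rewrite vsval_klift !id_lfunE. Qed.

Lemma kliftB (A B : obj C) (f g : 'Hom(fib A, fib B)) :
  klift (f - g) = klift f - klift g.
Proof.
apply/lfunP=> u; apply: subvs_inj; rewrite vsval_klift !add_lfunE !opp_lfunE.
by rewrite [RHS]linearB /= !vsval_klift.
Qed.

Lemma klift_inv (A B : obj C) (f : 'Hom(fib A, fib B)) (g : 'Hom(fib B, fib A)) :
  (g \o f = \1)%VF -> (f \o g = \1)%VF -> kerX (klift f) -> kerX (klift g).
Proof.
by move=> gf fg /X_inv; apply; rewrite -klift_comp ?gf ?fg klift1.
Qed.

(** Composition multiplies scalars and the inversion rule of Ker inverts them, so the scalars acting
    on A form a field. *)
Lemma scalar_field (A : obj C) (D : K -> Prop) :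
  Defs.hom (\1%VF : 'Hom(fib A, fib A)) ->
  (forall c, D c -> kerX (klift (c *: (\1%VF : 'Hom(fib A, fib A))))) ->
  forall c, gen_field D c -> kerX (klift (c *: (\1%VF : 'Hom(fib A, fib A)))).
Proof.
move=> idP DP c; elim=> {c} [x Dx||x y _ IHx _ IHy|x y _ IHx _ IHy].
- exact: DP.
- by rewrite scale1r; apply: klift_hom.
- rewrite scalerBl kliftB; apply: X_D IHx _; exact: X_N.
(* A quotient by 0 is 0 by convention, and the zero morphism is available. *)
have [->|y0] := eqVneq y 0.
  rewrite invr0 mulr0 scale0r; rewrite -(subrr (\1%VF : 'Hom(fib A, fib A))) kliftB subrr.
  exact: X_0.
have Ecomp (s t : K) : ((s *: \1) \o (t *: \1) = (s * t) *: \1 :> 'Hom(fib A, fib A))%VF.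
  by apply/lfunP=> v; rewrite comp_lfunE !scale_lfunE !id_lfunE scalerA.
rewrite -Ecomp klift_comp; apply: X_comp IHx.
by apply: klift_inv IHy; rewrite Ecomp ?mulfV ?mulVf // scale1r.
Qed.

End LevelOne.

(** * Morphisms given by tensors of small arity *)

Section Embedding.
Variables (K : fieldType) (J : finType) (gens : structure K J).
Local Notation fib0 := (fib0 K J).
Local Notation fib1 := (fib1 K J).

(** The fibre of a formal sum with one summand still has a second factor, the space of row vectors
    of length 0. *)
Definition emb (o o' : nat * nat) (g : 'Hom(fib0 o, fib0 o')) :
  'Hom(fib1 [:: o], fib1 [:: o']) :=
  linfun (fun y : fib1 [:: o] => (g y.1, y.2) : fib1 [:: o']).

Lemma embE o o' (g : 'Hom(fib0 o, fib0 o')) y : emb g y = (g y.1, y.2).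
Proof.
pose f (y : fib1 [:: o]) : fib1 [:: o'] := (g y.1, y.2).
have fL : linear f by move=> c u v; rewrite /f /= linearP.
pose F : {linear fib1 [:: o] -> fib1 [:: o']} :=
  HB.pack f (GRing.isLinear.Build K (fib1 [:: o]) (fib1 [:: o']) _ f fL).
exact: (lfunE F y).
Qed.

Lemma emb_comp o o' o'' (g : 'Hom(fib0 o, fib0 o')) (h : 'Hom(fib0 o', fib0 o'')) :
  emb (h \o g)%VF = (emb h \o emb g)%VF.
Proof. by apply/lfunP=> y; rewrite comp_lfunE !embE comp_lfunE. Qed.

Lemma emb1 o : emb (\1%VF : 'Hom(fib0 o, fib0 o)) = \1%VF.
Proof. by apply/lfunP=> -[y r]; rewrite embE !id_lfunE. Qed.

Lemma emb_scale o c : emb (c *: (\1%VF : 'Hom(fib0 o, fib0 o))) = c *: \1%VF.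
Proof.
apply/lfunP=> -[y r]; rewrite embE !scale_lfunE !id_lfunE; congr (_, _).
have rV0 (u v : 'rV[K]_0) : u = v by rewrite (thinmx0 u) (thinmx0 v).
exact: rV0.
Qed.

Lemma hom_emb o o' (g : 'Hom(fib0 o, fib0 o')) : hom_0 gens g -> hom_1 gens (emb g).
Proof.
case=> x Sx gx; do 2!split=> //; exists x => // y.
by rewrite embE /= gx.
Qed.

Definition actl o o' (x : tensor K J (o'.1 + o.2) (o'.2 + o.1)) :
  'Hom(fib0 o, fib0 o') := linfun (@tens_act K J o.1 o.2 o'.1 o'.2 x).

Lemma actlE o o' (x : tensor K J (o'.1 + o.2) (o'.2 + o.1)) y :
  actl x y = tens_act x y.
Proof.
have fL : linear (@tens_act K J o.1 o.2 o'.1 o'.2 x).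
  move=> c u v; apply/ffunP=> w; rewrite !ffunE.
  rewrite [X in _ = X + _]mulr_sumr -big_split; apply: eq_bigr => s _.
  rewrite [X in _ = X + _]mulr_sumr -big_split; apply: eq_bigr => r _.
  by rewrite /= !ffunE mulrDr; congr (_ + _); apply: mulrCA.
pose F : {linear fib0 o -> fib0 o'} :=
  HB.pack (@tens_act K J o.1 o.2 o'.1 o'.2 x) (GRing.isLinear.Build K (fib0 o) (fib0 o') _ _ fL).
exact: (lfunE F y).
Qed.

Lemma hom_actl o o' (x : tensor K J (o'.1 + o.2) (o'.2 + o.1)) :
  invS gens x -> hom_1 gens (emb (actl x)).
Proof. by move=> Sx; apply: hom_emb; exists x => // y; rewrite actlE. Qed.

Lemma ffunI0 (u v : {ffun 'I_0 -> J}) : u = v.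
Proof. by apply/ffunP; case. Qed.

Lemma sum_ffun0 (F : {ffun 'I_0 -> J} -> K) u : \sum_v F v = F u.
Proof. by rewrite (bigD1 u) //= big1 ?addr0 // => v; rewrite (ffunI0 v u) eqxx. Qed.

Lemma joinf_l p q (u : {ffun 'I_p -> J}) (v : {ffun 'I_q -> J}) i :
  joinf u v (lshift q i) = u i.
Proof. by rewrite -[in RHS](lpart_joinf u v) [RHS]ffunE. Qed.

Lemma joinf_r p q (u : {ffun 'I_p -> J}) (v : {ffun 'I_q -> J}) i :
  joinf u v (rshift p i) = v i.
Proof. by rewrite -[in RHS](rpart_joinf u v) [RHS]ffunE. Qed.

Lemma act_scalar c y : @tens_act K J 0 0 0 0 (tens_scalar J c) y = c *: y.
Proof.
apply/ffunP=> -[u v]; rewrite !ffunE (sum_ffun0 _ u) (sum_ffun0 _ u) /= ffunE.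
by rewrite (ffunI0 v u).
Qed.

Lemma ord0l q : ord0 = lshift q (ord0 : 'I_1). Proof. exact/val_inj. Qed.
Lemma ord0r : ord0 = rshift 0 (ord0 : 'I_1). Proof. exact/val_inj. Qed.

Lemma joinf_0l (u : {ffun 'I_0 -> J}) (v : {ffun 'I_1 -> J}) : (joinf u v) ord0 = v ord0.
Proof. by rewrite [in LHS]ord0r joinf_r. Qed.

Lemma joinf_0r q (u : {ffun 'I_1 -> J}) (v : {ffun 'I_q -> J}) : (joinf u v) ord0 = u ord0.
Proof. by rewrite [in LHS](ord0l q) joinf_l. Qed.

Lemma act_id y : @tens_act K J 1 0 1 0 (tens_id K J) y = y.
Proof.
apply/ffunP=> -[u v]; rewrite ffunE /= (bigD1 u) //= [X in _ + X]big1 ?addr0.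
  by rewrite (sum_ffun0 _ v) ffunE /= joinf_0l joinf_0r eqxx mul1r.
move=> s su; rewrite (sum_ffun0 _ v) ffunE /= joinf_0l joinf_0r.
case: eqP => [us|]; last by rewrite mul0r.
by case/eqP: su; apply/ffunP=> i; rewrite (ord1 i) us.
Qed.

Lemma act_01 (f : J -> K) (x : tensor K J 0 1) y :
  (forall w, x w = f (w.2 ord0)) ->
  @tens_act K J 0 0 0 1 x y = [ffun w : tix J 0 1 => f (w.2 ord0) * y (w.1, w.1)].
Proof.
move=> xE; apply/ffunP=> -[u v]; rewrite !ffunE /= (sum_ffun0 _ u) (sum_ffun0 _ u).
by rewrite [x _]xE /= joinf_0r.
Qed.

Lemma act_10 (f : J -> K) (x : tensor K J 0 1) y :
  (forall w, x w = f (w.2 ord0)) ->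
  @tens_act K J 1 0 0 0 x y = [ffun w : tix J 0 0 => \sum_c f c * y ([ffun=> c], w.1)].
Proof.
move=> xE; apply/ffunP=> -[u v]; rewrite !ffunE /= sum_ffun1; apply: eq_bigr => c _.
by rewrite (sum_ffun0 _ u) [x _]xE /= joinf_0l ffunE.
Qed.

Lemma act_11 (f : J -> J -> K) (x : tensor K J 0 2) y :
  (forall w, x w = f (w.2 ord0) (w.2 ord_max)) ->
  @tens_act K J 1 0 0 1 x y =
  [ffun w : tix J 0 1 => \sum_c f (w.2 ord0) c * y ([ffun=> c], w.1)].
Proof.
move=> xE; apply/ffunP=> -[u v]; rewrite !ffunE /= sum_ffun1; apply: eq_bigr => c _.
rewrite (sum_ffun0 _ u) [x _]xE /= joinf_0r; congr (f _ _ * _).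
have o1 : ord_max = rshift 1 (ord0 : 'I_1) by apply/val_inj.
apply: (etrans (congr1 (joinf v [ffun=> c]) o1)); apply: (etrans (joinf_r _ _ _)).
by rewrite ffunE.
Qed.

Lemma contr_mul_Top (l : J -> K) (g : J -> J -> K) (x : tensor K J 0 1) (y : tensor K J 1 1) :
  (forall w, x w = l (w.2 ord0)) -> (forall w, y w = g (w.2 ord0) (w.1 ord0)) ->
  forall w, @tens_contr K J 0 1 (tens_mul x y) w = \sum_c l c * g (w.2 ord0) c.
Proof.
move=> xE yE [u v]; rewrite ffunE; apply: eq_bigr => c _; rewrite ffunE /= xE yE /=.
have o1 : rshift 1 (ord0 : 'I_1) = lift ord0 ord0 by apply/val_inj.
congr (l _ * g _ _); rewrite [LHS]ffunE.
- by rewrite -(ord0l 1) consf0.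
- by apply: (etrans (congr1 (consf c v) o1)); rewrite consfS.
- by rewrite -ord0r consf0.
Qed.

Lemma contr_mul_mul (l : J -> K) (g : J -> J -> J -> K) (x : tensor K J 0 1) (y : tensor K J 1 2) :
  (forall w, x w = l (w.2 ord0)) ->
  (forall w, y w = g (w.2 ord0) (w.2 ord_max) (w.1 ord0)) ->
  forall w, @tens_contr K J 0 2 (tens_mul x y) w =
    \sum_c l c * g (w.2 ord0) (w.2 ord_max) c.
Proof.
move=> xE yE [u v]; rewrite ffunE; apply: eq_bigr => c _; rewrite ffunE /= xE yE /=.
have o1 : rshift 1 (ord0 : 'I_2) = lift ord0 ord0 by apply/val_inj.
have o2 : rshift 1 (ord_max : 'I_2) = lift ord0 ord_max by apply/val_inj.
congr (l _ * g _ _ _); rewrite [LHS]ffunE.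
- by rewrite -(ord0l 2) consf0.
- by apply: (etrans (congr1 (consf c v) o1)); rewrite consfS.
- by apply: (etrans (congr1 (consf c v) o2)); rewrite consfS.
- by rewrite -ord0r consf0.
Qed.

End Embedding.

(** * The trace form and the recovery of b *)

Section Invariants.
Variables (k : fieldExtType rat) (K : closedFieldType) (iota : {rmorphism k -> K}).
Variables (n : nat) (zeta : k).
Hypotheses (n_gt1 : (1 < n)%N) (zetaP : n.-primitive_root zeta).

Local Notation I := (tidx n).
Local Notation e := (@bas K I).
Local Notation z := (iota zeta).
Local Notation zP := (prim_iota iota zetaP).
Local Notation ix := (ix n_gt1).

Variables (al : cochain K n) (b : K) (phi : 'End(fspace K I)).
Hypothesis phiP : model_iso n_gt1 zP (acochain al) b phi.
Local Notation A := (model n_gt1 zP b).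
Local Notation mul := (twist_mul iota zeta al).
Local Notation gens := (comodule_algebra_structure iota zeta al).
Local Notation n2 := ((n * n)%:R : K).

Lemma n2_neq0 : n2 != 0.
Proof. by rewrite natrM mulf_neq0 // (prim_root_natf_neq0 zP). Qed.

(** The trace of right multiplication by w. *)
Definition tr (w : fspace K I) : K := \sum_c mul (e c) w c.

Lemma trace_iso (F : fspace K I -> fspace K I) : linear F ->
  \sum_c F (e c) c = \sum_a phi^-1%VF (F (phi (e a))) a.
Proof.
move=> FL; transitivity (\sum_a \sum_c \sum_d bmatV phi a d * bmat phi c a * F (e c) d).
  rewrite exchange_big; apply: eq_bigr => c _; rewrite exchange_big (bigD1 c) //=.
  rewrite [X in _ + X]big1 ?addr0 => [|d /negPf dc].
    transitivity ((\sum_a bmat phi c a * bmatV phi a c) * F (e c) c).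
      by rewrite (bmat_mulV phiP) eqxx mul1r.
    by rewrite mulr_suml; apply: eq_bigr => a _; ring.
  transitivity ((\sum_a bmat phi c a * bmatV phi a d) * F (e c) d).
    by rewrite mulr_suml; apply: eq_bigr => a _; ring.
  by rewrite (bmat_mulV phiP) eq_sym dc mul0r.
apply: eq_bigr => a _; rewrite bmatV_coord exchange_big; apply: eq_bigr => d _.
rewrite -[phi (e a)]comb_id (lin_comb _ _ FL) combE mulr_suml.
by apply: eq_bigr => c _; rewrite /bmat; ring.
Qed.

Let phiM (u v : scT A) : mul (phi u) (phi v) = phi (u * v).
Proof. by case: phiP => _ -> _; rewrite twist_mulE. Qed.

Let phiK : cancel phi phi^-1%VF. Proof. exact: lker0_lfunK (iso_ker phiP). Qed.
Let phiVK : cancel phi^-1%VF phi. Proof. exact: lker0_lfunVK (iso_ker phiP). Qed.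

Lemma msc_coord c d a : msc z n_gt1 b c d a =
  z ^- (c.2 * d.1) * b ^+ ((c.2 + d.2) %/ n) * (a == ix (c.1 + d.1) (c.2 + d.2))%:R.
Proof. by rewrite /msc /mon !ffunE; apply: mulrA. Qed.

Lemma ix_addE (a d : I) : (a == ix (a.1 + d.1) (a.2 + d.2)) = (d == ix 0 0).
Proof.
have E (x y : 'I_n) : (x == (x + y) %% n :> nat)%N = (y == 0 :> nat)%N.
  rewrite -{1}(modn_small (ltn_ord x)) -{1}[x : nat]addn0 eqn_modDl mod0n.
  by rewrite (modn_small (ltn_ord y)) eq_sym.
by case: a d => [a1 a2] [d1 d2]; rewrite !xpair_eqE -!val_eqE /= !E !mod0n.
Qed.

(** Right multiplication by a basis monomial other than 1 sends every basis monomial to a multiple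
    of a different one and has trace 0. *)
Lemma tr_phi v : tr (phi v) = n2 * v (ix 0 0).
Proof.
have mL w : linear (fun u => mul u w).
  by move=> c u1 u2; rewrite !twist_mulE // /tmul comb_linear.
rewrite /tr (trace_iso (mL _)); transitivity (\sum_(a : I) v (ix 0 0)); last first.
  by rewrite sumr_const card_prod card_ord mulr_natl.
apply: eq_bigr => a _.
rewrite phiM phiK scmulE comb_bas combE (bigD1 (ix 0 0)) //= big1 ?addr0.
  rewrite msc_coord ix_addE eqxx /= !mod0n muln0 addn0 divn_small // !expr0.
  by rewrite invr1 !mulr1.
by move=> d /negPf d0; rewrite msc_coord ix_addE d0 !mulr0.
Qed.

Lemma Top_coord f v : Top iota zeta f v (ix 0 0) =
  \sum_a v a * (((a.1 + a.2) %% n == 0)%N%:R * iota (f a)).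
Proof.
rewrite TopE // comb_rho combE; apply: eq_bigr => a _; congr (_ * _).
rewrite combE (bigD1 (ix 0 0, a)) //= [X in _ + X]big1 ?addr0 => [|[c d] /= cd].
  rewrite comulE /cocond !ffunE eqxx /= !mod0n add0n eqxx qbinn !eqxx mulr1.
  by rewrite andbT [(0 == _)%N]eq_sym [_ *: _]mulr1.
rewrite !ffunE eq_sym; have [cE|_] := eqVneq; last by rewrite [_ *: _]mulr0 mulr0.
rewrite comulE /cocond cE /= mod0n !add0n.
have [/and3P[/eqP d1 _ /eqP d2]|] := boolP [&& _, _ & _]; last by rewrite !mul0r.
by case/negP: cd; rewrite cE xpair_eqE eqxx -[d](ixE n_gt1) d1 d2 ixE eqxx.
Qed.

(** The condition for 1 (x) e_a to occur in Delta(e_a), whose last term is g^(i+j) (x) g^i x^j. Only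
    then can the trace detect the coordinate a after some T_f. *)
Definition antidiag (a : I) := ((a.1 + a.2) %% n == 0)%N.

Lemma tr_Top a v : antidiag a -> tr (Top iota zeta (bas k a) (phi v)) = n2 * v a.
Proof.
move=> aa; rewrite (Top_phi phiP) tr_phi Top_coord (bigD1 a) //= big1 ?addr0.
  by rewrite /antidiag in aa; rewrite aa ffunE eqxx rmorph_nat -[true%:R]/(1 : K) !mulr1.
by move=> d /negPf da; rewrite ffunE da rmorph0 !mulr0.
Qed.

(** The monomial inverse to e_c up to a scalar when b is nonzero; [ix] brings an exponent n back to
    0. *)
Definition ixV (c : I) : I := ix (n - c.1) (n - c.2).

Lemma ixV_addE (c d : I) :
  (ix 0 0 == ix ((ixV c).1 + d.1) ((ixV c).2 + d.2)) = (d == c).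
Proof.
have E m x y : (x < m)%N -> (y < m)%N -> (0 == ((m - x) %% m + y) %% m)%N = (y == x)%N.
  move=> xm ym; rewrite modnDml -(modnn m) -{1}(subnK (ltnW xm)) eqn_modDl.
  by rewrite !modn_small // eq_sym.
by case: c d => [c1 c2] [d1 d2]; rewrite !xpair_eqE -!val_eqE /= mod0n !E //.
Qed.

(* Pairing e_{-c} with y isolates the coordinate y_c: the trace form is monomial. *)
Lemma antidual_coord c (y : scT A) : b != 0 -> exists2 m, m != 0 &
  ((e (ixV c) : scT A) * y) (ix 0 0) = m * y c.
Proof.
move=> b0; exists (z ^- ((ixV c).2 * c.1) * b ^+ (((ixV c).2 + c.2) %/ n)).
  by rewrite mulf_neq0 ?invr_neq0 ?expf_neq0 // (prim_neq0 n_gt1 zP).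
rewrite scmulE comb_bas combE (bigD1 c) //= big1 ?addr0 => [|d /negPf dc].
  by rewrite msc_coord ixV_addE eqxx mulr1 mulrC.
by rewrite msc_coord ixV_addE dc !mulr0.
Qed.

Lemma tr_linear : linear (tr : fspace K I -> K^o).
Proof.
move=> c u v; rewrite /tr [X in _ = X + _]mulr_sumr -big_split; apply: eq_bigr => d _.
rewrite !twist_mulE // /tmul !comb_bas combDl combZl !ffunE; by [].
Qed.

Lemma mul_linearr u : linear (fun v => mul u v).
Proof.
move=> c v w; rewrite !twist_mulE // /tmul -combZr -combDr; apply: eq_comb => d.
by rewrite combDl combZl.
Qed.

Lemma Top_linear (f : fspace k I) : linear (Top iota zeta f).
Proof. by move=> x v1 v2; rewrite !(TopE _ n_gt1 zetaP) rho_linear comb_linear. Qed.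

Definition tr_tensor : tensor K I 0 1 := @tens_contr K I 0 1 (mul_tensor iota zeta al).

Lemma tr_tensorE w : tr_tensor w = tr (e (w.2 ord0)).
Proof.
rewrite ffunE; apply: eq_bigr => c _; rewrite ffunE /= !consf0.
by rewrite ord_max2 consfS.
Qed.

Definition trT_tensor (f : fspace k I) : tensor K I 0 1 :=
  @tens_contr K I 0 1 (tens_mul tr_tensor (Top_tensor iota zeta f)).

Lemma sum_tr (w : fspace K I) : \sum_c tr (e c) * w c = tr w.
Proof.
rewrite -[w in RHS]comb_id (lin_comb _ _ tr_linear).
by apply: eq_bigr => c _; apply: mulrC.
Qed.

Lemma trT_tensorE f w : trT_tensor f w = tr (Top iota zeta f (e (w.2 ord0))).
Proof.
rewrite -sum_tr; apply: (contr_mul_Top (l := fun c => tr (e c))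
  (g := fun a c => Top iota zeta f (e a) c)) => {}w; first exact: tr_tensorE.
by rewrite ffunE.
Qed.

Definition trM_tensor : tensor K I 0 2 :=
  @tens_contr K I 0 2 (tens_mul tr_tensor (mul_tensor iota zeta al)).

Lemma trM_tensorE w : trM_tensor w = tr (mul (e (w.2 ord0)) (e (w.2 ord_max))).
Proof.
rewrite -sum_tr; apply: (contr_mul_mul (l := fun c => tr (e c))
  (g := fun a d c => mul (e a) (e d) c)) => {}w; first exact: tr_tensorE.
by rewrite ffunE.
Qed.

Lemma ratrV : ratr ((n * n)%:R^-1) = n2^-1 :> K.
Proof.
have := fmorph_eq_rat (iota \o in_alg k) ((n * n)%:R^-1); rewrite /= => <-.
by rewrite -[_%:A]/(in_alg k _) !fmorphV !rmorph_nat.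
Qed.

Lemma invS_scalar_div c : invS gens (tens_scalar I (n2 * c)) -> invS gens (tens_scalar I c).
Proof.
move=> Sc; have := iS_Z ((n * n)%:R^-1) Sc; rewrite ratrV.
congr (invS _ _); apply/ffunP=> w; rewrite !ffunE.
by apply: mulKf; apply: n2_neq0.
Qed.

(** The scalar 1, which gives the identity of the unit object, is not among the generators of S: it
    is the trace n^2 of Id_W, divided by that integer. *)
Lemma invS_scalar1 : invS gens (tens_scalar I 1).
Proof.
apply: invS_scalar_div; rewrite mulr1.
have := @iS_contr _ _ gens 0 0 _ (iS_id gens); congr (invS _ _).
apply/ffunP=> w; rewrite !ffunE; under eq_bigr do rewrite ffunE /= !consf0 eqxx.
by rewrite sumr_const card_prod card_ord.
Qed.

Lemma invS_scalar_zeta : invS gens (tens_scalar I z).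
Proof.
pose f : fspace k I := [ffun a : I => zeta * (a.2 == 0 :> nat)%N%:R].
apply: invS_scalar_div.
have := @iS_contr _ _ gens 0 0 _ (iS_gen (cas_Top iota zeta al f)); congr (invS _ _).
apply/ffunP=> w; rewrite !ffunE; under eq_bigr do rewrite ffunE /= !consf0.
transitivity (\sum_(c : I) z); last by rewrite sumr_const card_prod card_ord mulr_natl.
apply: eq_bigr => c _; rewrite TopE // [rho _ _ _]comb_bas.
have -> : comb (comul z n_gt1 c) (fun p => iota (f p.2) *: e p.1) = z *: e c.
  rewrite -(counitr z n_gt1 c (fun d => z *: e d)); apply: eq_comb => p.
  by rewrite ffunE rmorphM rmorph_nat scalerA mulrC.
by rewrite !ffunE eqxx [_ *: _]mulr1.
Qed.

Local Notation C1 := (cat1 gens).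
Local Notation unit1 := (unit1 gens).

Lemma emb_actl_scalar c : emb (@actl K I (0, 0)%N (0, 0)%N (tens_scalar I c)) = c *: \1%VF.
Proof.
rewrite -emb_scale; congr emb; apply/lfunP=> y.
by rewrite actlE scale_lfunE id_lfunE; apply: act_scalar.
Qed.

Lemma hom_scalar c : invS gens (tens_scalar I c) ->
  @Defs.hom K C1 unit1 unit1 (c *: \1%VF).
Proof.
move=> Sc; rewrite -emb_actl_scalar; exact: (@hom_actl _ _ _ (0, 0)%N (0, 0)%N).
Qed.

Lemma hom_id_unit : @Defs.hom K C1 unit1 unit1 \1%VF.
Proof. by rewrite -[\1%VF]scale1r; apply/hom_scalar/invS_scalar1. Qed.

Lemma hom_id_W : @Defs.hom K C1 [:: (1, 0)%N] [:: (1, 0)%N] \1%VF.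
Proof.
have -> : \1%VF = emb (@actl K I (1, 0)%N (1, 0)%N (tens_id K I)).
  by rewrite -emb1; congr emb; apply/lfunP=> y; rewrite actlE id_lfunE act_id.
by apply: (@hom_actl _ _ _ (1, 0)%N (1, 0)%N); apply: iS_id.
Qed.

Let o0 : nat * nat := (0, 0)%N.
Let o1 : nat * nat := (1, 0)%N.
Let o2 : nat * nat := (0, 1)%N.

(** The tensor of w |-> trace (T_f w) lies in S^{0,1}, which is both the morphisms from the unit to
    the dual of W and those from W to the unit; [dualm] and [coordm] are its two readings. *)
Definition dualm a : 'Hom(fib0 K I o0, fib0 K I o2) :=
  @actl K I o0 o2 (trT_tensor (bas k a)).
Definition coordm a : 'Hom(fib0 K I o1, fib0 K I o0) :=
  @actl K I o1 o0 (trT_tensor (bas k a)).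
Definition tracem : 'Hom(fib0 K I o1, fib0 K I o2) := @actl K I o1 o2 trM_tensor.

Lemma dualmE a y : dualm a y =
  [ffun w : tix I 0 1 => tr (Top iota zeta (bas k a) (e (w.2 ord0))) * y (w.1, w.1)].
Proof.
rewrite /dualm actlE.
exact: (act_01 (f := fun c => tr (Top iota zeta (bas k a) (e c))) y (trT_tensorE _)).
Qed.

Lemma coordmE a y : coordm a y =
  [ffun w : tix I 0 0 => tr (Top iota zeta (bas k a) [ffun c => y ([ffun=> c], w.1)])].
Proof.
rewrite /coordm actlE.
rewrite [LHS](act_10 (f := fun c => tr (Top iota zeta (bas k a) (e c))) y (trT_tensorE _)).
apply/ffunP=> w; rewrite !ffunE; set v := [ffun c => _].
rewrite -[v in RHS]comb_id (lin_comb _ _ (Top_linear _)) (lin_comb _ _ tr_linear).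
by apply: eq_bigr => c _; rewrite ffunE; apply: mulrC.
Qed.

Lemma tracemE y : tracem y =
  [ffun w : tix I 0 1 => tr (mul (e (w.2 ord0)) [ffun c => y ([ffun=> c], w.1)])].
Proof.
rewrite /tracem actlE.
rewrite [LHS](act_11 (f := fun c d => tr (mul (e c) (e d))) y trM_tensorE).
apply/ffunP=> w; rewrite !ffunE; set v := [ffun c => _].
rewrite -[v in RHS]comb_id (lin_comb _ _ (mul_linearr _)) (lin_comb _ _ tr_linear).
by apply: eq_bigr => c _; rewrite [v c]ffunE; apply: mulrC.
Qed.

Lemma tr_mul_phi (u v : scT A) : tr (mul (phi u) (phi v)) = n2 * (u * v) (ix 0 0).
Proof. by rewrite phiM tr_phi. Qed.

Hypothesis b_neq0 : b != 0.

Lemma tracem_inj : lker tracem == 0%VS.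
Proof.
apply/lker0P => y1 y2 E; apply/eqP; rewrite -subr_eq0; apply/eqP.
have {E} : tracem (y1 - y2) = 0 by rewrite linearB /= E subrr.
move: (y1 - y2) => {y1 y2} y y0.
have emp : {ffun 'I_0 -> I} := ffun0 (card_ord 0).
pose v : fspace K I := [ffun c => y ([ffun=> c], emp)].
have tr0 u : tr (mul u v) = 0.
  have mL : linear (fun u => mul u v).
    by move=> c u1 u2; rewrite !twist_mulE // /tmul comb_linear.
  rewrite -[u]comb_id (lin_comb _ _ mL) (lin_comb _ _ tr_linear) /comb big1 // => c _.
  have : tracem y (emp, [ffun=> c]) = 0 by rewrite y0 ffunE.
  by rewrite tracemE ffunE /= ffunE -/v => ->; rewrite scaler0.
have v0 : phi^-1%VF v = 0.
  apply/ffunP=> c; rewrite [RHS]ffunE.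
  have [m m0 mE] := antidual_coord c (phi^-1%VF v) b_neq0.
  have := tr0 (phi (e (ixV c))); rewrite -{1}[v]phiVK tr_mul_phi mE => /eqP.
  by rewrite !mulf_eq0 (negPf n2_neq0) (negPf m0) => /eqP.
have {}v0 : v = 0 by rewrite -[v]phiVK v0 linear0.
apply/ffunP=> -[u w]; rewrite [RHS]ffunE (ffunI0 w emp).
have := congr1 (fun f : fspace K I => f (u ord0)) v0; rewrite !ffunE => E.
rewrite -[RHS]E; congr (fun_of_fin y (_, _)).
by apply/ffunP=> i; rewrite (ord1 i) ffunE.
Qed.

(** A K-linear identification of the dual of W with W, which makes [tracem] an endomorphism, so that
    injectivity provides a two-sided inverse. It is not claimed to be a morphism of the category. *)
Definition swapm : 'Hom(fib0 K I o2, fib0 K I o1) :=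
  linfun (fun y : tensor K I 0 1 => [ffun w : tix I 1 0 => y (w.2, w.1)] : tensor K I 1 0).

Lemma swapmE y : swapm y = [ffun w : tix I 1 0 => y (w.2, w.1)].
Proof.
pose f (y : tensor K I 0 1) : tensor K I 1 0 := [ffun w : tix I 1 0 => y (w.2, w.1)].
have fL : linear f by move=> c u v; apply/ffunP=> w; rewrite !ffunE.
pose F : {linear tensor K I 0 1 -> tensor K I 1 0} :=
  HB.pack f (GRing.isLinear.Build K (tensor K I 0 1) (tensor K I 1 0) _ f fL).
exact: (lfunE F y).
Qed.

Lemma swapm_inj : injective swapm.
Proof.
move=> x y; rewrite !swapmE => E; apply/ffunP=> -[u v].
by have := congr1 (fun t : tensor K I 1 0 => t (v, u)) E; rewrite !ffunE.
Qed.

Definition tracemV : 'Hom(fib0 K I o2, fib0 K I o1) :=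
  ((swapm \o tracem)^-1 \o swapm)%VF.

Lemma lker_swap_trace : lker (swapm \o tracem)%VF == 0%VS.
Proof.
apply/lker0P=> x y; rewrite !comp_lfunE => /swapm_inj; apply/lker0P.
exact: tracem_inj.
Qed.

Lemma tracemK : (tracemV \o tracem = \1)%VF.
Proof.
apply/lfunP=> y; rewrite !comp_lfunE id_lfunE -[swapm _]comp_lfunE.
exact: (lker0_lfunK lker_swap_trace).
Qed.

Lemma tracemVK : (tracem \o tracemV = \1)%VF.
Proof.
apply/lfunP=> y; apply: swapm_inj; rewrite !comp_lfunE id_lfunE -[swapm (tracem _)]comp_lfunE.
exact: (lker0_lfunVK lker_swap_trace).
Qed.

(** Both g x^(n-1) and g^(-1) x are antidiagonal, hence visible to the trace functionals, and their
    product involves x^n = b. Since (g^(-1) x)(g x^(n-1)) = z^(-1) b, the multiple by [kap] of the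
    first is dual to the second. *)
Let ga : I := ix 1 n.-1.
Let gd : I := ix n.-1 1.
Let kap : K := z / b.

Lemma dual_pair (v : scT A) : (v * (kap *: e ga : scT A)) (ix 0 0) = v gd.
Proof.
have n0 := ltnW n_gt1; have n1 : (n.-1 < n)%N by rewrite ltn_predL.
rewrite scmulE combE (bigD1 gd) //= big1 ?addr0 => [|d dN].
  rewrite [_ (ix 0 0)]combE (bigD1 ga) //= big1 ?addr0 => [|c /negPf cN]; last first.
    by rewrite !ffunE cN [_ *: _]mulr0 mul0r.
  rewrite !ffunE eqxx [kap *: _]mulr1 /= !modn_small // mul1n add1n addn1 prednK //.
  rewrite divnn n0 !expr1 /kap.
  have -> : (ix 0 0 == ix n n) by apply/eqP/eq_ix; rewrite modnn mod0n.
  rewrite -[true%:R]/(1 : K) [b *: _]mulr1; have z0 := prim_neq0 n_gt1 zP.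
  rewrite /GRing.scale /=; by field; rewrite z0 b_neq0.
have -> : comb (kap *: e ga) (msc z n_gt1 b d) (ix 0 0) = kap * msc z n_gt1 b d ga (ix 0 0).
  by rewrite combZl comb_bas !ffunE.
rewrite msc_coord; have -> : (ix 0 0 == ix (d.1 + ga.1) (d.2 + ga.2)) = false.
  have gaE : ga = ixV gd.
    have E : (n - n.-1 = 1)%N by rewrite -{1}(prednK n0) subSnn.
    apply: eq_ix => /=; first by rewrite (@modn_small n.-1 n) // E.
    by rewrite (@modn_small 1 n) // subn1.
  by rewrite gaE addnC [(d.2 + _)%N]addnC ixV_addE; apply/negbTE.
by rewrite !mulr0.
Qed.

Lemma antidiag_ga : antidiag ga.
Proof.
have n0 := ltnW n_gt1; have n1 : (n.-1 < n)%N by rewrite ltn_predL.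
by rewrite /antidiag /= (modn_small n_gt1) (modn_small n1) add1n prednK ?modnn.
Qed.

Lemma antidiag_gd : antidiag gd.
Proof.
have n0 := ltnW n_gt1; have n1 : (n.-1 < n)%N by rewrite ltn_predL.
by rewrite /antidiag /= (modn_small n_gt1) (modn_small n1) addn1 prednK ?modnn.
Qed.

(* Inverting the trace form, which only the kernel completion allows, closes a loop
   of morphisms at the unit object, whose value involves b^-1. *)
Lemma loop_scalar : (coordm ga \o (tracemV \o dualm gd) = (n2 * kap) *: \1)%VF.
Proof.
apply/lfunP=> y; rewrite comp_lfunE (comp_lfunE tracemV (dualm gd)) scale_lfunE id_lfunE.
have emp : {ffun 'I_0 -> I} := ffun0 (card_ord 0).
pose t := y (emp, emp); pose w : fspace K I := phi (kap *: e ga).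
(* The explicit preimage of [dualm gd y] under the trace form, found from [dual_pair]; it evaluates
   the inverse form at this one vector. *)
pose Y : tensor K I 1 0 := [ffun u : tix I 1 0 => t * w (u.1 ord0)].
have YE u : [ffun c => Y ([ffun=> c], u)] = t *: w :> fspace K I.
  by apply/ffunP=> c; rewrite !ffunE /= ?ffunE.
have -> : dualm gd y = tracem Y.
  rewrite dualmE tracemE; apply/ffunP=> -[u v]; rewrite !ffunE /= YE.
  have := tr_linear t (mul (e (v ord0)) w) 0; rewrite !addr0.
  have mZ : mul (e (v ord0)) (t *: w) = t *: mul (e (v ord0)) w.
    have := mul_linearr (e (v ord0)) t w 0; rewrite !addr0 => ->.
    have -> : mul (e (v ord0)) 0 = 0; last by rewrite addr0.
    by have := mul_linearr (e (v ord0)) (-1) 0 0; rewrite scaler0 addr0 scaleN1r addNr.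
  have tr0 : tr 0 = 0.
    by have := tr_linear (-1) 0 0; rewrite scaler0 addr0 scaleN1r addNr.
  rewrite tr0 addr0 -mZ => ->.
  rewrite -{1 2}[e (v ord0)]phiVK tr_mul_phi dual_pair tr_Top ?antidiag_gd //.
  by rewrite (ffunI0 u emp) mulrC.
rewrite -(comp_lfunE tracemV tracem) tracemK id_lfunE coordmE.
apply/ffunP=> -[u v]; rewrite !ffunE /= YE -linearZ /= tr_Top ?antidiag_ga //.
rewrite !ffunE eqxx (ffunI0 u emp) (ffunI0 v emp) -/t.
by rewrite /GRing.scale /=; ring.
Qed.

Lemma kerX_loop :
  @kerX K C1 (@kemb K C1 unit1) (@kemb K C1 unit1) (@klift K C1 unit1 unit1 ((n2 * kap) *: \1%VF)).
Proof.
have Sl : invS gens tr_tensor by apply/iS_contr/iS_gen; exact: cas_mul.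
have ST f : invS gens (trT_tensor f).
  by apply: iS_contr; apply: iS_mul Sl _; apply: iS_gen; exact: cas_Top.
have SM : invS gens trM_tensor.
  by apply: iS_contr; apply: iS_mul Sl _; apply: iS_gen; exact: cas_mul.
have E : (emb (coordm ga) \o (emb tracemV \o emb (dualm gd)))%VF = (n2 * kap) *: \1%VF.
  by rewrite -!emb_comp loop_scalar emb_scale.
have KV : @kerX K C1 (@kemb K C1 [:: o2]) (@kemb K C1 [:: o1]) (@klift K C1 [:: o2] [:: o1] (emb tracemV)).
  apply: (@klift_inv K C1 [:: o1] [:: o2] (emb tracem)).
  - by rewrite -emb_comp tracemK emb1.
  - by rewrite -emb_comp tracemVK emb1.
  - by apply: klift_hom; [exact: hom_id_W|exact: (@hom_actl _ _ _ o1 o2)].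
rewrite -E; have -> := @klift_comp K C1 unit1 [:: o1] unit1
  (emb tracemV \o emb (dualm gd))%VF (emb (coordm ga)).
have -> := @klift_comp K C1 unit1 [:: o2] [:: o1] (emb (dualm gd)) (emb tracemV).
apply: (@X_comp K C1 _ (@kemb K C1 [:: o1])).
  apply: (@X_comp K C1 _ (@kemb K C1 [:: o2])) KV.
  by apply: klift_hom; [exact: hom_id_unit|exact: (@hom_actl _ _ _ o0 o2)].
by apply: klift_hom; [exact: hom_id_W|exact: (@hom_actl _ _ _ o1 o0)].
Qed.

End Invariants.

Lemma field_in_invariants (k : fieldExtType rat) (K : closedFieldType)
  (iota : {rmorphism k -> K}) (n : nat) (zeta : k) (n_gt1 : (1 < n)%N)
  (zetaP : n.-primitive_root zeta) (al : cochain K n) (b a : K) phi :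
  model_iso n_gt1 (prim_iota iota zetaP) (acochain al) b phi ->
  canonical_scalar iota zeta al a -> forall c,
  gen_field (fun x => x = iota zeta \/ x = a) c ->
  field_of_invariants (comodule_algebra_structure iota zeta al) c.
Proof.
(* One kernel completion suffices: only morphisms of the first category have to be inverted. *)
move=> phiP /(canonical_scalar_phi phiP) aE c cA; exists 1%N.
set gens := comodule_algebra_structure iota zeta al.
have idP := hom_id_unit iota zetaP al.
apply: (@scalar_field K (cat1 gens) (unit1 gens) _ idP _ c cA) => {c cA} c.
have zK : @kerX K (cat1 gens) _ _ (@klift K (cat1 gens) (unit1 gens) (unit1 gens)
    (iota zeta *: \1%VF)).
  by apply: klift_hom => //; apply/hom_scalar/invS_scalar_zeta.
case=> ->; first exact: zK.
(* For b = 0 the scalar a is 0 and lies in the prime field, the field generated by the empty set. *)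
have [b0|b0] := eqVneq b 0.
  apply: (@scalar_field K (cat1 gens) (unit1 gens) (fun _ => False) idP) => //.
  by rewrite aE b0 mulr0; apply: gf0.
set m := (n * n)%:R : K; have m0 : m != 0 by exact: (n2_neq0 iota zetaP).
pose D x := x = iota zeta \/ x = m * (iota zeta / b).
apply: (@scalar_field K (cat1 gens) (unit1 gens) D idP).
  by move=> x [->|->]; [exact: zK|exact: (kerX_loop phiP b0)].
have Dz : gen_field D (iota zeta) by apply: gf_in; left.
rewrite aE; apply: gfM; first exact/gfV/gfX.
(* The loop yields m z / b and not b itself; with z at hand, b is recovered by a division. *)
have -> : b = m * iota zeta / (m * (iota zeta / b)).
  rewrite [m * (_ / _)]mulrA invf_div mulrC divfK //.
  by rewrite mulf_neq0 // (prim_neq0 n_gt1 (prim_iota iota zetaP)).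
apply: gf_div; first by apply: gfM Dz; apply: gf_nat.
by apply: gf_in; right.
Qed.

Theorem mainTheorem6 (n : nat) (n_ge2 : (2 <= n)%N)
    (K : closedFieldType) (charK0 : [pchar K] =i pred0)
    (k : fieldExtType rat) (zeta : k) (zeta_prim : n.-primitive_root zeta)
    (k_gen : <<1%VS; zeta>>%VS = fullv) (iota : {rmorphism k -> K}) :
  [/\ (forall al : cochain K n, two_cocycle iota zeta al ->
         exists! b : K, canonical_scalar iota zeta al b),
      (forall (al be : cochain K n) (a b : K),
         two_cocycle iota zeta al -> two_cocycle iota zeta be ->
         canonical_scalar iota zeta al a -> canonical_scalar iota zeta be b ->
         (cocycle_equiv iota zeta al be <-> a = b)),
      (forall b : K, exists2 al : cochain K n,
         two_cocycle iota zeta al & canonical_scalar iota zeta al b)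
    & (forall (al : cochain K n) (b : K),
         two_cocycle iota zeta al -> canonical_scalar iota zeta al b ->
         forall c : K,
           field_of_invariants (comodule_algebra_structure iota zeta al) c <->
           gen_field (fun x => x = iota zeta \/ x = b) c)].
Proof.
split.
- exact: (cscalar_exists n_ge2 zeta_prim).
- exact: (cscalar_equiv n_ge2 zeta_prim).
- exact: (cscalar_onto iota n_ge2 zeta_prim).
move=> al b /(two_cocycleP n_ge2 zeta_prim) [b' [phi phiP]] ab c.
by split; [exact: (invariants_in_field phiP k_gen ab)|exact: (field_in_invariants phiP ab)].
Qed.
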